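(* Let $f_{32.2.a.a} = \eta^2(4z)\, \eta^2(8z) = \sum_{n\geq1} a_n(f_{32.2.a.a})\, e^{2\pi \mathrm{i} n z} \in S_2(\Gamma_0(32))$. If $p$ is an odd prime, then $${}_{4}G_{4}\left[ \begin{array}{cccc} \frac{1}{4}, & \frac{3}{4}, & \frac{1}{4}, & \frac{3}{4} \\ 1, & \frac{1}{2}, & 1, & \frac{1}{2} \end{array} \Big| \; 1 \right]_p = \varphi(-1) + a_p(f_{32.2.a.a}).$$
   Context: $\eta(z)=e^{2\pi \mathrm{i}z/24}\prod_{n\ge1}(1-e^{2\pi \mathrm{i}nz})$ is the Dedekind eta function and $\varphi$ is the quadratic character of $\mathbb{F}_p$. $\Gamma_p$ is Morita's $p$-adic gamma function on $\mathbb{Z}_p$: $\Gamma_p(n):=(-1)^n\prod_{0<j<n,\,p\nmid j}j$ for $n\in\mathbb{Z}^+$, extended continuously, with $\Gamma_p(0)=1$. $\omega:\mathbb{F}_p^*\to\mathbb{Z}_p^{\times}$ is the Teichmüller character ($\omega(x)$ is the $(p-1)$-st root of unity congruent to $x$ mod $p$), $\overline{\omega}$ its inverse, all powers (including the trivial one) extended by $0$ at $0$. For $x\in\mathbb{Q}$, $\langle x\rangle=x-\lfloor x\rfloor$. For an odd prime $p$, $\lambda\in\mathbb{F}_p$ and $a_i,b_i\in\mathbb{Q}\cap\mathbb{Z}_p$ ($1\le i\le m$), $${}_{m}G_{m}\left[ \begin{array}{ccc} a_1, & \dots, & a_m \\ b_1, & \dots, & b_m \end{array} \Big| \; \lambda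 \right]_p := \frac{-1}{p-1} \sum_{j=0}^{p-2} (-1)^{jm}\, \overline{\omega}^j(\lambda) \prod_{i=1}^{m} \frac{\Gamma_p(\langle a_i -\frac{j}{p-1} \rangle)}{\Gamma_p(\langle a_i \rangle)} \frac{\Gamma_p(\langle -b_i +\frac{j}{p-1} \rangle)}{\Gamma_p(\langle -b_i \rangle)} (-p)^{-\lfloor\langle a_i \rangle -\frac{j}{p-1}\rfloor -\lfloor\langle -b_i\rangle +\frac{j}{p-1}\rfloor}.$$ *)

(* Defs.v *)
From HB Require Import structures.
From mathcomp Require Import all_boot all_order all_algebra all_field.
From mathcomp Require Import cyclic complex.
From mathcomp Require Import all_classical all_reals all_analysis.
Set Implicit Arguments.
Unset Strict Implicit.
Unset Printing Implicit Defensive.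

Import Order.TTheory GRing.Theory Num.Theory.
Import numFieldNormedType.Exports.
Local Open Scope classical_set_scope.
Local Open Scope ring_scope.

(* An element of Z_p = lim Z/p^n, given by its residues mod p^n in [0, p^n);
   padic_compat forces padic_res x n < p^n. The primality proof is a parameter
   of the type so that it can carry integral domain structure. *)
Record padic_int (p : nat) (pp : prime p) := PadicInt {
  padic_res : nat -> nat;
  padic_compat : forall n, padic_res n = (padic_res n.+1 %% p ^ n)%N }.

Section PadicRing.
Context (p : nat) (pp : prime p).
Local Notation Zp := (padic_int pp).
Implicit Types x y z : Zp.

Let pn_gt0 n : (0 < p ^ n)%N. Proof. by rewrite expn_gt0 prime_gt0. Qed.

Lemma padic_resP x y : padic_res x =1 padic_res y -> x = y.
Proof.
case: x y => [u hu] [v hv] /= /funext uv; subst v.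
by congr PadicInt; apply: Prop_irrelevance.
Qed.

Lemma padic_res_mod x n : (padic_res x n %% p ^ n)%N = padic_res x n.
Proof. by rewrite [in RHS]padic_compat [in LHS]padic_compat modn_mod. Qed.

Lemma padic_res_lt x n : (padic_res x n < p ^ n)%N.
Proof. by rewrite -padic_res_mod ltn_mod. Qed.

Lemma padic_res_add x n k : (padic_res x (n + k) %% p ^ n)%N = padic_res x n.
Proof.
elim: k => [|k IH]; first by rewrite addn0 padic_res_mod.
rewrite -[RHS]IH addnS (padic_compat x (n + k)) modn_dvdm //.
by rewrite expnD dvdn_mulr.
Qed.

Lemma padic_res_le x m n : (m <= n)%N ->
  (padic_res x n %% p ^ m)%N = padic_res x m.
Proof. by move/subnKC <-; exact: padic_res_add. Qed.

Fact padic_mk_compat (u : nat -> nat) :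
  (forall n, u n.+1 = u n %[mod p ^ n]) ->
  forall n, (u n %% p ^ n = (u n.+1 %% p ^ n.+1) %% p ^ n)%N.
Proof. by move=> hu n; rewrite modn_dvdm ?hu // dvdn_exp2l. Qed.

Definition padic_mk u hu : Zp := PadicInt pp (@padic_mk_compat u hu).

Let resS x n : padic_res x n.+1 = padic_res x n %[mod p ^ n].
Proof. by rewrite [in RHS]padic_compat modn_mod. Qed.

Fact padic_nat_subproof (k n : nat) : k = k %[mod p ^ n]. Proof. by []. Qed.
Definition padic_nat k := padic_mk (padic_nat_subproof k).

Fact padic_add_subproof x y n :
  (padic_res x n.+1 + padic_res y n.+1)%N =
  (padic_res x n + padic_res y n)%N %[mod p ^ n].
Proof. by rewrite -modnDm !resS modnDm. Qed.
Definition padic_add x y := padic_mk (padic_add_subproof x y).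

Fact padic_mul_subproof x y n :
  (padic_res x n.+1 * padic_res y n.+1)%N =
  (padic_res x n * padic_res y n)%N %[mod p ^ n].
Proof. by rewrite -modnMm !resS modnMm. Qed.
Definition padic_mul x y := padic_mk (padic_mul_subproof x y).

Fact padic_opp_subproof x n :
  (p ^ n.+1 - padic_res x n.+1)%N = (p ^ n - padic_res x n)%N %[mod p ^ n].
Proof.
apply/eqP; rewrite -(eqn_modDr (padic_res x n)).
rewrite subnK ?(ltnW (padic_res_lt _ _)) // -modnDmr -(resS x) modnDmr.
by rewrite subnK ?(ltnW (padic_res_lt _ _)) // modnn expnS modnMl.
Qed.
Definition padic_opp x := padic_mk (padic_opp_subproof x).

HB.instance Definition _ := gen_eqMixin Zp.
HB.instance Definition _ := gen_choiceMixin Zp.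

Fact padic_addA : associative padic_add.
Proof. by move=> x y z; apply: padic_resP => n /=; rewrite modnDml modnDmr addnA. Qed.
Fact padic_addC : commutative padic_add.
Proof. by move=> x y; apply: padic_resP => n /=; rewrite addnC. Qed.
Fact padic_add0 : left_id (padic_nat 0) padic_add.
Proof. by move=> x; apply: padic_resP => n /=; rewrite mod0n padic_res_mod. Qed.
Fact padic_addN : left_inverse (padic_nat 0) padic_opp padic_add.
Proof.
move=> x; apply: padic_resP => n /=.
by rewrite modnDml subnK ?(ltnW (padic_res_lt _ _)) // modnn mod0n.
Qed.
HB.instance Definition _ := GRing.isZmodule.Build Zp
  padic_addA padic_addC padic_add0 padic_addN.

Fact padic_mulA : associative padic_mul.
Proof. by move=> x y z; apply: padic_resP => n /=; rewrite modnMml modnMmr mulnA. Qed.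
Fact padic_mulC : commutative padic_mul.
Proof. by move=> x y; apply: padic_resP => n /=; rewrite mulnC. Qed.
Fact padic_mul1 : left_id (padic_nat 1) padic_mul.
Proof. by move=> x; apply: padic_resP => n /=; rewrite modnMml mul1n padic_res_mod. Qed.
Fact padic_mulD : left_distributive padic_mul padic_add.
Proof.
by move=> x y z; apply: padic_resP => n /=; rewrite modnMml mulnDl modnDm.
Qed.
Fact padic_oner_neq0 : padic_nat 1 != 0.
Proof.
apply/eqP => /(congr1 (fun x => padic_res x 1)) /=.
by rewrite expn1 mod0n modn_small // prime_gt1.
Qed.
HB.instance Definition _ := GRing.Zmodule_isComNzRing.Build Zp
  padic_mulA padic_mulC padic_mul1 padic_mulD padic_oner_neq0.

Definition padic_unit : pred Zp := fun x => `[< exists y, y * x = 1 >].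
Definition padic_inv x : Zp := xget x [set y | y * x = 1].

Fact padic_mulVx : {in padic_unit, left_inverse 1 padic_inv *%R}.
Proof. by move=> x /asboolP [y yx]; rewrite /padic_inv; case: xgetP => [z _ //|/(_ y)]. Qed.
Fact padic_unitP x y : y * x = 1 -> padic_unit x.
Proof. by move=> yx; apply/asboolP; exists y. Qed.
Fact padic_inv_out : {in [predC padic_unit], padic_inv =1 id}.
Proof.
move=> x /negP nx; rewrite /padic_inv; case: xgetP => // y _ yx.
by case: nx; exact: padic_unitP yx.
Qed.
HB.instance Definition _ := GRing.ComNzRing_hasMulInverse.Build Zp
  padic_mulVx padic_unitP padic_inv_out.

Lemma padic_resD x y n :
  padic_res (x + y) n = ((padic_res x n + padic_res y n) %% p ^ n)%N.
Proof. by []. Qed.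
Lemma padic_resM x y n :
  padic_res (x * y) n = ((padic_res x n * padic_res y n) %% p ^ n)%N.
Proof. by []. Qed.
Lemma padic_res_nat k n : padic_res (k%:R : Zp) n = (k %% p ^ n)%N.
Proof.
elim: k => [|k IH]; first by rewrite mulr0n.
by rewrite -addn1 natrD padic_resD IH /= modnDm.
Qed.

Fact padic_mulf_eq0 x y : x * y = 0 -> (x == 0) || (y == 0).
Proof.
move=> xy0; apply: contrapT => /negP; rewrite negb_or => /andP[x0 y0].
have nz z : z != 0 -> exists n, padic_res z n != 0%N.
  move=> /eqP z0; apply: contrapT => /forallNP h; apply: z0.
  by apply: padic_resP => n /=; rewrite mod0n; apply/eqP/negPn/negP/h.
have [m xm] := nz _ x0; have [n yn] := nz _ y0.
pose a := padic_res x (m + n); pose b := padic_res y (m + n).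
have ndvd z k l : padic_res z k != 0%N -> (k <= l)%N ->
    ~~ (p ^ k %| padic_res z l)%N.
  by move=> zk kl; rewrite /dvdn padic_res_le.
have na : ~~ (p ^ m %| a)%N by apply: ndvd => //; exact: leq_addr.
have nb : ~~ (p ^ n %| b)%N by apply: ndvd => //; exact: leq_addl.
have a0 : (0 < a)%N by rewrite lt0n; apply: contra na => /eqP ->.
have b0 : (0 < b)%N by rewrite lt0n; apply: contra nb => /eqP ->.
have /eqP := congr1 (fun z => padic_res z (m + n)) xy0.
rewrite /= mod0n -/a -/b -/(dvdn _ _) pfactor_dvdn ?muln_gt0 ?a0 //.
move: na nb; rewrite !pfactor_dvdn // -!ltnNge => la lb.
by rewrite lognM // leqNgt -addnS (leq_add (ltnW la) lb).
Qed.
HB.instance Definition _ :=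
  GRing.ComUnitRing_isIntegral.Build Zp padic_mulf_eq0.


Lemma padic_unitE x : (x \is a GRing.unit) = (padic_res x 1 != 0%N).
Proof.
apply/idP/idP => [/unitrPr [y /(congr1 (fun z => padic_res z 1))] /=|x1].
  rewrite expn1 (modn_small (prime_gt1 pp)) => xy.
  by apply/eqP => x0; move: xy; rewrite x0 mul0n mod0n.
have co n : coprime (padic_res x n) (p ^ n).
  case: n => [|n]; first by rewrite expn0 coprimen1.
  rewrite coprime_sym coprime_pexpl // prime_coprime //.
  by rewrite /dvdn -[in X in (_ %% X)%N](expn1 p) padic_res_le.
pose v n := (padic_res x n ^ (totient (p ^ n)).-1)%N.
have xv n : (padic_res x n * v n = 1 %[mod p ^ n])%N.
  by rewrite /v -expnS prednK ?totient_gt0 // Euler_exp_totient.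
have hv n : (v n.+1 = v n %[mod p ^ n])%N.
  have x'v' : (padic_res x n.+1 * v n.+1 = 1 %[mod p ^ n])%N.
    have d : (p ^ n %| p ^ n.+1)%N by rewrite dvdn_exp2l.
    by rewrite -[LHS](modn_dvdm _ d) xv modn_dvdm.
  rewrite -[in LHS](muln1 (v n.+1)) -modnMmr -xv modnMmr mulnA.
  rewrite (mulnC (v n.+1)) -modnMml -(modnMml (padic_res x n)) -resS.
  by rewrite (modnMml (padic_res x n.+1)) x'v' modnMml mul1n.
apply/unitrPr; exists (padic_mk hv); apply: padic_resP => n /=.
by rewrite modnMmr xv.
Qed.

(* The p-adic topology: the balls x + p^n Z_p form a neighbourhood basis. *)
HB.instance Definition _ := hasNbhs.Build Zp
  (fun x => [set A | exists n, forall y, padic_res y n = padic_res x n -> A y]).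

Fact padic_nbhs_filter x : ProperFilter (nbhs x).
Proof.
apply: Build_ProperFilter_ex.
  by move=> A [n An]; exists x; apply: An.
split=> [|A B [m Am] [n Bn]|A B AB [n An]]; first by exists 0%N.
  exists (maxn m n) => y yx; split; [apply: Am|apply: Bn];
  by rewrite -(padic_res_le y (leq_maxl m n)) -(padic_res_le x (leq_maxl m n)) yx
          || rewrite -(padic_res_le y (leq_maxr m n)) -(padic_res_le x (leq_maxr m n)) yx.
by exists n => y /An /AB.
Qed.
Fact padic_nbhs_singleton x (A : set Zp) : nbhs x A -> A x.
Proof. by move=> [n]; apply. Qed.
Fact padic_nbhs_nbhs x (A : set Zp) : nbhs x A -> nbhs x (nbhs^~ A).
Proof. by move=> [n An]; exists n => y yx; exists n => z zy; apply: An; rewrite zy. Qed.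
HB.instance Definition _ := Nbhs_isNbhsTopological.Build Zp
  padic_nbhs_filter padic_nbhs_singleton padic_nbhs_nbhs.

Lemma padic_continuousP (f : Zp -> Zp) : continuous f <->
  forall x n, exists m, forall y,
    padic_res y m = padic_res x m -> padic_res (f y) n = padic_res (f x) n.
Proof.
split=> [fc x n|fc x A [n An]].
  by apply: (fc x [set z | padic_res z n = padic_res (f x) n]); exists n.
by have [m fm] := fc x n; exists m => y /fm /An.
Qed.

Record is_morita_gamma (G : Zp -> Zp) : Prop := IsMoritaGamma {
  morita_gamma_continuous : continuous G;
  morita_gamma_nat : forall n, (0 < n)%N ->
    G n%:R = (-1) ^+ n * \prod_(1 <= j < n | ~~ (p %| j)%N) j%:R;
  morita_gamma0 : G 0 = 1 }.

Definition morita_gamma : Zp -> Zp := xget (fun=> 1) is_morita_gamma.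

Record is_teichmuller (x : 'F_p) (t : Zp) : Prop := IsTeichmuller {
  teichmuller_unity : t ^+ p.-1 = 1;
  teichmuller_res : padic_res t 1 = x }.

Definition teichmuller (x : 'F_p) : Zp :=
  if x == 0 then 0 else xget 0 (is_teichmuller x).

Lemma padic_res0 x : padic_res x 0 = 0%N.
Proof. by rewrite -padic_res_mod modn1. Qed.

Lemma modn_exp_prime n a b : a = b %[mod p ^ n.+1] ->
  (a ^ p = b ^ p %[mod p ^ n.+2])%N.
Proof.
wlog le_ba : a b / (b <= a)%N.
  by move=> H ab; case/orP: (leq_total b a) => [/H|/H h]; [exact|exact/esym/h].
move=> /eqP; rewrite eqn_mod_dvd // => ab; apply/eqP.
rewrite eqn_mod_dvd ?leq_exp2r ?prime_gt0 // subn_exp expnSr dvdn_mul //.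
have ab1 : a = b %[mod p].
  by apply/eqP; rewrite eqn_mod_dvd // (dvdn_trans _ ab) // dvdn_exp.
rewrite /dvdn -modn_summ.
under eq_bigr => i _.
  rewrite -modnMmr -modnXm -ab1 modnXm modnMmr -expnD subnK; last first.
    by rewrite -ltnS prednK ?prime_gt0.
  over.
by rewrite modn_summ sum_nat_const card_ord modnMr.
Qed.

Lemma padic_resX x k n : padic_res (x ^+ k) n = (padic_res x n ^ k %% p ^ n)%N.
Proof.
elim: k => [|k IH]; first by rewrite expr0 -[1]/(1%:R) padic_res_nat.
by rewrite exprS padic_resM IH modnMmr expnS.
Qed.

Lemma teichmuller_uniq (u : 'F_p) x y :
  is_teichmuller u x -> is_teichmuller u y -> x = y.
Proof.
have fix_ t : t ^+ p.-1 = 1 -> t ^+ p = t.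
  by move=> t1; rewrite -(prednK (prime_gt0 pp)) exprS t1 mulr1.
move=> [/fix_ xp x1] [/fix_ yp y1]; apply: padic_resP.
elim=> [|[|n] IH].
- by rewrite !padic_res0.
- by rewrite x1 y1.
by rewrite -xp -yp !padic_resX; apply: modn_exp_prime; rewrite !padic_res_le.
Qed.

Lemma teichmuller_ex (u : 'F_p) : u != 0 -> exists t : Zp, is_teichmuller u t.
Proof.
move=> u0; have up : (u < p)%N by rewrite -[X in (_ < X)%N](Fp_cast pp) ltn_ord.
have fermat : (u ^ p = u %[mod p])%N.
  have h := expf_card u; rewrite card_Fp // in h.
  have := congr1 (@nat_of_ord _) h.
  by rewrite -[in u ^+ p](natr_Zp u) -natrX val_Fp_nat // (modn_small up).
have step n : ((u ^ p ^ n) ^ p = u ^ p ^ n %[mod p ^ n.+1])%N.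
  elim: n => [|n IH]; first by rewrite expn1 expn0 fermat.
  by rewrite expnSr expnM; apply: modn_exp_prime.
have hu n : (u ^ p ^ n.+1 = u ^ p ^ n %[mod p ^ n])%N.
  have d : (p ^ n %| p ^ n.+1)%N by rewrite dvdn_exp2l.
  by rewrite expnSr expnM -[LHS](modn_dvdm _ d) step modn_dvdm.
pose t := padic_mk hu; exists t.
have t1 : padic_res t 1 = u.
  by rewrite /= expn1 fermat modn_small.
have t0 : t != 0.
  apply/eqP => t0; move: t1; rewrite t0 /= mod0n => /esym u00.
  by case/negP: u0; apply/eqP/val_inj.
split=> //; apply: (mulfI t0); rewrite -exprS prednK ?prime_gt0 // mulr1.
apply: padic_resP => n; rewrite padic_resX /= modnXm -expnM -expnSr hu //.
Qed.

Lemma teichmullerP (u : 'F_p) : u != 0 -> is_teichmuller u (teichmuller u).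
Proof.
move=> u0; rewrite /teichmuller (negbTE u0).
by case: xgetP => // h; have [t /h] := teichmuller_ex u0.
Qed.

Lemma morita_gamma_uniq (G H : Zp -> Zp) :
  is_morita_gamma G -> is_morita_gamma H -> G = H.
Proof.
move=> [/padic_continuousP Gc GN _] [/padic_continuousP Hc HN _].
apply/funext => x; apply: padic_resP => n.
have [k Gk] := Gc x n; have [l Hl] := Hc x n.
pose m := (padic_res x (k + l) + p ^ (k + l))%N.
have m0 : (0 < m)%N by rewrite addn_gt0 pn_gt0 orbT.
have mx : forall j, (j <= k + l)%N -> padic_res (m%:R : Zp) j = padic_res x j.
  move=> j jkl; rewrite padic_res_nat /m -modnDmr.
  by rewrite (eqP (dvdn_exp2l p jkl)) addn0 padic_res_le.
rewrite -(Gk m%:R) ?mx ?leq_addr // -(Hl m%:R) ?mx ?leq_addl //.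
by rewrite GN // HN.
Qed.

Let A k : nat := (\prod_(1 <= j < k | ~~ (p %| j)) j)%N.

Lemma wilson_pow n : odd p -> (p ^ n.+1 %| (A (p ^ n.+1)).+1)%N.
Proof.
move=> podd; set q := (p ^ n.+1)%N.
have q1 : (1 < q)%N by rewrite (ltn_exp2l 0) ?prime_gt1.
have p0 := prime_gt0 pp.
have pdvdq : (p %| q)%N by rewrite /q expnS dvdn_mulr.
have sq : (A q * A q = 1 %[mod q])%N.
  have AZ : (A q)%:R = \prod_(x : 'Z_q | x \is a GRing.unit) x.
    rewrite /A natr_prod.
    have -> : \prod_(1 <= j < q | ~~ (p %| j)%N) (j%:R : 'Z_q) =
              \prod_(0 <= j < (Zp_trunc q).+2 | ~~ (p %| j)%N) j%:R.
      by rewrite Zp_cast // [in RHS]big_ltn_cond ?dvdn0 // ltnW.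
    rewrite big_mkord; apply: eq_big => [x|x _]; last by rewrite natr_Zp.
    by rewrite -{2}(natr_Zp x) unitZpE // coprime_pexpl // prime_coprime.
  have : (A q * A q)%:R = 1 :> 'Z_q.
    rewrite natrM {1}AZ (reindex_inj (@invr_inj 'Z_q)) /=.
    under eq_bigl do rewrite unitrV.
    by rewrite AZ -big_split big1 //= => x xu; rewrite mulVr.
  by move/(congr1 (@nat_of_ord _)); rewrite -[1]/(1%:R) !val_Zp_nat.
have wil : (A p = p.-1 %[mod p])%N.
  have -> : A p = (p.-1)`!.
    rewrite fact_prod prednK // /A big_nat_cond [RHS]big_nat_cond.
    apply: eq_bigl => j; case: (boolP (0 < j < p)%N) => //= /andP[j1 jp].
    by rewrite gtnNdvd.
  have := Wilson (prime_gt1 pp); rewrite pp => /esym wp.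
  apply/eqP; rewrite -(eqn_modDr 1) !addn1 prednK // modnn; exact: wp.
have per k : (A (k.+1 * p) = A (k * p) * A p %[mod p])%N.
  have kp j : (p %| k * p + j)%N = (p %| j)%N by rewrite dvdn_addr ?dvdn_mull.
  case: k kp => [|k] kp; first by rewrite mul1n mul0n {2}/A big_geq // mul1n.
  rewrite {1}/A (@big_cat_nat _ _ _ (k.+1 * p)) ?muln_gt0 ?p0 ?leq_pmul2r //=.
  rewrite -[X in (_ * \prod_(X <= _ < _ | _) _)%N]add0n.
  rewrite [X in (_ * \prod_(_ <= _ < X | _) _)%N]mulSn big_addn addnK.
  rewrite -modnMmr -[RHS]modnMmr; congr (_ * _ %% _)%N.
  rewrite big_ltn_cond // add0n dvdn_mull //= /A.
  under eq_bigl do rewrite addnC kp.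
  apply: (big_rec2 (fun u v => u = v %[mod p])) => // j u v _ uv.
  by rewrite -modnMm uv addnC modnMDl modnMm.
have cop k : (A (k.+1 * p) = p.-1 ^ k.+1 %[mod p])%N.
  elim: k => [|k IH]; first by rewrite mul1n wil.
  by rewrite per -modnMm IH wil modnMm -expnSr.
have sqm : (p.-1 ^ 2 = 1 %[mod p])%N.
  have -> : (p.-1 ^ 2 = p.-2 * p + 1)%N.
    by case: (p) (prime_gt1 pp) => [|[|k]] // _ /=; rewrite expnS expn1 mulSn [in RHS]mulnS addn1.
  by rewrite modnMDl.
have m1 : (p %| (A q).+1)%N.
  have qE : q = ((p ^ n).-1.+1 * p)%N by rewrite prednK // /q expnSr.
  have oq : odd (p ^ n) by rewrite oddX podd orbT.
  rewrite /dvdn -addn1 -modnDml qE cop prednK // -(odd_double_half (p ^ n)) oq.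
  rewrite expnD -muln2 mulnC expnM expnAC -modnMml -modnXm sqm modnXm exp1n.
  by rewrite modnMml mul1n expn1 modnDml addn1 prednK // modnn.
have A0 : (0 < A q)%N.
  by rewrite lt0n; apply/eqP => A0; move: m1; rewrite A0 dvdn1; case: eqP pp => // ->.
have aux a : (0 < a)%N -> (a.-1 * a.+1 = a * a - 1)%N.
  by case: a => // a _; rewrite /= mulnS mulSn subn1.
have : (q %| (A q).-1 * (A q).+1)%N.
  by move/eqP: sq; rewrite eqn_mod_dvd ?muln_gt0 ?A0 // aux.
rewrite Gauss_dvdr // /q coprime_pexpl // prime_coprime //.
apply/negP => m2; have := dvdn_sub m1 m2.
have -> : ((A q).+1 - (A q).-1 = 2)%N by case: (A q) A0 => // a _; rewrite /= -add2n addnK.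
by move/dvdn_leq => /(_ isT); case: (p) pp podd => [|[|[|k]]].
Qed.

Lemma morita_gamma_ex : odd p -> exists G : Zp -> Zp, is_morita_gamma G.
Proof.
move=> podd.
pose E n x y := padic_res x n = padic_res y n.
have EM n x x' y y' : E n x x' -> E n y y' -> E n (x * y) (x' * y').
  by rewrite /E !padic_resM => -> ->.
pose B a b : Zp := \prod_(a <= j < b | ~~ (p %| j)%N) j%:R.
pose g k : Zp := (-1) ^+ k * B 1%N k.
have BW n : E n.+1 (B 1%N (p ^ n.+1)%N) (-1).
  have -> : B 1%N (p ^ n.+1)%N = (A (p ^ n.+1))%:R by rewrite natr_prod.
  rewrite /E; apply/eqP.
  suff : E n.+1 ((A (p ^ n.+1))%:R + 1 - 1) (0 - 1 : Zp).
    by rewrite addrK sub0r /E => ->.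
  rewrite /E [LHS]padic_resD [RHS]padic_resD; congr ((_ + _) %% _)%N.
  rewrite natr1 padic_res_nat /= mod0n; apply/eqP; exact: wilson_pow podd.
have Bshift n k : E n.+1 (B k (k + p ^ n.+1)%N) (-1).
  elim: k => [|k IH].
    by rewrite add0n /B big_ltn_cond // dvdn0; exact: BW.
  have kq : (k < k + p ^ n.+1)%N by rewrite -ltn_subLR // subnn.
  have pkq : (p %| k + p ^ n.+1)%N = (p %| k)%N.
    by rewrite dvdn_addl // expnS dvdn_mulr.
  have [pk|npk] := boolP (p %| k)%N.
    suff -> : B k.+1 (k.+1 + p ^ n.+1)%N = B k (k + p ^ n.+1)%N by [].
    rewrite /B addSn [RHS]big_ltn_cond // pk /= [LHS]big_mkcond big_nat_recr //=.
    by rewrite pkq pk mulr1 -big_mkcond.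
  have ku : (k%:R : Zp) \is a GRing.unit.
    by rewrite padic_unitE padic_res_nat expn1.
  have BE : k%:R * B k.+1 (k.+1 + p ^ n.+1)%N =
            B k (k + p ^ n.+1)%N * (k + p ^ n.+1)%:R.
    rewrite /B addSn [in RHS]big_ltn_cond // npk /= [in LHS]big_mkcond.
    by rewrite big_nat_recr //= pkq npk -big_mkcond mulrA.
  rewrite -[B _ _](mulKr ku) BE mulrCA.
  rewrite -[in X in E _ _ X](mulr1 (-1)); apply: (EM _) => //.
  rewrite -[X in E _ _ X](mulVr ku).
  apply: (EM _) => //.
  by rewrite /E !padic_res_nat modnDr.
have gE n k l : (k = l %[mod p ^ n.+1])%N -> E n.+1 (g k) (g l).
  have gS m : E n.+1 (g (m + p ^ n.+1)%N) (g m).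
    have q0 : (0 < p ^ n.+1)%N by [].
    have -> : g (m + p ^ n.+1)%N = g m * (- B m (m + p ^ n.+1)%N).
      rewrite /g exprD -[(-1) ^+ (p ^ n.+1)]signr_odd oddX podd orbT expr1.
      rewrite mulrN1 mulNr mulrN -mulrA; congr (- (_ * _)).
      case: m => [|m]; last by rewrite /B -big_cat_nat // leq_addr.
      have -> : B 1%N 0%N = 1 by rewrite /B big_geq.
      by rewrite mul1r add0n /B [RHS]big_ltn_cond // dvdn0.
    rewrite -[X in E _ _ X]mulr1; apply: (EM _) => //.
    have := EM n.+1 (-1) (-1) _ _ erefl (Bshift n m).
    by rewrite mulN1r mulrNN mulr1.
  have gk m j : E n.+1 (g (m + j * p ^ n.+1)%N) (g m).
    elim: j => [|j IH]; first by rewrite mul0n addn0.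
    by rewrite mulSn addnCA addnC /E gS IH.
  have gm m : E n.+1 (g m) (g (m %% p ^ n.+1)%N).
    by have := gk (m %% p ^ n.+1)%N (m %/ p ^ n.+1)%N; rewrite addnC -divn_eq.
  by move=> kl; rewrite /E gm kl -gm.
have hG x n : (padic_res (g (padic_res x n.+1)) n.+1 =
               padic_res (g (padic_res x n)) n %[mod p ^ n])%N.
  rewrite padic_res_le // [RHS]padic_res_mod; case: n => [|n].
    by rewrite !padic_res0.
  by apply: gE; rewrite padic_res_le // padic_res_mod.
pose G x := padic_mk (hG x).
have GE x n : padic_res (G x) n = padic_res (g (padic_res x n)) n.
  exact: padic_res_mod.
have Gnat k : G k%:R = g k.
  apply: padic_resP => -[|n].
    by rewrite !padic_res0.
  by rewrite GE; apply: gE; rewrite padic_res_nat modn_mod.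
exists G; split=> [|n _|].
- by apply/padic_continuousP => x n; exists n => y yx; rewrite !GE yx.
- exact: Gnat.
- by rewrite (Gnat 0%N) /g /B big_geq // expr0 mulr1.
Qed.

Lemma morita_gammaP : odd p -> is_morita_gamma morita_gamma.
Proof.
move=> podd; rewrite /morita_gamma.
by case: xgetP => // h; have [G /h] := morita_gamma_ex podd.
Qed.

End PadicRing.

Notation "''Q_[' pp ]" := {fraction padic_int pp}
  (at level 8, format "''Q_[' pp ]") : type_scope.

Definition quad_char (p : nat) (x : 'F_p) : int :=
  if x == 0 then 0 else if [exists y, y ^+ 2 == x] then 1 else -1.

Definition fracpart (x : rat) : rat := x - (Num.floor x)%:~R.

Section HypergeometricG.
Context (p : nat) (pp : prime p).

(* Gamma_p at a rational number of Z_p; the value is irrelevant when p divides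
   the denominator. *)
Definition gammaQ (x : rat) : 'Q_[pp] := tofrac (morita_gamma (ratr x : padic_int pp)).

(* The j-th power of the inverse Teichmuller character; it is 0 at 0 even for
   j = 0. *)
Definition teichmullerV_exp (j : nat) (x : 'F_p) : padic_int pp :=
  if x == 0 then 0 else (teichmuller pp x)^-1 ^+ j.

Definition hypergeomG m (a b : m.-tuple rat) (lam : 'F_p) : 'Q_[pp] :=
  -1 / (p%:R - 1) *
  \sum_(0 <= j < p.-1)
    let t : rat := j%:R / (p%:R - 1) in
    (-1) ^+ (j * m) * tofrac (teichmullerV_exp j lam) *
    \prod_(i < m)
      (gammaQ (fracpart (tnth a i - t)) / gammaQ (fracpart (tnth a i)) *
       (gammaQ (fracpart (- tnth b i + t)) / gammaQ (fracpart (- tnth b i))) *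
       (- p%:R) ^ (- Num.floor (fracpart (tnth a i) - t)
                   - Num.floor (fracpart (- tnth b i) + t))).

End HypergeometricG.

Section Eta.
Context (R : realType).

(* R[i] seen through its numClosedFieldType structure, from which it gets the
   topology of the modulus. *)
Definition cplx : numClosedFieldType := R[i].
Implicit Types z : cplx.

Definition cexp z : cplx :=
  Complex (expR (complex.Re z) * cos (complex.Im z))
          (expR (complex.Re z) * sin (complex.Im z)).

Definition expi2pi z : cplx := cexp (2%:R * Complex pi 0 * 'i * z).

Definition dedekind_eta z : cplx :=
  expi2pi (z / 24%:R) *
  lim (\prod_(1 <= n < N) (1 - expi2pi (n%:R * z)) @[N --> \oo]).

Definition is_q_expansion (a : nat -> cplx) (f : cplx -> cplx) :=
  forall z, 0 < 'Im z ->
    \sum_(1 <= n < N) a n * expi2pi (n%:R * z) @[N --> \oo] --> f z.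

Definition f_32_2_a_a z : cplx := dedekind_eta (4%:R * z) ^+ 2 * dedekind_eta (8%:R * z) ^+ 2.

End Eta.

(* Main.v *)
(* Dwork's series [exp (X + X ^ p / p)], evaluated at a root of
   [X ^ (p - 1) = - p], produces an additive character of F_p. Grouping its terms
   by the exponent mod [p - 1] gives the Gauss sums, and a telescoping argument
   identifies them with inverse values of Gamma_p at [1 - r / (p - 1)], which is
   the part of the Gross-Koblitz formula that is needed here. The duplication
   formula for Gamma_p turns each term of 4G4 into the square of a Jacobi sum of
   an even character and the quadratic one, and orthogonality of characters
   yields
     4G4 = - sum_{(x y) ^ 2 = 1} phi(1 + x) phi(1 + y)
         = phi(-1) - sum_x phi(x ^ 3 - x).
   On the modular side, eta(4z)^2 eta(8z)^2 = (eta(4z)^2 / eta(8z)) eta(8z)^3, and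
   the identities of Gauss and Jacobi, which are limits of finite q-binomial
   identities, make it
     sum_{j in Z} sum_{k >= 0} (-1)^(j + k) (2k + 1) q^(4 j^2 + (2k + 1)^2).
   Its coefficient at p depends only on the representation of p as a sum of two
   squares; Jacobsthal's evaluation of [sum_x phi(x ^ 3 - x)] gives the opposite
   number, the sign being settled by a congruence mod 8.
   The coefficients [a n] are recovered from the convergent expansion by letting
   q tend to 0 along the imaginary axis, where all quantities are real. *)

Require Import Defs.
From HB Require Import structures.
From mathcomp Require Import all_boot all_order all_algebra all_field.
From mathcomp Require Import cyclic complex.
From mathcomp Require Import all_classical all_reals all_analysis.
From mathcomp Require Import ring lra zify.
Import Order.TTheory GRing.Theory Num.Theory.
Local Open Scope ring_scope.
Set Implicit Arguments.
Unset Strict Implicit.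
Unset Printing Implicit Defensive.

(** * p-adic valuations *)

(** ['Q_[pp]] contains no root of [X ^ (p - 1) = - p], and no extension of it is built: an
    evaluation at that root is a remainder modulo [dwork_mod], and truncated series are compared mod
    [p ^ N] for every N. The analytic core is that Dwork's series converges there. The quantity (-
    p)^j j! a_(pj + r) is the j-th finite difference at 0 of a function of m which is, up to sign, 1
    / Gamma_p(pm + r + 1), and each difference gains a factor p^(2/3). Dividing by j! costs at most
    p^(j/2); the remaining p^(j/6) suffices. Every parameter of 4G4 occurs twice, so every term is a
    square and values of Gamma_p matter only up to sign. Hence the reflection formula is proved for
    squares only. The duplication formula is stated for a product of two pairs of gamma values,
    arranged so that the powers of 2 which it would otherwise contain cancel. *)

Section PadicSmall.
Context (p : nat) (pp : prime p).
Local Notation Zp := (padic_int pp).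
Local Notation K := 'Q_[pp].
Implicit Types (x y : K) (N M : nat).

Lemma padic_nat_neq0 n : (0 < n)%N -> (n%:R : Zp) != 0.
Proof.
move=> n0; apply/eqP => /(congr1 (fun z => padic_res z n)).
rewrite padic_res_nat modn_small; last by rewrite ltn_expl // prime_gt1.
by move=> nE; move: n0; rewrite nE -(mulr0n 1) padic_res_nat mod0n.
Qed.

Lemma frac_nat_neq0 n : (0 < n)%N -> (n%:R : K) != 0.
Proof.
by move=> n0; rewrite -(rmorph_nat (@tofrac Zp)) tofrac_eq0 padic_nat_neq0.
Qed.

Lemma pK_neq0 : (p%:R : K) != 0. Proof. exact/frac_nat_neq0/prime_gt0. Qed.

(** The ball [p ^ N Z_p]. All limits in the fraction field are expressed through these balls. *)
Definition padic_small N x := exists z : Zp, x = p%:R ^+ N * tofrac z.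

Lemma small_tofrac (z : Zp) : padic_small 0 (tofrac z).
Proof. by exists z; rewrite expr0 mul1r. Qed.

Lemma smallD N x y : padic_small N x -> padic_small N y -> padic_small N (x + y).
Proof. by move=> [u ->] [v ->]; exists (u + v); rewrite rmorphD mulrDr. Qed.

Lemma smallM N M x y :
  padic_small N x -> padic_small M y -> padic_small (N + M) (x * y).
Proof. by move=> [u ->] [v ->]; exists (u * v); rewrite rmorphM exprD mulrACA. Qed.

Lemma small_le N M x : (M <= N)%N -> padic_small N x -> padic_small M x.
Proof.
move=> MN [u ->]; exists (p%:R ^+ (N - M) * u).
by rewrite rmorphM rmorphXn rmorph_nat mulrA -exprD subnKC.
Qed.

Lemma small_nat n : padic_small 0 n%:R.
Proof. by rewrite -(rmorph_nat (@tofrac Zp)); apply: small_tofrac. Qed.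

Lemma small0 N : padic_small N 0.
Proof. by exists 0; rewrite rmorph0 mulr0. Qed.

Lemma smallMl N x y : padic_small 0 x -> padic_small N y -> padic_small N (x * y).
Proof. by move=> hx hy; rewrite -[N]add0n; apply: smallM. Qed.

Lemma smallMr N x y : padic_small N x -> padic_small 0 y -> padic_small N (x * y).
Proof. by move=> hx hy; rewrite -[N]addn0; apply: smallM. Qed.

Lemma smallN N x : padic_small N x -> padic_small N (- x).
Proof. by move=> [u ->]; exists (- u); rewrite rmorphN mulrN. Qed.

Lemma smallB N x y : padic_small N x -> padic_small N y -> padic_small N (x - y).
Proof. by move=> hx hy; apply/smallD/smallN. Qed.

Lemma small_sum N (I : Type) (r : seq I) (P : pred I) (F : I -> K) :
  (forall i, P i -> padic_small N (F i)) -> padic_small N (\sum_(i <- r | P i) F i).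
Proof.
by move=> h; apply: (big_ind (padic_small N)) => //; [exact: small0 | exact: smallD].
Qed.

Lemma small_pX N : padic_small N (p%:R ^+ N).
Proof. by exists 1; rewrite rmorph1 mulr1. Qed.

Lemma small_exp x k : padic_small 0 x -> padic_small 0 (x ^+ k).
Proof.
move=> hx; elim: k => [|k IH]; first by rewrite expr0; exact: (small_nat 1).
by rewrite exprS; apply: smallMl.
Qed.

Lemma small_dvdn N k : (p ^ N %| k)%N -> padic_small N k%:R.
Proof.
move=> /dvdnP[j ->]; rewrite natrM natrX.
by apply: smallMl (small_pX N); exact: small_nat.
Qed.

Lemma padic_unit_nat k : ~~ (p %| k)%N -> (k%:R : Zp) \is a GRing.unit.
Proof. by move=> pk; rewrite padic_unitE padic_res_nat expn1. Qed.

Lemma small_natV k : ~~ (p %| k)%N -> padic_small 0 k%:R^-1.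
Proof.
move=> pk; exists (k%:R^-1); rewrite expr0 mul1r.
have k0 : (k%:R : K) != 0.
  by apply/frac_nat_neq0; rewrite lt0n; apply: contraNneq pk => ->; rewrite dvdn0.
apply: (mulfI k0); rewrite divff // -[in RHS](rmorph_nat (@tofrac Zp)) -rmorphM.
by rewrite divrr ?rmorph1 // padic_unit_nat.
Qed.

Lemma small_eq0 x : (forall N, padic_small N x) -> x = 0.
Proof.
move=> h; have [z] := h 0%N; rewrite expr0 mul1r => xz.
suff z0 : z = 0 by rewrite xz z0 rmorph0.
apply: padic_resP => N; have [w] := h N.
rewrite xz -(rmorph_nat (@tofrac Zp)) -rmorphXn -rmorphM => /eqP.
rewrite tofrac_eq => /eqP ->; rewrite padic_resM padic_resX padic_res_nat.
by rewrite modnXm modnMml modnMr /= mod0n.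
Qed.

Lemma small_padic_res N (z : Zp) : padic_small N (tofrac z) <-> padic_res z N = 0%N.
Proof.
split=> [[w]|z0].
  rewrite -(rmorph_nat (@tofrac Zp)) -rmorphXn -rmorphM => /eqP.
  rewrite tofrac_eq => /eqP ->; rewrite padic_resM padic_resX padic_res_nat.
  by rewrite modnXm modnMml modnMr.
have hu n : (padic_res z (n.+1 + N) %/ p ^ N = padic_res z (n + N) %/ p ^ N %[mod p ^ n])%N.
  by rewrite !modn_divl -expnD padic_res_le ?padic_res_mod.
exists (padic_mk pp hu).
rewrite -(rmorph_nat (@tofrac Zp)) -rmorphXn -rmorphM; congr (tofrac _).
apply: padic_resP => n; rewrite padic_resM padic_resX padic_res_nat.
rewrite modnXm modnMml /= modnMmr -(padic_res_le z (leq_addr N n)).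
have : (p ^ N %| padic_res z (n + N))%N.
  by rewrite /dvdn padic_res_le ?leq_addl // z0.
by move=> /dvdnP[k ->]; rewrite mulnK ?expn_gt0 ?prime_gt0 // mulnC.
Qed.

(** By Legendre's formula the valuation is at most k / (p - 1), and p is at least 3. *)
Lemma logn_fact_le k : odd p -> (2 * logn p k`! <= k)%N.
Proof.
move=> podd; have p3 : (2 < p)%N by case: (p) pp podd => [|[|[|]]].
rewrite logn_fact //.
(* The slack [k %/ p ^ n] pays for the next summand, since [3 * (k %/ p ^ n.+1) <= k %/ p ^ n]. *)
have tele n : (2 * \sum_(1 <= i < n.+1) k %/ p ^ i + k %/ p ^ n <= k)%N.
  elim: n => [|n IH]; first by rewrite big_nil muln0 divn1.
  rewrite big_nat_recr //= mulnDr.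
  have : (3 * (k %/ p ^ n.+1) <= k %/ p ^ n)%N.
    rewrite expnSr divnMA; apply: leq_trans (leq_divM (k %/ p ^ n) p).
    by rewrite mulnC leq_mul.
  by move: IH; set u := \sum_(_ <= _ < _) _; lia.
exact: leq_trans (leq_addr _ _) (tele k).
Qed.

Lemma small_factV k : odd p -> padic_small 0 (p%:R ^+ k./2 / k`!%:R).
Proof.
move=> podd; have h := logn_fact_le k podd.
have f0 := fact_gt0 k; have [m pm fE] := pfactor_coprime pp f0.
rewrite fE natrM natrX invfM [X in _ * X]mulrC mulrA.
set v := logn _ _ in h *; have hv : (v <= k./2)%N by rewrite geq_half_double; lia.
rewrite -(subnKC hv) exprD (mulrC (p%:R ^+ v)) mulfK ?expf_neq0 ?pK_neq0 //.
apply: smallMl; first exact: small_le (small_pX _).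
by apply: small_natV; rewrite -prime_coprime.
Qed.

End PadicSmall.

(** * Dwork's exponential *)

Section FormalSeries.
Context (F : fieldType) (charF : forall n, n.+1%:R != 0 :> F) (p : nat) (p_gt0 : (0 < p)%N).
Implicit Types (f g h : nat -> F) (u v : F).

Definition conv f g n := \sum_(i < n.+1) f i * g (n - i)%N.
Definition dil f n := if (p %| n)%N then f (n %/ p)%N else 0.
Definition exps u n : F := u ^+ n / n`!%:R.
(* The coefficients of [exp (u X + v X ^ p)]. *)
Definition exp2 u v := conv (exps u) (dil (exps v)).

(** Series products are read off from truncated polynomials, whose ring structure then supplies
    commutativity and associativity. *)
Lemma coef_poly_mul L f g n : (n < L)%N ->
  ((\poly_(i < L) f i) * (\poly_(i < L) g i))`_n = conv f g n.
Proof.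
move=> nL; rewrite coefM; apply: eq_bigr => i _; rewrite !coef_poly.
by rewrite (leq_ltn_trans _ nL) ?(leq_ltn_trans (leq_subr i n) nL) // -ltnS.
Qed.

Lemma convC f g : conv f g = conv g f.
Proof.
by apply/funext => n; rewrite -!(@coef_poly_mul n.+1) // mulrC.
Qed.

Lemma convA f g h : conv f (conv g h) = conv (conv f g) h.
Proof.
apply/funext => n; pose P k := \poly_(i < n.+1) k i : {poly F}.
have E k l m : (m < n.+1)%N -> (P k * P l)`_m = conv k l m by exact: coef_poly_mul.
have : (P f * (P g * P h))`_n = (P f * P g * P h)`_n by rewrite mulrA.
rewrite coefM [X in _ = X -> _]coefM => H.
rewrite [LHS](_ : _ = \sum_(i < n.+1) (P f)`_i * (P g * P h)`_(n - i)).
  rewrite H; apply: eq_bigr => i _; rewrite E // coef_poly.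
  by rewrite ltnS leq_subr.
by apply: eq_bigr => i _; rewrite E ?coef_poly ?ltn_ord // ltnS leq_subr.
Qed.

Lemma conv_exps u v : conv (exps u) (exps v) = exps (u + v).
Proof.
apply/funext => n; have f0 k : k`!%:R != 0 :> F.
  by rewrite -(prednK (fact_gt0 k)) charF.
rewrite /exps addrC exprDn mulr_suml; apply: eq_bigr => i _.
have ni : (i <= n)%N by rewrite -ltnS.
rewrite -(bin_fact ni) !natrM -mulr_natr.
have b0 : 'C(n, i)%:R != 0 :> F.
  by rewrite -(@prednK 'C(n, i)) ?bin_gt0 // charF.
by have := f0 i; have := f0 (n - i)%N => h1 h2; field; rewrite h1 h2 b0.
Qed.

Lemma conv_dil f g : conv (dil f) (dil g) = dil (conv f g).
Proof.
apply/funext => n; pose P k := \poly_(i < n.+1) k i : {poly F}.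
have E k i : (i < n.+1)%N -> (P k \Po 'X^p)`_i = dil k i.
  move=> iL; rewrite coef_comp_poly_Xn // /dil coef_poly.
  by rewrite (leq_ltn_trans (leq_div _ _) iL).
rewrite [RHS]/dil -(@coef_poly_mul n.+1 f) ?ltnS ?leq_div //.
rewrite -coef_comp_poly_Xn // comp_polyM coefM; apply: eq_bigr => i _.
by rewrite -!E ?ltn_ord ?ltnS ?leq_subr.
Qed.

Lemma conv_exp2 u v u' v' :
  conv (exp2 u v) (exp2 u' v') = exp2 (u + u') (v + v').
Proof.
rewrite /exp2 -!conv_exps -conv_dil !convA; congr conv.
by rewrite -!convA; congr conv; rewrite convC.
Qed.

(** The substitution of t X for X. *)
Lemma exp2_scale u v t n : exp2 (u * t) (v * t ^+ p) n = exp2 u v n * t ^+ n.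
Proof.
rewrite /exp2 /conv mulr_suml; apply: eq_bigr => i _; rewrite /dil.
case: ifP => [pn|_]; last by rewrite !mulr0 mul0r.
have ni : (i <= n)%N by rewrite -ltnS.
rewrite /exps !exprMn -exprM (mulnC p) divnK //.
by rewrite -[X in _ = _ * t ^+ X](subnKC ni) exprD; ring.
Qed.

Lemma exp2_0 u v : exp2 u v 0 = 1.
Proof. by rewrite /exp2 /conv big_ord1 /dil dvdn0 div0n /exps !expr0 fact0 divr1 mul1r. Qed.

Lemma exps_rec u n : n.+1%:R * exps u n.+1 = u * exps u n.
Proof.
have f0 : n`!%:R != 0 :> F by rewrite -(prednK (fact_gt0 n)) charF.
have n0 := charF n.
by rewrite /exps factS natrM exprS; field; rewrite f0 addrC natr1 n0.
Qed.

(** Coefficient form of Y' = (u + p v X^(p - 1)) Y for Y = exp (u X + v X^p). *)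
Lemma exp2_rec u v n : n.+1%:R * exp2 u v n.+1 =
  u * exp2 u v n + (if (p <= n.+1)%N then p%:R * v * exp2 u v (n.+1 - p) else 0).
Proof.
pose f := exps u; pose g := dil (exps v).
have g_rec m : m%:R * g m = if (p <= m)%N then p%:R * v * g (m - p)%N else 0.
  case: (leqP p m) => pm; last first.
    case: m pm => [|m] pm; first by rewrite mul0r.
    by rewrite /g /dil gtnNdvd // mulr0.
  rewrite /g /dil dvdn_subl //; case: ifP => [/dvdnP[k mE]|]; last by rewrite !mulr0.
  rewrite {}mE in pm *.
  have -> : (k * p - p = (k - 1) * p)%N by rewrite mulnBl mul1n.
  rewrite !mulnK //.
  have k0 : (0 < k)%N by case: (k) pm => //; rewrite mul0n leqNgt p_gt0.
  rewrite -(prednK k0) subn1 /= natrM mulrAC exps_rec; ring.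
rewrite {1}/exp2 /conv mulr_sumr -/f -/g.
under eq_bigr => i _.
  have ni : (i <= n.+1)%N by rewrite -ltnS.
  rewrite -{1}(subnKC ni) natrD mulrDl mulrA -[X in _ + X]mulrCA g_rec.
  over.
rewrite big_split /=; congr (_ + _).
  rewrite big_ord_recl !mul0r add0r mulr_sumr; apply: eq_bigr => i _.
  by rewrite /= exps_rec subSS mulrA.
case: (leqP p n.+1) => pn; last first.
  rewrite big1 // => i _; rewrite leqNgt (leq_ltn_trans _ pn) ?mulr0 //.
  exact: leq_subr.
rewrite (bigID (fun i : 'I_n.+2 => (i < (n.+1 - p).+1)%N)) /=.
rewrite [X in _ + X]big1 ?addr0; last first.
  move=> i; rewrite -leqNgt => hi.
  by rewrite leqNgt (_ : (n.+1 - i < p)%N) ?mulr0 //; lia.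
have hle : ((n.+1 - p).+1 <= n.+2)%N by lia.
rewrite mulr_sumr (big_ord_widen _ (fun i => p%:R * v * (f i * g (n.+1 - p - i)%N)) hle).
apply: eq_bigr => i hi; rewrite (_ : (p <= n.+1 - i)%N); last by lia.
by rewrite subnAC mulrCA.
Qed.

End FormalSeries.

(** * Finite differences and p-divisibility of integer polynomials *)

Section ThirdsFiltration.
Context (p : nat).
Implicit Types (g h : {poly int}) (mu nu : nat).

(* Over [Z[p ^ (1 / 3)]], with [w = p ^ (2 / 3)], these are the polynomials
   [w ^ mu * h (w X)]. *)
Definition thirds mu g := forall j, (p%:Z ^+ ((2 * (mu + j) + 2) %/ 3) %| g`_j)%Z.

Lemma dvdz_exp2 (a b : nat) : (a <= b)%N -> (p%:Z ^+ a %| p%:Z ^+ b)%Z.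
Proof. by move=> ab; rewrite -(subnKC ab) exprD dvdz_mulr. Qed.

Lemma size_exp_Xsub1 n : size (('X - 1 : {poly int}) ^+ n) = n.+1.
Proof. by rewrite -polyC1 size_exp_XsubC. Qed.

Lemma thirdsD mu g h : thirds mu g -> thirds mu h -> thirds mu (g + h).
Proof. by move=> hg hh j; rewrite coefD rpredD. Qed.

Lemma thirdsN mu g : thirds mu g -> thirds mu (- g).
Proof. by move=> hg j; rewrite coefN rpredN. Qed.

Lemma thirdsM mu nu g h : thirds mu g -> thirds nu h -> thirds (mu + nu) (g * h).
Proof.
move=> hg hh j; rewrite coefM; apply: rpred_sum => i _.
have ij : (i <= j)%N by rewrite -ltnS.
apply: dvdz_trans (dvdz_mul (hg i) (hh (j - i)%N)).
rewrite -exprD; apply: dvdz_exp2; lia.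
Qed.

Lemma thirds_sum mu n (G : 'I_n -> {poly int}) :
  (forall i, thirds mu (G i)) -> thirds mu (\sum_i G i).
Proof. by move=> h j; rewrite coef_sum; apply: rpred_sum => i _; exact: h. Qed.

Lemma thirds_shift mu g : thirds mu g -> thirds mu (g \Po ('X - 1)).
Proof.
move=> hg; rewrite comp_polyE; apply: thirds_sum => i j.
rewrite coefZ; have [ij|ji] := ltnP i j.
  by rewrite [X in _ * X]nth_default ?size_exp_Xsub1 // mulr0 dvdz0.
apply/dvdz_mulr/(dvdz_trans _ (hg i))/dvdz_exp2; lia.
Qed.

(** ['X^i - ('X - 1) ^+ i] has degree below i, so the coefficient of index j only receives
    contributions from some [g_i] with i > j, and these carry one more factor p^(2/3). *)
Lemma thirds_diff mu g : thirds mu g -> thirds mu.+1 (g - (g \Po ('X - 1))).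
Proof.
move=> hg.
have -> : g - (g \Po ('X - 1)) = \sum_(i < size g) g`_i *: ('X^i - ('X - 1) ^+ i).
  under eq_bigr do rewrite scalerBr.
  by rewrite sumrB -!comp_polyE comp_polyXr.
apply: thirds_sum => i j; rewrite coefZ.
have [ij|ji] := leqP i j; last first.
  apply/dvdz_mulr/(dvdz_trans _ (hg i))/dvdz_exp2; lia.
suff -> : ('X^i - ('X - 1) ^+ i : {poly int})`_j = 0 by rewrite mulr0 dvdz0.
have [->|ij'] := eqVneq j i; last first.
  have ij2 : (i < j)%N by rewrite ltn_neqAle eq_sym ij' ij.
  by rewrite coefB !nth_default ?subr0 ?size_polyXn ?size_exp_Xsub1.
have m1 : ('X - 1 : {poly int}) ^+ i \is monic by rewrite -polyC1 monic_exp // monicXsubC.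
have := monicP m1; rewrite lead_coefE size_exp_Xsub1 /= => e1.
by rewrite coefB coefXn eqxx e1 subrr.
Qed.

Lemma thirds_horner mu g (x : int) : thirds mu g ->
  (p%:Z ^+ ((2 * mu + 2) %/ 3) %| g.[x])%Z.
Proof.
move=> hg; rewrite horner_coef; apply: rpred_sum => i _.
apply/dvdz_mulr/(dvdz_trans _ (hg i))/dvdz_exp2; lia.
Qed.

End ThirdsFiltration.

Section StepPoly.
Context (p : nat) (pp : prime p) (p_odd : odd p) (r : nat) (rp : (r < p)%N).

(** At [p * m.+1] this is, up to sign, the product of the integers prime to p in a window of length
    p: the ratio of two consecutive values of [dwork_sum], see [dwork_sum_stepE]. *)
Definition step_poly : {poly int} :=
  - \prod_(0 <= i < p | i != r) ('X + (r%:Z - i%:Z)%:P).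

(** [r - i] runs over the nonzero residues, which are the roots of X^(p - 1) - 1. *)
Lemma step_poly_mod : map_poly (intr : int -> 'F_p) step_poly = 1 - 'X^(p.-1).
Proof.
rewrite /step_poly rmorphN rmorph_prod /=.
pose r' : 'F_p := r%:R.
have hbig (P : pred nat) (f : nat -> {poly 'F_p}) :
  \prod_(0 <= i < p | P i) f i = \prod_(0 <= i < (Zp_trunc (pdiv p)).+2 | P i) f i.
  by rewrite [in RHS]Fp_cast.
have -> : \prod_(0 <= i < p | i != r) map_poly (intr : int -> 'F_p) ('X + (r%:Z - i%:Z)%:P)
        = \prod_(i : 'F_p | i != r') ('X - (i - r')%:P).
  rewrite hbig big_mkord; apply: eq_big => [i|i _].
    rewrite -(inj_eq val_inj) /r' /= val_Fp_nat // modn_small //.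
  rewrite rmorphD /= map_polyX map_polyC /= rmorphB /=.
  by rewrite -[X in X - r']natr_Zp -polyCN opprB.
rewrite (reindex_inj (addIr r')) /=.
under eq_bigl => i do rewrite -subr_eq0 addrK.
under eq_bigr => i _ do rewrite addrK.
have h : \prod_(x : 'F_p) ('X - x%:P) = 'X^p - 'X.
  by rewrite -finField_genPoly card_Fp.
have X0 : ('X : {poly 'F_p}) != 0 by rewrite polyX_eq0.
apply: (mulfI X0); move: h; rewrite (bigD1 0) //= polyC0 subr0 => h.
rewrite mulrN h mulrBr mulr1 -exprS prednK ?prime_gt0 //; ring.
Qed.

(** Origin of the exponent 2/3. In degree j < p - 1 the coefficient has the factor p^j of the
    substitution and, by [step_poly_mod], one more p. From degree p - 1 on only p^j is available;
    for p = 3 and j = 2 the required p^2 is met with equality. *)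
Lemma step_poly_thirds : thirds p 1 (step_poly \Po (p%:Z *: 'X) - 1).
Proof.
have p3 : (2 < p)%N by case: (p) pp p_odd => [|[|[|]]].
have cE j : (step_poly \Po (p%:Z *: 'X))`_j = p%:Z ^+ j * step_poly`_j.
  rewrite comp_polyE coef_sum; case: (ltnP j (size step_poly)) => hj.
    rewrite (bigD1 (Ordinal hj)) //= big1 => [|i].
      by rewrite addr0 exprZn !coefZ coefXn eqxx mulr1 mulrC.
    by rewrite exprZn !coefZ coefXn -(inj_eq val_inj) eq_sym /= => /negPf ->; rewrite !mulr0.
  rewrite (nth_default _ hj) mulr0 big1 // => i _.
  by rewrite exprZn !coefZ coefXn gtn_eqF ?mulr0 // (leq_trans (ltn_ord i)).
have dv j : (j < p.-1)%N -> (p%:Z %| (step_poly - 1)`_j)%Z.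
  move=> jp; rewrite (dvdz_pcharf (pchar_Fp pp)).
  have : (map_poly (intr : int -> 'F_p) (step_poly - 1))`_j = 0.
    rewrite rmorphB /= step_poly_mod rmorph1 addrAC subrr add0r coefN coefXn.
    by rewrite ltn_eqF // oppr0.
  by rewrite coef_map /= => ->.
move=> j; rewrite coefB cE coef1; have [jp|jp] := ltnP j p.-1; last first.
  have j1 : (1 < j)%N by lia.
  have -> : (j == 0)%N = false by case: (j) j1.
  rewrite subr0; apply/dvdz_mulr/dvdz_exp2; lia.
have [->|j0] := posnP j.
  by have := dv 0%N; rewrite coefB coef1 expr0 mul1r expr1; apply; lia.
have := dv j jp; rewrite coefB coef1 gtn_eqF // !subr0 => hj.
apply: (@dvdz_trans (p%:Z ^+ j * p%:Z)); last by rewrite dvdz_mul.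
by rewrite -exprSr; apply: dvdz_exp2; lia.
Qed.

End StepPoly.

(** * Coefficients of Dwork's series: size and trace sums *)

Section Dwork.
Context (p : nat) (pp : prime p) (p_odd : odd p).
Local Notation K := 'Q_[pp].
Local Notation pK := (p%:R : K).
Local Notation small := (@padic_small p pp).

Let charK n : n.+1%:R != 0 :> K. Proof. exact: frac_nat_neq0. Qed.
Let p_gt0 : (0 < p)%N. Proof. exact: prime_gt0. Qed.

(* [exp (X + X ^ p / p)] *)
Definition dwork : nat -> K := exp2 p 1 pK^-1.
Local Notation a := dwork.

Lemma dwork0 : a 0 = 1. Proof. exact: exp2_0. Qed.

Lemma dwork_rec n : n.+1%:R * a n.+1 = a n + (if (p <= n.+1)%N then a (n.+1 - p)%N else 0).
Proof. by rewrite /dwork exp2_rec // mul1r divff ?pK_neq0 // mul1r. Qed.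

(** A Newton expansion in m: the coefficient of the binomial of m over k is (- p)^k k! a_(pk + s).
    For s < p, [dwork_sum_digit] identifies it, up to sign, with 1 / Gamma_p(pm + s + 1). *)
Definition dwork_sum m s := \sum_(k < m.+1) (- pK) ^+ k * a (p * k + s)%N * (m ^_ k)%:R.
Local Notation F := dwork_sum.

Lemma dwork_sum_first m s : a s = F m.+1 s + pK * m.+1%:R * F m (p + s)%N.
Proof.
rewrite /F big_ord_recl muln0 add0n expr0 mul1r ffactn0 mulr1 -addrA.
rewrite mulr_sumr -big_split big1 ?addr0 //= => k _.
rewrite /bump add1n ffactSS natrM exprS mulnSr addnA; ring.
Qed.

(** Split the factor as (pk + s + 1) + p (m - k). The first part is treated by [dwork_rec]; the
    second turns [m ^_ k] into [m ^_ k.+1] and cancels the second term of the recurrence at the next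
    k. *)
Lemma dwork_sum_step m s : (s.+1 + p * m)%:R * F m s.+1 =
  F m s + (if (p <= s.+1)%N then a (s.+1 - p)%N else 0).
Proof.
have E k : (k < m.+1)%N -> (s.+1 + p * m)%:R * ((- pK) ^+ k * a (p * k + s.+1)%N * (m ^_ k)%:R) =
  (- pK) ^+ k * a (p * k + s)%N * (m ^_ k)%:R
  + (- pK) ^+ k * (m ^_ k)%:R * (if (p <= (p * k + s).+1)%N then a ((p * k + s).+1 - p)%N else 0)
  - (- pK) ^+ k.+1 * a (p * k + s.+1)%N * (m ^_ k.+1)%:R.
  rewrite ltnS => km; rewrite ffactnSr natrM natrB //.
  have -> : (if (p <= (p * k + s).+1)%N then a ((p * k + s).+1 - p)%N else 0) =
      (p * k + s.+1)%:R * a (p * k + s.+1)%N - a (p * k + s)%N.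
    by rewrite addnS dwork_rec addrC addrA addNr add0r.
  rewrite !natrD !natrM exprS; ring.
rewrite /F mulr_sumr (eq_bigr _ (fun (i : 'I_m.+1) _ => E i (ltn_ord i))).
rewrite big_split big_split /= -addrA; congr (_ + _).
rewrite big_ord_recl expr0 muln0 add0n ffactn0 !mul1r -addrA -[RHS]addr0; congr (_ + _).
rewrite [X in _ + X]big_ord_recr /= ffact_small // mulr0 oppr0 addr0 -big_split /=.
rewrite big1 // => k _; rewrite /bump add1n.
have pks : (p <= (p * k.+1 + s).+1)%N by rewrite mulnS; lia.
have -> : ((p * k.+1 + s).+1 - p = p * k + s.+1)%N by rewrite mulnS; lia.
rewrite pks; ring.
Qed.

Definition unit_fact n : nat := \prod_(1 <= j < n.+1 | ~~ (p %| j)%N) j.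

Lemma unit_factS n : unit_fact n.+1 = (unit_fact n * (if (p %| n.+1)%N then 1 else n.+1))%N.
Proof.
rewrite /unit_fact big_mkcond big_nat_recr //= -big_mkcond /=.
by case: (p %| n.+1)%N.
Qed.

Lemma unit_fact_ndvd n : ~~ (p %| unit_fact n)%N.
Proof.
elim: n => [|n IH]; first by rewrite /unit_fact big_nil Euclid_dvd1.
rewrite unit_factS Euclid_dvdM // negb_or IH /=.
by case: ifPn => // _; rewrite Euclid_dvd1.
Qed.

(** Induction along the integers p m + r. Inside a block of length p, [dwork_sum_step] supplies the
    new factor; at the carry it combines with [dwork_sum_first] into [F m.+1 0 = - F m p.-1], the
    source of the sign. *)
Lemma dwork_sum_digit m r : (r < p)%N ->
  F m r * (unit_fact (p * m + r))%:R = (-1) ^+ m.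
Proof.
have digit m' : F m' 0 * (unit_fact (p * m'))%:R = (-1) ^+ m' ->
    forall r', (r' < p)%N -> F m' r' * (unit_fact (p * m' + r'))%:R = (-1) ^+ m'.
  move=> h0; elim=> [|r' IH] rp; first by rewrite addn0.
  rewrite -(IH (ltnW rp)) addnS unit_factS -addnS dvdn_addr ?dvdn_mulr //.
  rewrite gtnNdvd // natrM [X in _ = X * _](_ : _ = (r'.+1 + p * m')%:R * F m' r'.+1).
    by rewrite (addnC r'.+1); ring.
  by rewrite dwork_sum_step leqNgt rp addr0.
suff h0 m' : F m' 0 * (unit_fact (p * m'))%:R = (-1) ^+ m' by exact: digit.
elim: m' {m} => [|m IH].
  by rewrite muln0 /F big_ord1 muln0 dwork0 /unit_fact big_nil ffactn0 !mulr1 !expr0.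
have /digit/(_ p.-1) := IH; rewrite prednK // leqnn => /(_ isT) h.
have := dwork_sum_step m p.-1; rewrite prednK // leqnn subnn => e1.
have := dwork_sum_first m 0; rewrite addn0 => e2.
have e3 : F m.+1 0 = - F m p.-1.
  apply/eqP; rewrite -addr_eq0; apply/eqP.
  have : F m p.-1 = (p + p * m)%:R * F m p - a 0 by rewrite e1 addrK.
  move=> ->; rewrite {1}e2 -mulnS natrM; ring.
have mE : (p * m.+1 = (p * m + p.-1).+1)%N by rewrite mulnS; move: p_gt0; lia.
by rewrite e3 exprS mulN1r -h mE unit_factS -mE dvdn_mulr // muln1 mulNr.
Qed.

Lemma dwork_sum_small m r : (r < p)%N -> small 0 (F m r).
Proof.
move=> rp; have h := dwork_sum_digit m rp; have u := unit_fact_ndvd (p * m + r).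
have u0 : (unit_fact (p * m + r))%:R != 0 :> K.
  by apply/frac_nat_neq0; rewrite lt0n; apply: contraNneq u => ->; rewrite dvdn0.
rewrite -[F m r](mulfK u0) h; apply: smallMr (small_natV _ u).
by apply: small_exp; apply: smallN; exact: (small_nat _ 1).
Qed.

Lemma unit_fact_shift m r : (r < p)%N ->
  unit_fact (p * m.+1 + r) =
  (\prod_(0 <= i < p | i != r) (p * m.+1 + r - i) * unit_fact (p * m + r))%N.
Proof.
move=> rp.
have main t : (t <= p)%N -> unit_fact (p * m.+1 + r) =
    (\prod_(0 <= i < t | i != r) (p * m.+1 + r - i) * unit_fact (p * m.+1 + r - t))%N.
  elim: t => [|t IH] tp; first by rewrite big_nil mul1n subn0.
  rewrite (IH (ltnW tp)) [in RHS]big_mkcond big_nat_recr //= -big_mkcond /= -mulnA.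
  congr (_ * _)%N.
  have -> : (p * m.+1 + r - t = (p * m.+1 + r - t.+1).+1)%N by rewrite mulnS; lia.
  rewrite unit_factS mulnC; congr (_ * _)%N.
  have -> : ((p * m.+1 + r - t.+1).+1 = p * m + (p + r - t))%N by rewrite mulnS; lia.
  rewrite dvdn_addr ?dvdn_mulr //; case: eqVneq => [->|tr]; first by rewrite addnK dvdnn.
  case: ifP => // /dvdnP[k kE]; exfalso; move/eqP: tr; apply.
  have k1 : k = 1%N by case: k kE => [|[|k]] //; rewrite ?mulSn; lia.
  by move: kE; rewrite k1; lia.
by rewrite (main p) // mulnS; congr (_ * unit_fact _)%N; lia.
Qed.

Lemma dwork_sum_stepE m r : (r < p)%N ->
  F m r = ((step_poly p r).[(p * m.+1)%:Z])%:~R * F m.+1 r.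
Proof.
move=> rp; have u n : (unit_fact n)%:R != 0 :> K.
  apply/frac_nat_neq0; rewrite lt0n; apply: contraNneq (unit_fact_ndvd n) => ->.
  by rewrite dvdn0.
have hp : \prod_(0 <= i < p | i != r) ((p * m.+1)%:Z + (r%:Z - i%:Z)) =
    (\prod_(0 <= i < p | i != r) (p * m.+1 + r - i))%N%:Z.
  rewrite -[RHS]natz natr_prod big_nat_cond [RHS]big_nat_cond.
  apply: eq_bigr => i /andP[/andP[_ ip] _]; rewrite natz -subzn ?PoszD ?addrA //.
  by rewrite mulnS; lia.
apply: (mulIf (u (p * m.+1 + r)%N)); rewrite -mulrA dwork_sum_digit //.
have hev (x : int) : (\prod_(0 <= i < p | i != r) ('X + (r%:Z - i%:Z)%:P)).[x] =
    \prod_(0 <= i < p | i != r) (x + (r%:Z - i%:Z)).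
  by rewrite horner_prod; apply: eq_bigr => i _; rewrite hornerD hornerX hornerC.
rewrite unit_fact_shift // natrM mulrCA dwork_sum_digit // /step_poly hornerN hev.
rewrite hp exprS rmorphN mulN1r mulrNN; congr (_ * _).
Qed.

(** The j-th forward difference of [dwork_sum] in m, by [dwork_diffS]. At m = 0 it reduces to one
    term, which isolates the single coefficient a_(pj + r). *)
Definition dwork_diff r j m := \sum_(k < m.+1)
  (- pK) ^+ (k + j) * (k + j)`!%:R * a (p * (k + j) + r)%N * 'C(m, k)%:R.
Local Notation H := dwork_diff.

Lemma dwork_diff0 r m : H r 0 m = F m r.
Proof.
by apply: eq_bigr => k _; rewrite !addn0 -bin_ffact natrM; ring.
Qed.

Lemma dwork_diffS r j m : H r j.+1 m = H r j m.+1 - H r j m.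
Proof.
rewrite /H [in RHS]big_ord_recl /= bin0.
have -> : \sum_(k < m.+1) (- pK) ^+ (k + j) * (k + j)`!%:R * a (p * (k + j) + r)%N * 'C(m, k)%:R
  = (- pK) ^+ (0 + j) * (0 + j)`!%:R * a (p * (0 + j) + r)%N * 1%:R +
   \sum_(k < m.+1) (- pK) ^+ (k.+1 + j) * (k.+1 + j)`!%:R * a (p * (k.+1 + j) + r)%N * 'C(m, k.+1)%:R.
  by rewrite big_ord_recl /= bin0 [in RHS]big_ord_recr /= bin_small // mulr0 addr0.
rewrite opprD addrACA subrr add0r -sumrB; apply: eq_bigr => k _.
by rewrite /bump add1n binS natrD addSnnS; ring.
Qed.

Lemma dwork_diff_factor r j : (r < p)%N -> exists2 g, thirds p j g &
  forall m, H r j m = (g.[(m + j)%:Z])%:~R * F (m + j) r.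
Proof.
move=> rp; elim: j => [|j [g hg IH]].
  exists 1 => [i|m]; last by rewrite dwork_diff0 addn0 hornerC mul1r.
  rewrite coef1; case: (eqVneq i 0%N) => [->|]; last by rewrite dvdz0.
  by rewrite addn0 muln0 /= expr0 dvd1z.
pose T := step_poly p r \Po (p%:Z *: 'X).
(* Since [F (m + j)] is [T] at m + j + 1 times [F (m + j.+1)], the new factor is g(X) - g(X - 1)
   T(X). Splitting off T - 1 leaves two parts that both gain p^(2/3). *)
exists (g - (g \Po ('X - 1)) - (g \Po ('X - 1)) * (T - 1)) => [|m].
  apply: thirdsD; first exact: thirds_diff.
  apply: thirdsN; rewrite -[j.+1]addn1; apply: thirdsM; first exact: thirds_shift.
  exact: step_poly_thirds.
rewrite dwork_diffS !IH (@dwork_sum_stepE (m + j)) // addSn -addnS.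
rewrite !hornerE !horner_comp !hornerE -PoszM.
have -> : (m + j.+1)%:Z - 1 = (m + j)%:Z by rewrite addnS; lia.
by rewrite !(rmorphB, rmorphM, rmorphD, rmorphN, rmorph1) /=; ring.
Qed.

Lemma smallV_pX N n (x : K) : (n <= N)%N -> small N (pK ^+ n * x) -> small (N - n) x.
Proof.
move=> nN [z h]; exists z; apply: (@mulfI _ (pK ^+ n)).
  by rewrite expf_neq0 // pK_neq0.
by rewrite h mulrA -exprD subnKC.
Qed.

(** With j = n / p, the j-th difference at 0 provides p^(2j/3), and removing j! costs at most
    p^(j/2). *)
Lemma dwork_small n : small ((n %/ p) %/ 6) (pK ^+ (n %/ p) * a n).
Proof.
pose j := (n %/ p)%N; pose r := (n %% p)%N; have rp : (r < p)%N by rewrite ltn_mod.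
have nE : n = (p * j + r)%N by rewrite mulnC -divn_eq.
have [g hg hH] := dwork_diff_factor j rp.
have h1 : small ((2 * j + 2) %/ 3) (H r j 0).
  rewrite hH; apply: smallMr; last exact: dwork_sum_small.
  have /dvdzP[c ->] := thirds_horner j%:Z hg.
  rewrite rmorphM rmorphXn /= -pmulrn mulrC; apply: (smallMr (small_pX pp _)).
  by case: c => c; rewrite ?NegzE ?rmorphN; [|apply: smallN]; exact: small_nat.
have h2 : small ((2 * j + 2) %/ 3) (j`!%:R * (pK ^+ j * a n)).
  move: h1; rewrite /H big_ord1 !add0n bin0 mulr1 nE exprNn => h.
  have -> : j`!%:R * (pK ^+ j * a (p * j + r)%N) =
     (-1) ^+ j * ((-1) ^+ j * pK ^+ j * j`!%:R * a (p * j + r)%N).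
    by rewrite !mulrA -expr2 sqrr_sign; ring.
  apply: smallMl h; apply: small_exp; apply: smallN; exact: (small_nat _ 1).
apply: (@small_le _ _ ((2 * j + 2) %/ 3 - j./2)); first by rewrite -/j; lia.
apply: smallV_pX; first by lia.
have f0 : j`!%:R != 0 :> K by apply/frac_nat_neq0/fact_gt0.
rewrite -[X in small _ (_ * X)](mulKf f0) mulrA.
by apply: smallMl h2; exact: small_factV.
Qed.

Lemma dwork_small_le n k : (n %/ p <= k)%N -> small ((n %/ p) %/ 6) (pK ^+ k * a n).
Proof.
move=> nk; rewrite -(subnK nk) exprD -mulrA; apply: smallMl (dwork_small n).
by apply: small_exp; exact: small_nat.
Qed.

Lemma dwork_small_leN n k :
  (n %/ p <= k)%N -> small ((n %/ p) %/ 6) ((- pK) ^+ k * a n).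
Proof.
move=> nk; rewrite exprNn -mulrA; apply: smallMl (dwork_small_le nk).
by apply: small_exp; apply: smallN; exact: (small_nat _ 1).
Qed.

Let divp_le n k : (n < p * k.+1)%N -> (n %/ p <= k)%N.
Proof. by move=> h; rewrite -ltnS ltn_divLR // mulnC. Qed.

Lemma dwork_sum_small_shift m r i : (r < p)%N ->
  small 0 ((- pK) ^+ i.+1 * F m (p + (r + p.-1 * i))%N).
Proof.
move=> rp; rewrite /F mulr_sumr; apply: small_sum => k _.
rewrite 2!mulrA -exprD -mulrA mulrA; apply: smallMr (small_nat _ _).
apply: small_le (leq0n _) (dwork_small_leN _).
have hi : (p.-1 * i <= p * i)%N by rewrite leq_mul2r leq_pred orbT.
by apply: divp_le; rewrite !(mulnS, mulnDr); lia.
Qed.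

(** Up to a multiple of r + (p - 1) m, each term on the left is the difference of two consecutive
    values of (- p)^k F(m - k)(r + (p - 1) k). That multiple is small once m is p-adically close to
    - r / (p - 1). *)
Lemma dwork_trace_eq m r k : (r < p)%N -> (k <= m)%N -> exists2 z, small 0 z &
  (1 - pK) * (\sum_(i < k) (- pK) ^+ i * a (r + p.-1 * i)%N) =
  F m r - (- pK) ^+ k * F (m - k) (r + p.-1 * k)%N + (r + p.-1 * m)%:R * z.
Proof.
move=> rp; elim: k => [|k IH] km.
  exists 0; first exact: small0.
  by rewrite big_ord0 !mulr0 muln0 addn0 subn0 expr0 mul1r subrr addr0.
have [z hz E] := IH (ltnW km); set s := (r + p.-1 * k)%N in E *.
exists (z + (- pK) ^+ k.+1 * F (m - k.+1) (p + s)%N).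
  by apply: smallD => //; exact: dwork_sum_small_shift.
rewrite big_ord_recr mulrDr /= {}E -/s.
have mE : (m - k = (m - k.+1).+1)%N by lia.
have e1 := dwork_sum_first (m - k.+1) s; rewrite -mE in e1.
have e2 := dwork_sum_step (m - k.+1) (p.-1 + s).
have sE : ((p.-1 + s).+1 = p + s)%N by move: p_gt0; lia.
rewrite sE leq_addr addKn in e2.
have dE : (p + s + p * (m - k.+1) = (r + p.-1 * m) + (m - k))%N.
  by rewrite /s -{1 2}(prednK p_gt0) -(subnKC km); move: (m - k.+1)%N => q; nia.
rewrite dE natrD mulrDl in e2.
have -> : (r + p.-1 * k.+1 = p.-1 + s)%N by rewrite /s; nia.
rewrite exprS.
have -> : F (m - k.+1) (p.-1 + s) = (r + p.-1 * m)%:R * F (m - k.+1) (p + s)%N +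
  (m - k)%:R * F (m - k.+1) (p + s)%N - a s by rewrite e2 addrK.
have -> : F (m - k)%N s = a s - pK * (m - k)%:R * F (m - k.+1) (p + s)%N.
  by rewrite [in RHS]e1 addrK.
ring.
Qed.

Lemma dwork_trace N r : (r < p)%N -> exists M, forall L m,
  (M <= L)%N -> (M <= m)%N -> (p ^ N %| r + p.-1 * m)%N ->
  small N ((1 - pK) * (\sum_(i < L) (- pK) ^+ i * a (r + p.-1 * i)%N) - F m r).
Proof.
move=> rp; have p3 : (2 < p)%N by case: (p) pp p_odd => [|[|[|]]].
have tail i : (12 * (N + r).+1 <= i)%N -> small N ((- pK) ^+ i * a (r + p.-1 * i)%N).
  move=> hi; have hd : (i %/ 2 <= (r + p.-1 * i) %/ p)%N.
    by rewrite leq_divRL //; nia.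
  apply: small_le (dwork_small_leN _); first by lia.
  by apply: divp_le; nia.
(* 12 = 2 * 6: the index [r + p.-1 * i] divided by p is at least i / 2, and [dwork_small] keeps one
   sixth of that. *)
exists (12 * (N + r).+1)%N => L m ML Mm dvd.
have part n : (12 * (N + r).+1 <= n)%N -> small N
    ((1 - pK) * (\sum_(i < n) (- pK) ^+ i * a (r + p.-1 * i)%N)
   - (1 - pK) * (\sum_(i < 12 * (N + r).+1) (- pK) ^+ i * a (r + p.-1 * i)%N)).
  move=> hn; rewrite -mulrBr; apply: smallMl.
    by apply: smallB; [exact: (small_nat _ 1) | exact: small_nat].
  rewrite -!(big_mkord xpredT (fun i => (- pK) ^+ i * a (r + p.-1 * i)%N)).
  rewrite (@big_cat_nat _ _ _ (12 * (N + r).+1)%N) //= addrAC subrr add0r.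
  by rewrite big_nat; apply: small_sum => i /andP[hi _]; exact: tail.
have [z hz E] := dwork_trace_eq rp (leqnn m).
rewrite subnn in E; rewrite (_ : _ - _ = ((1 - pK) * (\sum_(i < L) (- pK) ^+ i * a (r + p.-1 * i)%N)
   - (1 - pK) * (\sum_(i < 12 * (N + r).+1) (- pK) ^+ i * a (r + p.-1 * i)%N))
  - ((1 - pK) * (\sum_(i < m) (- pK) ^+ i * a (r + p.-1 * i)%N)
   - (1 - pK) * (\sum_(i < 12 * (N + r).+1) (- pK) ^+ i * a (r + p.-1 * i)%N))
  + (r + p.-1 * m)%:R * z - (- pK) ^+ m * a (r + p.-1 * m)%N); last first.
  rewrite E /F big_ord1 muln0 add0n expr0 ffactn0 mul1r mulr1; ring.
apply: smallB (tail _ Mm); apply: smallD; first by apply: smallB; apply: part.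
by apply: smallMr hz; exact: small_dvdn.
Qed.

End Dwork.

(** * Evaluation at Dwork's pi and the additive character *)

Section Evaluation.
Context (p : nat) (pp : prime p) (p_odd : odd p).
Local Notation K := 'Q_[pp].
Local Notation pK := (p%:R : K).
Local Notation small := (@padic_small p pp).
Local Notation d := p.-1.
Implicit Types (P Q A B : {poly K}) (f g : nat -> K) (N L : nat).

Let p_gt2 : (2 < p)%N. Proof. by case: (p) pp p_odd => [|[|[|]]]. Qed.
Let d_gt0 : (0 < d)%N. Proof. by move: p_gt2; lia. Qed.
Let charK n : n.+1%:R != 0 :> K. Proof. exact: frac_nat_neq0. Qed.

Let le_divD i j : (i %/ d + j %/ d <= (i + j) %/ d)%N.
Proof. by rewrite leq_divRL // mulnDl leq_add ?leq_divM. Qed.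

(* A root of this polynomial is Dwork's [pi]. *)
Definition dwork_mod : {poly K} := 'X^d + pK%:P.
Local Notation MM := dwork_mod.

Lemma size_dwork_mod : size MM = p.
Proof. by rewrite size_XnaddC // prednK // ltnW // ltnW. Qed.

Lemma dwork_mod_neq0 : MM != 0.
Proof. by rewrite -size_poly_gt0 size_dwork_mod (ltn_trans _ p_gt2). Qed.

Lemma modXn n : 'X^n %% MM = (- pK) ^+ (n %/ d) *: 'X^(n %% d).
Proof.
rewrite {1}(divn_eq n d); elim: (n %/ d)%N => [|k IH].
  rewrite mul0n add0n expr0 scale1r modp_small // size_polyXn size_dwork_mod.
  by rewrite -[X in (_ < X)%N](prednK (ltnW (ltnW p_gt2))) ltnS ltn_mod.
rewrite mulSn -addnA exprD.
have -> : 'X^d = MM - pK%:P by rewrite addrK.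
rewrite mulrBl modpD mulrC modp_mull add0r modpN mul_polyC modpZl IH scalerA.
by rewrite exprS mulNr scaleNr.
Qed.

Lemma coef_modp P i : (P %% MM)`_i =
  \sum_(n < size P) P`_n * (- pK) ^+ (n %/ d) * (i == n %% d)%N%:R.
Proof.
rewrite {1}(_ : P = \sum_(n < size P) P`_n *: 'X^n); last by rewrite -poly_def coefK.
rewrite (big_morph (fun Q => Q %% MM) (fun A B => modpD MM A B) (mod0p MM)) coef_sum.
by apply: eq_bigr => n _; rewrite modpZl modXn !coefZ coefXn mulrA.
Qed.

(** The weight of X^n is, up to sign, the scalar that reduction modulo [dwork_mod] produces from
    X^n; so the remainder of such a P has all its coefficients in [p ^ N Z_p]. *)
Definition wsmall N P := forall n, small N (pK ^+ (n %/ d) * P`_n).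

Definition eqv N P Q := forall i, small N ((P - Q) %% MM)`_i.

Lemma wsmall_modp N P i : wsmall N P -> small N (P %% MM)`_i.
Proof.
move=> h; rewrite coef_modp; apply: small_sum => n _.
apply: smallMr (small_nat _ _); rewrite exprNn mulrCA mulrC.
apply: smallMr; first by rewrite mulrC; exact: h.
by apply: small_exp; apply: smallN; exact: (small_nat _ 1).
Qed.

Lemma eqv_w N P Q : wsmall N (P - Q) -> eqv N P Q.
Proof. by move=> h i; apply: wsmall_modp. Qed.

Lemma eqv_modp N P Q : P %% MM = Q %% MM -> eqv N P Q.
Proof. by move=> h i; rewrite modpD modpN h subrr coef0; exact: small0. Qed.

Lemma eqv_trans N P Q A : eqv N P Q -> eqv N Q A -> eqv N P A.
Proof.
move=> h1 h2 i; rewrite -(subrK Q P) -addrA modpD coefD.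
by apply: smallD; [apply: h1 | apply: h2].
Qed.

Lemma eqv_sym N P Q : eqv N P Q -> eqv N Q P.
Proof. by move=> h i; rewrite -opprB modpN coefN; apply: smallN. Qed.

(** The floor of n / d is superadditive, so the weight of a product is divisible by the product of
    the weights. *)
Lemma wsmallM N M P Q : wsmall N P -> wsmall M Q -> wsmall (N + M) (P * Q).
Proof.
move=> hP hQ n; rewrite coefM mulr_sumr; apply: small_sum => i _.
have ni : (i <= n)%N by rewrite -ltnS.
have hd := le_divD i (n - i); rewrite subnKC // in hd.
rewrite -(subnK hd) !exprD -mulrA.
apply: smallMl; first by apply: small_exp; exact: small_nat.
by rewrite mulrACA; apply: smallM.
Qed.

Lemma psmall_w N P : (forall i, small N P`_i) -> wsmall N P.
Proof. by move=> h n; apply: smallMl (h n); apply: small_exp; exact: small_nat. Qed.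

Lemma eqvMl N P A B : wsmall 0 P -> eqv N A B -> eqv N (P * A) (P * B).
Proof.
move=> hP hAB i; rewrite -mulrBr -modp_mul; apply: wsmall_modp.
by rewrite -[N]add0n; apply: wsmallM => //; apply: psmall_w.
Qed.

(** Coefficients of a power series that converges at the root with integral terms. *)
Definition null f := (forall n, small 0 (pK ^+ (n %/ d) * f n)) /\
  forall N, exists M, forall n, (M <= n)%N -> small N (pK ^+ (n %/ d) * f n).

Lemma wsmall_trunc L f : null f -> wsmall 0 (\poly_(i < L) f i).
Proof. by move=> [h _] n; rewrite coef_poly; case: ifP => // _; rewrite mulr0; exact: small0. Qed.

Lemma null_mul f g N : null f -> null g -> exists M, forall i j, (M <= i + j)%N ->
  small N (pK ^+ ((i + j) %/ d) * (f i * g j)).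
Proof.
move=> [f0 fN] [g0 gN]; have [Mf hf] := fN N; have [Mg hg] := gN N.
exists (Mf + Mg)%N => i j hij; have hd := le_divD i j.
rewrite -(subnK hd) !exprD -mulrA.
apply: smallMl; first by apply: small_exp; exact: small_nat.
rewrite mulrACA; have [hi|hi] := leqP Mf i.
  by apply: smallMr; [apply: hf | apply: g0].
by apply: smallMl; [apply: f0 | apply: hg]; lia.
Qed.

Lemma null_conv f g : null f -> null g -> null (conv f g).
Proof.
move=> hf hg; split=> [n|N]; last first.
  have [M hM] := null_mul N hf hg; exists M => n hn.
  rewrite mulr_sumr; apply: small_sum => i _.
  have ni : (i <= n)%N by rewrite -ltnS.
  by have := hM i (n - i)%N; rewrite subnKC //; apply.
rewrite mulr_sumr; apply: small_sum => i _.
have ni : (i <= n)%N by rewrite -ltnS.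
have hd := le_divD i (n - i); rewrite subnKC // in hd.
rewrite -(subnK hd) !exprD -mulrA.
apply: smallMl; first by apply: small_exp; exact: small_nat.
by rewrite mulrACA; apply: smallMl; [apply: hf.1 | apply: hg.1].
Qed.

Lemma null_trunc_conv f g N : null f -> null g -> exists M, forall L, (M <= L)%N ->
  eqv N (\poly_(i < L) f i * \poly_(i < L) g i) (\poly_(i < L) conv f g i).
Proof.
move=> hf hg; have [M hM] := null_mul N hf hg; exists M => L ML.
apply: eqv_w => n; rewrite coefB [X in _ - X]coef_poly; case: ltnP => nL.
  by rewrite coef_poly_mul // subrr mulr0; exact: small0.
rewrite subr0 coefM mulr_sumr; apply: small_sum => i _; rewrite !coef_poly.
case: ifP => _; last by rewrite mul0r mulr0; exact: small0.
case: ifP => _; last by rewrite !mulr0; exact: small0.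
have ni : (i <= n)%N by rewrite -ltnS.
have := hM i (n - i)%N; rewrite subnKC //; apply.
exact: leq_trans ML nL.
Qed.

Lemma null_trunc f N : null f -> exists M, forall L L', (M <= L)%N -> (M <= L')%N ->
  eqv N (\poly_(i < L) f i) (\poly_(i < L') f i).
Proof.
move=> [_ /(_ N)[M hM]]; exists M => L L' ML ML'; apply: eqv_w => n.
rewrite coefB !coef_poly; have [nM|nM] := ltnP n M.
  by rewrite !(leq_trans nM) // subrr mulr0; exact: small0.
rewrite mulrBr; apply: smallB; case: ifP => _; rewrite ?mulr0; by [exact: hM | exact: small0].
Qed.

Lemma small_expsp (v : K) n : small 0 v -> small n./2 (exps (pK * v) n).
Proof.
move=> hv; rewrite /exps exprMn mulrAC; apply: smallMr; last exact: small_exp.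
rewrite -[X in pK ^+ X](odd_double_half n) -addnn addnA exprD -mulrA.
rewrite -[X in small X _]addn0; apply: smallM; last exact: small_factV.
by apply: small_le (small_pX _ _); rewrite leq_addl.
Qed.

Lemma null_expsp v : small 0 v -> null (exps (pK * v)).
Proof.
move=> hv; have h n : small n./2 (pK ^+ (n %/ d) * exps (pK * v) n).
  by apply: smallMl; [apply: small_exp; exact: small_nat | exact: small_expsp].
split=> [n|N]; first exact: small_le (h n).
by exists (N.*2) => n hn; apply: small_le (h n); rewrite geq_half_double.
Qed.

Lemma null_dil v : small 0 v -> null (dil p (exps v)).
Proof.
move=> hv; have h n : small (n %/ p)./2 (pK ^+ (n %/ d) * dil p (exps v) n).
  rewrite /dil; case: ifP => _; last by rewrite mulr0; exact: small0.
  have hd : (n %/ p <= n %/ d)%N by apply: leq_div2l; rewrite ?leq_pred.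
  rewrite -(subnK hd) exprD -mulrA; apply: smallMl.
    by apply: small_exp; exact: small_nat.
  by rewrite mulrA -exprMn; exact: small_expsp.
split=> [n|N]; first exact: small_le (h n).
exists (N.*2 * p)%N => n hn; apply: small_le (h n).
by rewrite geq_half_double leq_divRL // (ltn_trans _ p_gt2).
Qed.

Lemma null_dwork (t : K) : small 0 t -> null (fun n => dwork pp n * t ^+ n).
Proof.
move=> ht; have h n : small (n %/ p %/ 6) (pK ^+ (n %/ d) * (dwork pp n * t ^+ n)).
  rewrite mulrA; apply: smallMr (small_exp _ ht); apply: dwork_small_le => //.
  by apply: leq_div2l; rewrite ?leq_pred.
split=> [n|N]; first exact: small_le (h n).
exists (N * 6 * p)%N => n hn; apply: small_le (h n).
by rewrite !leq_divRL // (ltn_trans _ p_gt2).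
Qed.

(* [exp (p v X + v X ^ p)] evaluates to [1], because [X ^ p = - p X]. *)
Lemma exp2_modp v N : small 0 v -> exists M, forall L, (M <= L)%N ->
  eqv N (\poly_(i < p * L) exp2 p (pK * v) v i) 1.
Proof.
move=> hv; have hv' : small 0 (- v) by apply: smallN.
have n1 := null_expsp hv; have n2 := null_expsp hv'; have n3 := null_dil hv.
have [M1 h1] := null_trunc_conv N n1 n3.
have [M2 h2] := null_trunc_conv N n1 n2.
have [M3 h3] := null_trunc N n2.
exists (M1 + M2 + M3).+1 => L hL; have LpL : (L <= p * L)%N by rewrite leq_pmull // (ltn_trans _ p_gt2).
apply: eqv_trans (eqv_sym (h1 _ _)) _; first by lia.
(* X^p = - p X turns exp (v X^p) into exp (- p v X), the inverse of the other factor. The truncation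
   length is a multiple of p so that the truncated dilation is exactly a polynomial in X^p. *)
have e : eqv N (\poly_(i < p * L) dil p (exps v) i) (\poly_(i < p * L) exps (pK * - v) i).
  apply: eqv_trans (h3 L _ _ _); try lia.
  apply: eqv_modp.
  have -> : \poly_(i < p * L) dil p (exps v) i = (\poly_(i < L) exps v i) \Po 'X^p.
    apply/polyP => i; rewrite coef_comp_poly_Xn ?coef_poly ?(ltn_trans _ p_gt2) //.
    rewrite /dil; case: (boolP (p %| i)%N) => pi; last by case: ifP.
    by rewrite ltn_divLR ?(ltn_trans _ p_gt2) // mulnC.
  have -> : \poly_(i < L) exps (pK * - v) i = (\poly_(i < L) exps v i) \Po (- pK *: 'X).
    rewrite !poly_def linear_sum /=; apply: eq_bigr => i _.
    rewrite linearZ /= comp_Xn_poly exprZn scalerA; congr (_ *: _).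
    by rewrite /exps mulrN -mulNr exprMn; ring.
  have hX : 'X^p %% MM = (- pK *: 'X) %% MM.
    have d1 : (1 < d)%N by lia.
    have q1 m : (1 < m)%N -> (m.+1 %/ m = 1)%N /\ (m.+1 %% m = 1)%N.
      by move=> m1; rewrite -addn1 divnDl // divnn modnDl modn_small // divn_small // ltnW.
    have [] := q1 d d1; rewrite prednK ?(ltn_trans _ p_gt2) // => e1 e2.
    by rewrite modpZl modXn e1 e2 -[X in X %% _]expr1 modXn divn_small // modn_small // expr0 scale1r expr1.
  have modM A B A' B' : A %% MM = A' %% MM -> B %% MM = B' %% MM ->
      (A * B) %% MM = (A' * B') %% MM.
    by move=> hA hB; rewrite -(modp_mul A B) hB modp_mul mulrC -modp_mul hA modp_mul mulrC.
  have hXn n : ('X^p) ^+ n %% MM = ((- pK *: 'X) ^+ n) %% MM.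
    elim: n => [|n IH].
      exact: (congr1 (fun Q => Q %% MM) (etrans (expr0 _) (esym (expr0 _)))).
    rewrite [in LHS]exprS.
    rewrite [in RHS]exprS.
    exact: modM.
  rewrite !comp_polyE !(big_morph (fun Q => Q %% MM) (fun A B => modpD MM A B) (mod0p MM)).
  by apply: eq_bigr => i _; rewrite !modpZl hXn.
apply: eqv_trans (eqvMl (wsmall_trunc _ n1) e) _.
apply: eqv_trans (h2 _ _) _; first by lia.
rewrite conv_exps // mulrN subrr.
apply: eqv_modp; congr (_ %% _); apply/polyP => i; rewrite coef_poly coef1 /exps expr0n.
have pL : (0 < p * L)%N by lia.
by case: i => [|i]; rewrite ?pL ?fact0 ?divr1 //= mul0r if_same.
Qed.

Lemma coef_modp_poly f L r : (r < d)%N ->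
  ((\poly_(i < d * L) f i) %% MM)`_r = \sum_(k < L) (- pK) ^+ k * f (r + d * k)%N.
Proof.
move=> rd; rewrite poly_def.
rewrite (big_morph (fun Q => Q %% MM) (fun A B => modpD MM A B) (mod0p MM)) coef_sum.
under eq_bigr => i _ do rewrite modpZl modXn !coefZ coefXn.
rewrite -(big_mkord xpredT (fun i => f i * ((- pK) ^+ (i %/ d) * (r == i %% d)%N%:R))).
elim: L => [|L IH]; first by rewrite muln0 big_nil big_ord0.
rewrite mulnS addnC (@big_cat_nat _ _ _ (d * L)%N) ?leq_addr //= IH big_ord_recr /=.
congr (_ + _); rewrite -[X in \sum_(X <= _ < _) _]add0n [(d * L + d)%N]addnC big_addn addnK.
have md i : (i < d)%N -> ((i + d * L) %% d = i /\ (i + d * L) %/ d = L)%N.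
  by move=> id; rewrite (mulnC d) addnC modnMDl modn_small // divnMDl // divn_small // addn0.
rewrite big_mkord (bigD1 (Ordinal rd)) //= big1 ?addr0 => [|i ir].
  by have [-> ->] := md _ rd; rewrite eqxx mulr1 mulrC.
move: ir; rewrite -(inj_eq val_inj) /= => ir.
by have [-> _] := md _ (ltn_ord i); rewrite eq_sym (negPf ir) !mulr0.
Qed.

Lemma coef_modp_small P r : (r < d)%N -> (size P <= d + d)%N ->
  (P %% MM)`_r = P`_r - pK * P`_(d + r).
Proof.
move=> rd sP.
have -> : P = \poly_(i < d * 2) P`_i.
  apply/polyP => i; rewrite coef_poly; case: ifPn => // hi.
  by rewrite nth_default // (leq_trans sP) // leqNgt; apply: contra hi; lia.
rewrite coef_modp_poly // !big_ord_recl big_ord0 !coef_poly.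
have -> : (r < d * 2)%N by lia.
have -> : (d + r < d * 2)%N by lia.
by rewrite /bump /= muln0 addn0 muln1 addr0 (addnC r) expr0 mul1r -[bump 0 0]/1%N expr1 mulNr.
Qed.

Context (gam : nat -> K).
Hypothesis gam_small : forall r, (r < d)%N -> small 0 (gam r).
Hypothesis gam_lim : forall r N, (r < d)%N -> exists M, forall L, (M <= L)%N ->
  small N (\sum_(k < L) (- pK) ^+ k * dwork pp (r + d * k)%N - gam r).

Let gam_poly (t : K) : {poly K} := \poly_(r < d) (gam r * t ^+ r).

Lemma dwork_eqv (t : K) N : small 0 t -> t ^+ d = 1 -> exists M, forall L, (M <= L)%N ->
  eqv N (\poly_(i < d * L) (dwork pp i * t ^+ i)) (gam_poly t).
Proof.
move=> ht td.
have [M hM] : exists M, forall r, (r < d)%N -> forall L, (M <= L)%N ->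
    small N (\sum_(k < L) (- pK) ^+ k * dwork pp (r + d * k)%N - gam r).
  (* A common bound for the finitely many r, by induction on their range; the repeated hypothesis
     keeps r < d while the first copy is generalised. *)
  suff [M hM] : exists M, forall r, (r < d)%N -> (r < d)%N -> forall L, (M <= L)%N ->
    small N (\sum_(k < L) (- pK) ^+ k * dwork pp (r + d * k)%N - gam r).
    by exists M => r rd; exact: hM.
  elim: {1}d => [|e [M hM]]; first by exists 0%N.
  have [ed|de] := ltnP e d; last first.
    exists M => r; rewrite ltnS leq_eqVlt => /orP[/eqP ->|/hM]; last by [].
    by rewrite ltnNge de.
  have [M' hM'] := gam_lim N ed; exists (M + M')%N => r re rd L hL.
  move: re; rewrite ltnS leq_eqVlt => /orP[/eqP ->|re]; first by apply: hM'; lia.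
  by apply: hM => //; lia.
exists M => L ML i; rewrite modpD modpN coefB.
have [id|di] := ltnP i d; last first.
  have sz P : (size (P %% MM)%R <= i)%N.
    have : (size (P %% MM)%R < size MM)%N by rewrite ltn_modp dwork_mod_neq0.
    by rewrite size_dwork_mod; lia.
  by rewrite !nth_default // subrr; exact: small0.
rewrite coef_modp_poly // [in X in _ - X]modp_small; last first.
  by rewrite (leq_ltn_trans (size_poly _ _)) // size_dwork_mod ltn_predL (ltn_trans _ p_gt2).
rewrite coef_poly id.
have -> : \sum_(k < L) (- pK) ^+ k * (dwork pp (i + d * k)%N * t ^+ (i + d * k)) =
   t ^+ i * \sum_(k < L) (- pK) ^+ k * dwork pp (i + d * k)%N.
  rewrite mulr_sumr; apply: eq_bigr => k _.
  by rewrite exprD exprM td expr1n; ring.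
rewrite (mulrC (gam i)) -mulrBr; apply: smallMl; [exact: small_exp|exact: hM].
Qed.

(** As s^p = s, the two factors are exp (X + X^p / p) and exp (s X + s X^p / p). Their exponents add
    up to (1 + s)(X + X^p / p), and the excess of 1 + s = u + p v over u contributes exp (p v X + v
    X^p), which is 1 by [exp2_modp]. *)
Lemma dwork_add (s u v : K) N : small 0 s -> small 0 u -> small 0 v ->
  s ^+ p = s -> u ^+ p = u -> 1 + s = u + pK * v ->
  exists M, forall L, (M <= L)%N ->
  eqv N (\poly_(i < p * L) (dwork pp i * 1 ^+ i) * \poly_(i < p * L) (dwork pp i * s ^+ i))
        (\poly_(i < p * L) (dwork pp i * u ^+ i)).
Proof.
move=> hs hu hv sp up suv; have h1 : small 0 1 by exact: (small_nat _ 1).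
have n1 := null_dwork h1; have ns := null_dwork hs; have nu := null_dwork hu.
have tE t : t ^+ p = t -> (fun n => dwork pp n * t ^+ n) = exp2 p t (pK^-1 * t).
  by move=> tp; apply/funext => n; rewrite -exp2_scale mul1r tp.
have nv : null (exp2 p (pK * v) v) by apply: null_conv; [exact: null_expsp | exact: null_dil].
have [M1 hM1] := null_trunc_conv N n1 ns.
have [M2 hM2] := null_trunc_conv N nu nv.
have [M3 hM3] := exp2_modp N hv.
exists (M1 + M2 + M3)%N => L hL; have LpL : (L <= p * L)%N by rewrite leq_pmull // (ltn_trans _ p_gt2).
apply: eqv_trans (hM1 _ _) _; first by lia.
rewrite (tE 1) ?expr1n // (tE s sp) conv_exp2 ?(ltn_trans _ p_gt2) //.
apply: (@eqv_trans _ _ (\poly_(i < p * L) (dwork pp i * u ^+ i) *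
   \poly_(i < p * L) exp2 p (pK * v) v i)).
  apply: eqv_sym; have := hM2 (p * L)%N; rewrite (tE u up) conv_exp2 ?(ltn_trans _ p_gt2) //.
  rewrite -mulrDr suv mulrDr mulKf ?pK_neq0 //; apply; lia.
rewrite -[X in eqv _ _ X]mulr1; apply: eqvMl; first exact: wsmall_trunc.
by apply: hM3; lia.
Qed.

(* Dwork's additive character, in coordinates with respect to the powers of
   [pi] and with one of the two arguments equal to [1]. *)
Lemma gam_additive (s u v : K) h : small 0 s -> small 0 u -> small 0 v ->
  s ^+ d = 1 -> u ^+ p = u -> 1 + s = u + pK * v -> (0 < h < d)%N ->
  \sum_(i < d) (if (i <= h)%N then gam (h - i)%N * gam i else - pK * gam (h + d - i)%N * gam i)
    * s ^+ i = gam h * u ^+ h.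
Proof.
move=> hs hu hv sd up suv /andP[h0 hd]; have h1 : small 0 1 by exact: (small_nat _ 1).
have pE : p = d.+1 by move: p_gt2; lia.
have sp : s ^+ p = s.
  by transitivity (s ^+ d.+1); [congr (_ ^+ _) | rewrite exprS sd mulr1].
have gam_w t : small 0 t -> wsmall 0 (gam_poly t).
  move=> ht; apply: psmall_w => i; rewrite coef_poly; case: ifP => id; last exact: small0.
  by apply: smallMl; [exact: gam_small | exact: small_exp].
pose G := gam_poly 1 * gam_poly s.
have main N : small N ((G %% MM)`_h - gam h * u ^+ h).
  have [M0 hM0] := gam_lim N hd.
  have [M1 hM1] := dwork_eqv N h1 (expr1n _ _).
  have [M2 hM2] := dwork_eqv N hs sd.
  have [M3 hM3] := dwork_add N hs hu hv sp up suv.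
  pose L := (M0 + M1 + M2 + M3)%N.
  (* The length is a multiple of d for [coef_modp_poly] and of p for [dwork_add]. *)
  have LE : (d * (p * L) = p * (d * L))%N by rewrite mulnCA.
  have pL : (L <= p * L)%N by rewrite leq_pmull // (ltn_trans _ p_gt2).
  have dL : (L <= d * L)%N by rewrite leq_pmull.
  have e : eqv N G (\poly_(i < d * (p * L)) (dwork pp i * u ^+ i)).
    apply: eqv_trans; last first.
      by rewrite LE; apply: hM3; lia.
    rewrite -LE; apply: eqv_sym.
    apply: eqv_trans (eqvMl _ (hM2 _ _)) _; try lia.
      exact: wsmall_trunc (null_dwork h1).
    rewrite mulrC /G (mulrC (gam_poly 1)); apply: eqvMl; first exact: gam_w.
    by apply: hM1; lia.
  have := e h; rewrite modpD modpN coefB coef_modp_poly // => e'.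
  have -> : (G %% MM)`_h - gam h * u ^+ h = ((G %% MM)`_h -
    \sum_(k < p * L) (- pK) ^+ k * (dwork pp (h + d * k)%N * u ^+ (h + d * k)))
    + u ^+ h * (\sum_(k < p * L) (- pK) ^+ k * dwork pp (h + d * k)%N - gam h).
    rewrite mulrBr mulr_sumr; set A := \sum_(_ < _) _; set B := \sum_(_ < _) _.
    suff -> : A = B by ring.
    apply: eq_bigr => k _.
    suff -> : u ^+ (h + d * k) = u ^+ h by ring.
    elim: (k : nat) => [|j IH]; first by rewrite muln0 addn0.
    rewrite mulnS addnA (addnC h) -addnA exprD IH -(prednK h0) exprS mulrA -exprSr.
    by rewrite -pE up.
  by apply: smallD => //; apply: smallMl; [exact: small_exp | apply: hM0; lia].
have := small_eq0 main => /eqP; rewrite subr_eq0 => /eqP <-.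
rewrite coef_modp_small //; last first.
  apply: leq_trans (size_polyMleq _ _) _.
  by rewrite (leq_trans (leq_pred _)) // leq_add // size_poly.
rewrite /G !coefMr (bigID (fun i : 'I_d => (i <= h)%N)) /=; congr (_ + _).
  rewrite (big_ord_widen d (fun i => (gam_poly 1)`_(h - i) * (gam_poly s)`_i)) //.
  apply: eq_big => [i|i ih]; first by rewrite ltnS.
  rewrite ih !coef_poly ltn_ord expr1n mulr1 (leq_ltn_trans (leq_subr _ _) hd); ring.
rewrite -mulNr mulr_sumr.
pose T i := - pK * ((gam_poly 1)`_(d + h - i) * (gam_poly s)`_i).
have -> : \sum_(i < (d + h).+1) T i = \sum_(i < (d + h).+1 | (i < d)%N) T i.
  rewrite [RHS]big_mkcond; apply: eq_bigr => i _; case: ifPn => // id.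
  by rewrite /T [X in _ * (_ * X)]coef_poly (negPf id) !mulr0.
have dh : (d <= (d + h).+1)%N by lia.
rewrite -(big_ord_widen _ T dh) [RHS](bigID (fun i : 'I_d => (i <= h)%N)) /=.
rewrite [X in _ = X + _]big1 ?add0r => [|i ih].
  apply: eq_bigr => i ih; rewrite (negPf ih) /T !coef_poly ltn_ord (addnC h).
  by rewrite (_ : (d + h - i < d)%N) ?expr1n; [ring | lia].
by rewrite /T coef_poly ifF ?mul0r ?mulr0 //; lia.
Qed.

End Evaluation.

(** * Morita's gamma function *)

Section Morita.
Context (p : nat) (pp : prime p) (p_odd : odd p).
Local Notation Zp := (padic_int pp).
Local Notation K := 'Q_[pp].
Local Notation d := p.-1.
Local Notation h := p.-1./2.
Implicit Types (x y : Zp) (f g : Zp -> Zp).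

Let p_gt2 : (2 < p)%N. Proof. by case: (p) pp p_odd => [|[|[|]]]. Qed.
Let d_gt0 : (0 < d)%N. Proof. by move: p_gt2; lia. Qed.

Local Notation small := (@padic_small p pp).
Local Notation Gam := (@morita_gamma p pp).

Definition padic_cont f := forall x n, exists m, forall y,
  padic_res y m = padic_res x m -> padic_res (f y) n = padic_res (f x) n.

Lemma padic_res_eq_le x y m n : (m <= n)%N ->
  padic_res y n = padic_res x n -> padic_res y m = padic_res x m.
Proof. by move=> mn e; rewrite -(padic_res_le y mn) e padic_res_le. Qed.

Lemma cont_id : padic_cont id.
Proof. by move=> x n; exists n. Qed.

Lemma cont_const z : padic_cont (fun=> z).
Proof. by move=> x n; exists n. Qed.

Lemma contM f g : padic_cont f -> padic_cont g -> padic_cont (fun x => f x * g x).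
Proof.
move=> hf hg x n; have [m1 h1] := hf x n; have [m2 h2] := hg x n.
exists (m1 + m2)%N => y yx; rewrite !padic_resM.
by rewrite h1 ?h2 //; apply: (padic_res_eq_le _ yx); rewrite ?leq_addr ?leq_addl.
Qed.

Lemma contD f g : padic_cont f -> padic_cont g -> padic_cont (fun x => f x + g x).
Proof.
move=> hf hg x n; have [m1 h1] := hf x n; have [m2 h2] := hg x n.
exists (m1 + m2)%N => y yx; rewrite !padic_resD.
by rewrite h1 ?h2 //; apply: (padic_res_eq_le _ yx); rewrite ?leq_addr ?leq_addl.
Qed.

Lemma contN f : padic_cont f -> padic_cont (fun x => - f x).
Proof.
move=> hf; have -> : (fun x => - f x) = (fun x => -1 * f x).
  by apply/funext => x; rewrite mulN1r.
by apply: contM hf; exact: cont_const.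
Qed.

Lemma cont_comp f g : padic_cont f -> padic_cont g -> padic_cont (fun x => f (g x)).
Proof.
move=> hf hg x n; have [m h1] := hf (g x) n; have [m2 h2] := hg x m.
by exists m2 => y /h2 /h1.
Qed.

Lemma cont_gamma : padic_cont Gam.
Proof. exact/padic_continuousP/(morita_gamma_continuous (morita_gammaP pp p_odd)). Qed.

Lemma nat_dense x n : exists k, [/\ (0 < k)%N,
  padic_res (k%:R : Zp) n = padic_res x n & (k %% p)%N = padic_res x 1].
Proof.
(* Level [n.+1] fixes the residue mod p even for n = 0, and the second summand makes k positive. *)
exists (padic_res x n.+1 + p ^ n.+1)%N; split.
- by rewrite ltn_addl // expn_gt0 prime_gt0.
- rewrite padic_res_nat -modnDmr (_ : p ^ n.+1 %% p ^ n = 0)%N; last first.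
    by apply/eqP; rewrite -/(dvdn _ _) dvdn_exp2l.
  by rewrite addn0 padic_res_le.
by rewrite expnS mulnC addnC modnMDl -[X in (_ %% X)%N]expn1 padic_res_le.
Qed.

(** Density of the positive integers, restricted to the class of x mod p: there the correction [e]
    of [gamma_duplication_padic] is constant. *)
Lemma cont_eq f g x : padic_cont f -> padic_cont g ->
  (forall k, (0 < k)%N -> (k %% p)%N = padic_res x 1 -> f k%:R = g k%:R) -> f x = g x.
Proof.
move=> hf hg fg; apply: padic_resP => n.
have [m1 h1] := hf x n; have [m2 h2] := hg x n.
have [k [k0 kx kc]] := nat_dense x (m1 + m2).
rewrite -(h1 k%:R) ?(padic_res_eq_le _ kx) ?leq_addr //.
by rewrite -(h2 k%:R) ?(padic_res_eq_le _ kx) ?leq_addl // fg.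
Qed.

Definition unit_part x := if padic_res x 1 == 0%N then 1 else x.

Lemma unit_part_unit x : unit_part x \is a GRing.unit.
Proof. by rewrite /unit_part; case: ifPn; rewrite ?unitr1 ?padic_unitE. Qed.

Lemma cont_unit_part : padic_cont unit_part.
Proof.
move=> x n; exists n.+1 => y yx; rewrite /unit_part.
rewrite (padic_res_eq_le (ltn0Sn n) yx); case: ifP => // _.
exact: padic_res_eq_le yx.
Qed.

Lemma gamma_nat k : (0 < k)%N ->
  Gam k%:R = (-1) ^+ k * \prod_(1 <= j < k | ~~ (p %| j)%N) j%:R.
Proof. exact: morita_gamma_nat (morita_gammaP pp p_odd) k. Qed.

Lemma gamma0 : Gam 0 = 1. Proof. exact: morita_gamma0 (morita_gammaP pp p_odd). Qed.

Lemma gamma1 : Gam 1 = -1.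
Proof. by rewrite -[1]/(1%:R) gamma_nat // big_nil mulr1 expr1. Qed.

Lemma gammaS x : Gam (x + 1) = - unit_part x * Gam x.
Proof.
apply: (@cont_eq (fun x => Gam (x + 1)) (fun x => - unit_part x * Gam x)).
- by apply: cont_comp; [exact: cont_gamma | apply: contD; [exact: cont_id|exact: cont_const]].
- by apply: contM cont_gamma; apply/contN/cont_unit_part.
move=> k k0 _; rewrite natr1 !gamma_nat // big_mkcond big_nat_recr //= -big_mkcond /=.
rewrite /unit_part padic_res_nat expn1 -/(dvdn p k) exprS.
by case: (p %| k)%N => /=; ring.
Qed.

Lemma gamma_unit x : Gam x \is a GRing.unit.
Proof.
rewrite padic_unitE; have [m hm] := cont_gamma x 1.
have [k [k0 kx _]] := nat_dense x m; rewrite -(hm _ kx) -padic_unitE gamma_nat //.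
rewrite unitrM unitrX ?unitrN1 //=; apply: rpred_prod => j; exact: padic_unit_nat.
Qed.

Lemma unit_partN x : unit_part (- x) ^+ 2 = unit_part x ^+ 2.
Proof.
have e : (padic_res (- x) 1 == 0%N) = (padic_res x 1 == 0%N).
  by apply/negb_inj; rewrite -!padic_unitE unitrN.
by rewrite /unit_part e; case: ifP => // _; rewrite sqrrN.
Qed.

(** The sign of Gamma_p(x) Gamma_p(1 - x) depends on x mod p. Its square has period 1, by [gammaS]
    and [unit_partN], hence is constant by density. *)
Lemma gamma_reflection x : (Gam x * Gam (1 - x)) ^+ 2 = 1.
Proof.
pose Q x := (Gam x * Gam (1 - x)) * (Gam x * Gam (1 - x)).
suff : Q x = 1 by rewrite expr2.
have QS y : Q (y + 1) = Q y.
  have e1 := gammaS y; have e2 := gammaS (- y); rewrite (addrC (- y)) in e2.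
  have e3 := unit_partN y; rewrite !expr2 in e3.
  apply: (mulIr (unit_part_unit (- y))); apply: (mulIr (unit_part_unit (- y))).
  rewrite /Q opprD addrCA subrr addr0 e1 e2.
  transitivity (unit_part y * unit_part y * (Gam y * Gam y * Gam (- y) * Gam (- y) *
   (unit_part (- y) * unit_part (- y)))); first ring.
  rewrite -e3; ring.
apply: (@cont_eq Q (fun=> 1)); last first.
- move=> k _ _; elim: k => [|k IH]; last by rewrite -natr1 QS.
  by rewrite /Q subr0 gamma0 gamma1; ring.
- exact: cont_const.
- have c1 : padic_cont (fun x => 1 - x).
    by apply: contD; [exact: cont_const | apply/contN/cont_id].
  have c2 : padic_cont (fun x => Gam x * Gam (1 - x)).
    by apply: contM; [exact: cont_gamma | apply: cont_comp c1; exact: cont_gamma].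
  exact: (contM c2 c2).
Qed.

Lemma small_eq_res N x y : padic_res x N = padic_res y N -> small N (tofrac (x - y)).
Proof.
move=> e; apply/small_padic_res; rewrite padic_resD e -padic_resD subrr.
by rewrite -(mulr0n 1) padic_res_nat mod0n.
Qed.

Definition ratio_d r : Zp := r%:R / d%:R.

Lemma d_unit : (d%:R : Zp) \is a GRing.unit.
Proof. by apply: padic_unit_nat; rewrite gtnNdvd // ltn_predL; move: p_gt2; lia. Qed.

Lemma d_frac_neq0 : (d%:R : K) != 0. Proof. exact: frac_nat_neq0. Qed.

Lemma natr_d (F : pzRingType) : (d%:R : F) = p%:R - 1.
Proof. by rewrite -[in RHS](prednK (prime_gt0 pp)) -natr1 addrK. Qed.

(** The coefficient of (pi t)^r in Dwork's additive character: for r > 0 this is a Gauss sum divided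
    by (p - 1) pi^r, with the value that Gross-Koblitz predicts. *)
Definition gauss_gamma r : Zp := - (-1) ^+ r.+1 / Gam (1 - ratio_d r) / d%:R.

Lemma gauss_gamma_lim r N : (r < d)%N -> exists M, forall L, (M <= L)%N ->
  small N (\sum_(k < L) (- p%:R) ^+ k * dwork pp (r + d * k)%N
                    - tofrac (gauss_gamma r)).
Proof.
move=> rd; have rp : (r < p)%N by move: p_gt2; lia.
have [M hM] := dwork_trace pp p_odd N rp.
have [m0 hm0] := cont_gamma (1 - ratio_d r) N.
pose N' := (N + m0)%N.
(* A natural number above M and close to - r / d. Then p^N' divides r + d m, so that p m + r + 1 = 1
   + m + (r + d m) is close to 1 - r / d. *)
pose m := (padic_res (- ratio_d r) N' + p ^ N' * M)%N.
have Mm : (M <= m)%N.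
  by apply: leq_trans (leq_addl _ _); rewrite leq_pmull // expn_gt0 prime_gt0.
have mE : padic_res (m%:R : Zp) N' = padic_res (- ratio_d r) N'.
  by rewrite padic_res_nat /m addnC mulnC modnMDl padic_res_mod.
have zE : padic_res ((r + d * m)%:R : Zp) N' = 0%N.
  rewrite natrD natrM padic_resD padic_resM mE -padic_resM -padic_resD.
  rewrite mulrN /ratio_d mulrCA divrr ?d_unit // mulr1 subrr.
  by rewrite -(mulr0n 1) padic_res_nat mod0n.
have dvd : (p ^ N' %| r + d * m)%N by move: zE; rewrite padic_res_nat => /eqP.
pose y : Zp := (p * m + r).+1%:R.
have yE : padic_res y N' = padic_res (1 - ratio_d r) N'.
  have -> : y = 1 + m%:R + (r + d * m)%:R.
    rewrite /y -(natrD _ 1) -natrD; congr _%:R.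
    by have -> : (p * m = m + d * m)%N; [rewrite -mulSn prednK ?prime_gt0 | lia].
  rewrite padic_resD zE addn0 padic_resD mE -padic_resD padic_res_mod //.
have gE : padic_res (Gam y) N = padic_res (Gam (1 - ratio_d r)) N.
  by apply: hm0; apply: padic_res_eq_le yE; rewrite leq_addl.
have FE : dwork_sum pp m r = tofrac ((-1) ^+ r.+1 / Gam y).
  have u0 : tofrac (Gam y) != 0 :> K.
    by rewrite tofrac_eq0; apply: contraTneq (gamma_unit y) => ->; rewrite unitr0.
  apply: (mulIf u0); rewrite -rmorphM divrK ?gamma_unit // /y gamma_nat // -natr_prod.
  rewrite rmorphM rmorph_nat mulrCA -/(unit_fact p (p * m + r)) dwork_sum_digit //.
  rewrite rmorphXn rmorphN rmorph1 -exprD !rmorphXn rmorphN rmorph1.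
  rewrite -signr_odd -[RHS]signr_odd; congr (_ ^+ (nat_of_bool _)).
  by rewrite oddD !oddS oddD oddM p_odd /=; case: (odd m); case: (odd r).
exists M => L ML.
have hd : tofrac (d%:R) != 0 :> K by rewrite rmorph_nat d_frac_neq0.
have dV : small 0 (tofrac (d%:R^-1 : Zp)) by exact: small_tofrac.
have dVE : tofrac (d%:R^-1 : Zp) = (d%:R : K)^-1.
  by apply: (mulfI hd); rewrite -rmorphM divrr ?d_unit // rmorph1 rmorph_nat divff // d_frac_neq0.
have key : small N ((1 - p%:R) * (\sum_(k < L) (- p%:R) ^+ k * dwork pp (r + d * k)%N)
     - tofrac ((-1) ^+ r.+1 / Gam (1 - ratio_d r))).
  rewrite -(subrK (dwork_sum pp m r) (_ * _)) -addrA; apply: smallD.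
    apply: hM => //; apply: dvdn_trans dvd; rewrite dvdn_exp2l ?leq_addr //.
  rewrite FE -rmorphB.
  have -> : (-1) ^+ r.+1 / Gam y - (-1) ^+ r.+1 / Gam (1 - ratio_d r) =
      ((-1) ^+ r.+1 / Gam y / Gam (1 - ratio_d r)) * (Gam (1 - ratio_d r) - Gam y).
    rewrite mulrBr divrK ?gamma_unit // mulrAC divrK ?gamma_unit //.
  by rewrite rmorphM; apply: smallMl; [exact: small_tofrac | apply: small_eq_res].
rewrite (_ : _ - _ = - (d%:R : K)^-1 * ((1 - p%:R) * (\sum_(k < L) (- p%:R) ^+ k * dwork pp (r + d * k)%N)
     - tofrac ((-1) ^+ r.+1 / Gam (1 - ratio_d r)))).
  by apply: smallMl => //; apply: smallN; rewrite -dVE.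
have -> : tofrac (gauss_gamma r) = - tofrac ((-1) ^+ r.+1 / Gam (1 - ratio_d r)) / (d%:R : K).
  by rewrite -dVE -rmorphN -rmorphM /gauss_gamma mulNr.
have -> : 1 - p%:R = - (d%:R : K) by rewrite natr_d opprB.
move: d_frac_neq0; move: (d%:R : K) (tofrac _) (\sum_(_ < _) _) => D B S D0.
by rewrite mulrBr mulrA mulrNN mulVf // mul1r !mulNr !opprK (mulrC B).
Qed.

Lemma gauss_gamma_sq r : (gauss_gamma r * d%:R) ^+ 2 = Gam (ratio_d r) ^+ 2.
Proof.
have h1 := gamma_reflection (ratio_d r); have gu := gamma_unit (1 - ratio_d r).
rewrite /gauss_gamma divrK ?d_unit // mulNr sqrrN exprMn sqrr_sign mul1r.
apply: (mulIr (unitrX 2 gu)); rewrite -!exprMn h1 mulVr // expr1n //.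
Qed.

End Morita.

(** * The duplication formula for Gamma_p *)

Section Duplication.
Context (p : nat) (pp : prime p) (p_odd : odd p).
Local Notation Zp := (padic_int pp).
Local Notation d := p.-1.
Local Notation h := p.-1./2.
Local Notation Gam := (@morita_gamma p pp).
Implicit Types (x y : Zp).

Let p_gt2 : (2 < p)%N. Proof. by case: (p) pp p_odd => [|[|[|]]]. Qed.

Lemma gamma_mulI x (u v : Zp) : u * Gam x = v * Gam x -> u = v.
Proof. exact: (mulIr (gamma_unit p_odd x)). Qed.

(** Among p consecutive i each side omits one factor 2: the right one when p divides i, the left one
    at i = h mod p, where p divides 2i + 1. In an unfinished block of length c the right side has
    lost its factor once c > 0, the left side only once c > h. *)
Lemma pow2_count k :
  (\prod_(i < k) (if (p %| i.*2.+1)%N then 1 else 2) =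
   \prod_(i < k) (if (p %| i)%N then 1 else 2) * (if (0 < k %% p <= h)%N then 2 else 1))%N.
Proof.
elim: k => [|k IH]; first by rewrite !big_ord0 mod0n.
rewrite !big_ord_recr /= IH.
have kp : (k %% p < p)%N by rewrite ltn_mod prime_gt0.
have e1 : (p %| k)%N = (k %% p == 0)%N by [].
have e2 : (p %| k.*2.+1)%N = (k %% p == h)%N.
  rewrite /dvdn -addn1 -muln2 -modnDml -modnMml modnDml.
  have [lt|ge] := ltnP (k %% p * 2 + 1) p.
    by rewrite modn_small //; apply/idP/idP; lia.
  have -> : (k %% p * 2 + 1 = 1 * p + (k %% p * 2 + 1 - p))%N by lia.
  by rewrite modnMDl modn_small; [apply/idP/idP; lia | lia].
have e3 : (k.+1 %% p = if k %% p == d then 0 else (k %% p).+1)%N.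
  rewrite -addn1 -modnDml; case: eqP => [->|kd]; last by rewrite addn1 modn_small //; lia.
  by rewrite addn1 prednK ?prime_gt0 // modnn.
rewrite e1 e2 e3; move: (\prod_(_ < _) _)%N => w; move: (k %% p)%N kp => c cp.
case: (eqVneq c d) => cd; case: (eqVneq c 0%N) => c0; case: (eqVneq c h) => ch;
  case: (leqP 1 c) => h1; case: (leqP c h) => h2; case: (leqP c.+1 h) => h3 //=; lia.
Qed.

Local Notation half := (2%:R^-1 : Zp).

Let unit2 : (2%:R : Zp) \is a GRing.unit.
Proof. by apply: padic_unit_nat; rewrite gtnNdvd. Qed.

Let half2 : 2%:R * half = 1. Proof. exact: divrr. Qed.

Definition gamma_pair x : Zp := Gam x * Gam (x + half).
Local Notation A := gamma_pair.

Definition dup_factor x : Zp := if padic_res x 1 == 0%N then 1 else 2%:R.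

Lemma res1_unit x y : (x \is a GRing.unit) = (y \is a GRing.unit) ->
  (padic_res x 1 == 0%N) = (padic_res y 1 == 0%N).
Proof. by rewrite !padic_unitE => /negb_inj. Qed.

Lemma unit_part2 x : unit_part (2%:R * x) = dup_factor x * unit_part x.
Proof.
rewrite /unit_part /dup_factor (@res1_unit (2%:R * x) x) ?unitrM ?unit2 //.
by case: ifP; rewrite ?mulr1.
Qed.

(** A half step keeps one factor of the pair and moves the other by 1, while the argument 2x also
    moves by 1; by [gammaS] both changes agree up to a possible factor 2. *)
Lemma gamma_pair_step x :
  A (x + half) * Gam (2%:R * x) * dup_factor x = A x * Gam (2%:R * x + 1).
Proof.
rewrite gammaS // unit_part2 /A -addrA.
have -> : half + half = 1 by rewrite -[half]mul1r -mulrDl; exact: half2.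
rewrite gammaS //; ring.
Qed.

Lemma gamma_pair_steps x k :
  A (x + k%:R * half) * Gam (2%:R * x) * \prod_(i < k) dup_factor (x + i%:R * half) =
  A x * Gam (2%:R * x + k%:R).
Proof.
elim: k => [|k IH]; first by rewrite big_ord0 mulr1 mul0r !addr0.
rewrite big_ord_recr /=; set P := \prod_(_ < _) _ in IH *.
have s := gamma_pair_step (x + k%:R * half).
have e1 : 2%:R * (x + k%:R * half) = 2%:R * x + k%:R by rewrite mulrDr mulrCA half2 mulr1.
have e2 : x + k%:R * half + half = x + k.+1%:R * half by rewrite -natr1; ring.
rewrite e1 e2 -addrA natr1 in s.
apply: (@gamma_mulI (2%:R * x + k%:R)).
transitivity (A (x + k.+1%:R * half) * Gam (2%:R * x + k%:R) * dup_factor (x + k%:R * half)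
   * (Gam (2%:R * x) * P)); first ring.
by rewrite s [RHS]mulrAC -IH; ring.
Qed.

Let unit_quarter : (4%:R : Zp) \is a GRing.unit.
Proof. by rewrite (natrM _ 2 2) unitrM unit2. Qed.

Local Notation quarter := (4%:R^-1 : Zp).

Let quarter2 : 2%:R * quarter = half.
Proof.
apply: (mulrI unit2); rewrite mulrA -natrM divrr // ?half2 //.
Qed.

(** Compare k half steps upwards from 0 with k' half steps ending at 1/4. The relation between k and
    k' is the one for which [pow2_count] makes both powers of 2 equal, so that they cancel. *)
Lemma gamma_duplication k k' : (k' + (0 < k %% p <= h) = k)%N ->
  A (k%:R * half) * A (quarter - k'%:R * half) =
  A quarter * (Gam k%:R * Gam (half - k'%:R)).
Proof.
move=> kk'.
have s1 := gamma_pair_steps 0 k; rewrite mulr0 !add0r gamma0 // mulr1 in s1.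
have s2 := gamma_pair_steps (quarter - k'%:R * half) k'.
have e1 : 2%:R * (quarter - k'%:R * half) = half - k'%:R.
  by rewrite mulrBr quarter2 mulrCA half2 mulr1.
rewrite e1 !subrK in s2.
have p1 : \prod_(i < k) dup_factor (0 + i%:R * half) =
    (\prod_(i < k) (if (p %| i)%N then 1 else 2))%N%:R.
  rewrite natr_prod; apply: eq_bigr => i _.
  rewrite add0r /dup_factor (@res1_unit _ (i%:R)) ?unitrM ?unitrV ?unit2 ?andbT //.
  by rewrite padic_res_nat expn1 -/(dvdn p i); case: ifP.
have p2 : \prod_(i < k') dup_factor (quarter - k'%:R * half + i%:R * half) =
    (\prod_(i < k') (if (p %| i.*2.+1)%N then 1 else 2))%N%:R.
  (* Read backwards, the arguments are the -(2i + 1) / 4. *)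
  rewrite natr_prod (reindex_inj rev_ord_inj); apply: eq_bigr => i _ /=.
  rewrite /dup_factor (@res1_unit _ (i.*2.+1%:R)).
    by rewrite padic_res_nat expn1 -/(dvdn p _); case: ifP.
  have -> : quarter - k'%:R * half + (k' - i.+1)%:R * half = - (i.*2.+1%:R * quarter).
    rewrite natrB // -quarter2 -(natr1 i) -(natr1 i.*2) -addnn natrD.
    have -> : (2%:R : Zp) = 1 + 1 by []. ring.
  by rewrite unitrN unitrM unitrV unit_quarter andbT.
have wE : (\prod_(i < k') (if (p %| i.*2.+1)%N then 1 else 2) =
           \prod_(i < k) (if (p %| i)%N then 1 else 2))%N.
  have := pow2_count k; move: kk' {s1 p1}; case: ifP => hk /= kE; subst k; last by rewrite addn0 muln1.
  rewrite addn1 in hk *; rewrite big_ord_recr [in LHS]/=; case: ifP => [|_].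
    move=> pk; exfalso; have := pk.
    have -> : (k'.*2.+1 = (k'.+1 %/ p).*2 * p + ((k'.+1 %% p).*2 - 1))%N.
      have := divn_eq k'.+1 p; move: (k'.+1 %/ p)%N (k'.+1 %% p)%N hk => q c /andP[c0 _].
      by rewrite -!muln2 (mulnAC q 2 p); lia.
    rewrite dvdn_addr ?dvdn_mull // gtnNdvd //; first by move: hk; rewrite -muln2; lia.
    by move: hk; rewrite -muln2; lia.
  by move/eqP; rewrite eqn_pmul2r // => /eqP.
rewrite p1 in s1; rewrite p2 wE in s2; move: s1 s2; move: ((\prod_(i < k) (if (p %| i)%N then 1 else 2))%N%:R : Zp) => P s1 s2.
have A0 : A 0 = Gam half by rewrite /A add0r gamma0 // mul1r.
apply: (@gamma_mulI half).
transitivity (A (k%:R * half) * (A (quarter - k'%:R * half) * Gam half)); first ring.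
rewrite -s2 -A0; transitivity ((A (k%:R * half) * P) * (A quarter * Gam (half - k'%:R))).
  ring.
rewrite s1; ring.
Qed.

Lemma gamma_pair_cont f : padic_cont f -> padic_cont (fun x : Zp => A (f x)).
Proof.
move=> hf; apply: (@contM p pp (fun x => Gam (f x)) (fun x => Gam (f x + half))).
  by apply: cont_comp hf; exact: cont_gamma.
apply: (@cont_comp p pp Gam (fun x => f x + half)); first exact: cont_gamma.
by apply: contD => //; exact: cont_const.
Qed.

Lemma gamma_duplication_padic x : let e := (0 < padic_res x 1 <= h)%N : nat in
  A (x * half) * A (quarter - (x - e%:R) * half) =
  A quarter * (Gam x * Gam (half - (x - e%:R))).
Proof.
move=> e; have ch : padic_cont (fun x : Zp => x - e%:R).
  by apply: contD; [exact: cont_id | exact: cont_const].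
have chh : padic_cont (fun x : Zp => quarter - (x - e%:R) * half).
  apply: (@contD p pp (fun=> quarter) (fun x => - ((x - e%:R) * half))); first exact: cont_const.
  by apply: contN; apply: (@contM p pp (fun x => x - e%:R)) => //; exact: cont_const.
have chg : padic_cont (fun x : Zp => half - (x - e%:R)).
  by apply: contD; [exact: cont_const | exact: contN].
apply: (@cont_eq p pp (fun x => A (x * half) * A (quarter - (x - e%:R) * half))
  (fun x => A quarter * (Gam x * Gam (half - (x - e%:R))))).
- apply: (contM (f := fun x => A (x * half))); last exact: gamma_pair_cont.
  by apply: gamma_pair_cont; apply: contM; [exact: cont_id | exact: cont_const].
- apply: (@contM p pp (fun=> A quarter)); first exact: cont_const.
  apply: (@contM p pp Gam); first exact: cont_gamma.
  by apply: (@cont_comp p pp Gam) chg; exact: cont_gamma.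
move=> k k0 kx.
have ek : (e <= k)%N by rewrite /e; case: (0 < _ <= _)%N.
rewrite -natrB //; apply: gamma_duplication; rewrite kx -/e subnK //.
Qed.

End Duplication.

(** * Quadratic characters and Jacobi sums *)

Section QuadChar.
Context (p : nat) (pp : prime p) (p_odd : odd p).
Local Notation d := p.-1.
Local Notation h := p.-1./2.
Local Notation Fp := 'F_p.
Local Notation phi := (@quad_char p).
Implicit Types (x y : Fp).

Let p_gt2 : (2 < p)%N. Proof. by case: (p) pp p_odd => [|[|[|]]]. Qed.
Let hE : (h + h = d)%N.
Proof. by rewrite addnn halfK -subn1 oddB ?prime_gt0 // p_odd subn0. Qed.
Let h_gt0 : (0 < h)%N. Proof. by move: hE p_gt2; lia. Qed.

Lemma Fp_expd x : x != 0 -> x ^+ d = 1.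
Proof.
move=> x0; have := expf_card x; rewrite card_Fp // => xp.
by apply: (mulfI x0); rewrite -exprS prednK ?prime_gt0 // xp mulr1.
Qed.

Lemma Fp_primitive : exists z : Fp, d.-primitive_root z.
Proof.
have d0 : (0 < d)%N by lia.
suff /hasP[z _ hz] : has d.-primitive_root (enum [pred x : Fp | x != 0]) by exists z.
apply: has_prim_root => //.
- by apply/allP => x; rewrite mem_enum /= unity_rootE => x0; rewrite Fp_expd.
- exact: enum_uniq.
by rewrite -cardE (cardC1 (0 : Fp)) card_Fp.
Qed.

Lemma Fp_neq1N : (-1 : Fp) != 1.
Proof.
rewrite eq_sym -subr_eq0 opprK -[1 + 1]/(2%:R).
by rewrite -(dvdn_pcharf (pchar_Fp pp)) gtnNdvd.
Qed.

Lemma prim_half (z : Fp) : d.-primitive_root z -> z ^+ h = -1.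
Proof.
move=> hz; have : (z ^+ h) ^+ 2 == 1 by rewrite -exprM muln2 -addnn hE prim_expr_order.
rewrite sqrf_eq1 => /orP[|/eqP //]; rewrite -(prim_order_dvd hz) gtnNdvd //; lia.
Qed.

Lemma phi0 : phi 0 = 0. Proof. by rewrite /quad_char eqxx. Qed.

Lemma phi_sq x : x != 0 -> phi (x ^+ 2) = 1.
Proof.
move=> x0; rewrite /quad_char sqrf_eq0 (negPf x0) ifT //.
by apply/existsP; exists x.
Qed.

Lemma phi_range x : x != 0 -> phi x = 1 \/ phi x = -1.
Proof. by move=> x0; rewrite /quad_char (negPf x0); case: ifP; [left|right]. Qed.

Lemma phi_euler x : (phi x)%:~R = x ^+ h.
Proof.
have [->|x0] := eqVneq x 0; first by rewrite phi0 expr0n gtn_eqF.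
have [z hz] := Fp_primitive.
have [[i id] /= xE] := prim_rootP hz (Fp_expd x0).
rewrite /quad_char (negPf x0); case: ifP => [/existsP[y /eqP yx]|/negbT].
  have y0 : y != 0 by apply: contraNneq x0 => y0; rewrite -yx y0 expr0n.
  by rewrite -yx -exprM mulnC muln2 -addnn hE Fp_expd.
rewrite negb_exists => /forallP ns; rewrite xE -exprM mulnC exprM prim_half //.
rewrite -signr_odd; case: (boolP (odd i)) => // io.
have := ns (z ^+ i./2); rewrite -exprM muln2 even_halfK ?io // -xE eqxx //.
Qed.

(** 0, 1 and -1 stay distinct in F_p because p is odd, so identities between values of phi can be
    checked there through Euler's criterion. *)
Let int3_inj (a b : int) : a \in [:: 0; 1; -1] -> b \in [:: 0; 1; -1] ->
  a%:~R = b%:~R :> Fp -> a = b.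
Proof.
have n1 : (1 : Fp) != 0 := oner_neq0 _.
have n2 := Fp_neq1N; have n3 : (-1 : Fp) != 0 by rewrite oppr_eq0.
by rewrite !inE => /or3P[]/eqP-> /or3P[]/eqP-> //= /eqP;
  rewrite ?rmorph0 ?rmorphN ?rmorph1 1?eq_sym ?(negPf n1) ?(negPf n2) ?(negPf n3) // eq_sym
    ?(negPf n1) ?(negPf n2) ?(negPf n3).
Qed.

Let phi_in x : phi x \in [:: 0; 1; -1].
Proof. by rewrite /quad_char !inE; case: ifP => //; case: ifP. Qed.

Lemma phiM x y : phi (x * y) = phi x * phi y.
Proof.
apply: int3_inj; first exact: phi_in.
  by move: (phi_in x) (phi_in y); rewrite !inE => /or3P[]/eqP-> /or3P[]/eqP->.
by rewrite rmorphM /= !phi_euler exprMn.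
Qed.

Lemma phi1 : phi 1 = 1. Proof. by rewrite -(expr1n _ 2) phi_sq ?oner_neq0. Qed.

Lemma phi_sqr x : x != 0 -> phi x * phi x = 1.
Proof. by move=> x0; rewrite -phiM -expr2 phi_sq. Qed.

Lemma phiV x : phi x^-1 = phi x.
Proof.
have [->|x0] := eqVneq x 0; first by rewrite invr0.
rewrite -[LHS]mulr1 -(phi_sqr x0) mulrA -phiM mulVf // phi1 mul1r //.
Qed.

Lemma phiN1 : phi (-1) = (-1) ^+ h.
Proof.
apply: int3_inj; first exact: phi_in.
  by rewrite -signr_odd; case: (odd h).
by rewrite phi_euler rmorphXn rmorphN rmorph1.
Qed.

Lemma phi_nonresidue : exists2 g : Fp, g != 0 & phi g = -1.
Proof.
have [z hz] := Fp_primitive; have z0 : z != 0.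
  apply/eqP => z0; have := prim_expr_order hz; rewrite z0 expr0n gtn_eqF //; last by lia.
exists z => //; have := phi_euler z; rewrite (prim_half hz) => e.
by have [h1|//] := phi_range z0; move: e Fp_neq1N; rewrite h1 => <-; rewrite eqxx.
Qed.

Lemma sum_phi : \sum_x phi x = 0.
Proof.
have [g g0 hg] := phi_nonresidue.
have : \sum_x phi x = - \sum_x phi x.
  rewrite {1}(reindex_inj (mulfI g0)) -sumrN; apply: eq_bigr => x _.
  by rewrite phiM hg mulN1r.
by move: (\sum_x _) => s; lia.
Qed.

(* The sum over the pairs [(x, y)] with [(x y) ^ 2 = 1]. *)
Lemma sum_phi_pairs :
  \sum_(x | x != 0) (phi (1 + x) * phi (1 + x^-1) + phi (1 + x) * phi (1 - x^-1)) =
  - phi (-1) + \sum_x phi (x ^+ 3 - x).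
Proof.
rewrite big_split /=; congr (_ + _).
  have -> : \sum_(x | x != 0) phi (1 + x) * phi (1 + x^-1) =
      \sum_(x | (x != 0) && (x != -1)) phi x.
    rewrite (bigD1 (-1)) ?oppr_eq0 ?oner_eq0 //= subrr phi0 mul0r add0r.
    apply: eq_bigr => x /andP[x0 x1].
    have -> : 1 + x^-1 = (1 + x) * x^-1 by rewrite mulrDl mul1r divff // addrC.
    have x1' : 1 + x != 0 by rewrite addrC addr_eq0.
    by rewrite phiM mulrA phi_sqr // mul1r phiV.
  have := sum_phi; rewrite (bigD1 0) //= phi0 add0r (bigD1 (-1)) /=; last first.
    by rewrite oppr_eq0 oner_eq0.
  by move/eqP; rewrite addrC addr_eq0 => /eqP.
rewrite [RHS](bigD1 0) //= expr0n subr0 phi0 add0r; apply: eq_bigr => x x0.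
(* (1 + x)(1 - 1/x) x^2 = x^3 - x. *)
rewrite -phiM -[LHS]mulr1 -(phi_sq x0) -phiM; congr phi.
by field.
Qed.

End QuadChar.

(** * Jacobi sums and orthogonality *)

Section JacobiSums.
Context (p : nat) (pp : prime p) (p_odd : odd p).
Local Notation Zp := (padic_int pp).
Local Notation K := 'Q_[pp].
Local Notation d := p.-1.
Local Notation h := p.-1./2.
Local Notation Fp := 'F_p.
Local Notation phi := (@quad_char p).
Local Notation tch := (@teichmuller p pp).
Local Notation small := (@padic_small p pp).
Implicit Types (x y : Fp).

Let p_gt2 : (2 < p)%N. Proof. by case: (p) pp p_odd => [|[|[|]]]. Qed.
Let hE : (h + h = d)%N.
Proof. by rewrite addnn halfK -subn1 oddB ?prime_gt0 // p_odd subn0. Qed.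
Let h_gt0 : (0 < h)%N. Proof. by move: hE p_gt2; lia. Qed.

Definition padic_red (z : Zp) : Fp := (padic_res z 1)%:R.

Lemma natr_modp n : (n %% p)%:R = n%:R :> Fp.
Proof. by rewrite Fp_nat_mod. Qed.

Lemma padic_redD (z w : Zp) : padic_red (z + w) = padic_red z + padic_red w.
Proof. by rewrite /padic_red padic_resD expn1 natr_modp natrD. Qed.

Lemma padic_redM (z w : Zp) : padic_red (z * w) = padic_red z * padic_red w.
Proof. by rewrite /padic_red padic_resM expn1 natr_modp natrM. Qed.

Lemma padic_red_nat n : padic_red n%:R = n%:R.
Proof. by rewrite /padic_red padic_res_nat expn1 natr_modp. Qed.

Lemma padic_redX (z : Zp) n : padic_red (z ^+ n) = padic_red z ^+ n.
Proof. by elim: n => [|n IH]; [exact: (padic_red_nat 1) | rewrite !exprS padic_redM IH]. Qed.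

Lemma padic_red_inj0 (z : Zp) : padic_red z = 0 -> padic_res z 1 = 0%N.
Proof.
move=> /(congr1 (@nat_of_ord _)); rewrite /padic_red val_Fp_nat //= modn_small //.
by have := padic_res_lt z 1; rewrite expn1.
Qed.

Lemma padic_redN (z : Zp) : padic_red (- z) = - padic_red z.
Proof.
by apply/eqP; rewrite -addr_eq0 -padic_redD addNr (padic_red_nat 0).
Qed.

Lemma tch0 : tch 0 = 0. Proof. by rewrite /teichmuller eqxx. Qed.

Lemma tch_red x : padic_red (tch x) = x.
Proof.
have [->|x0] := eqVneq x 0; first by rewrite tch0 (padic_red_nat 0).
by have [_ e] := teichmullerP pp x0; rewrite /padic_red e natr_Zp.
Qed.

Lemma tch_expd x : x != 0 -> tch x ^+ d = 1.
Proof. by move=> x0; have [e _] := teichmullerP pp x0. Qed.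

Lemma tch_expp x : tch x ^+ p = tch x.
Proof.
have [->|x0] := eqVneq x 0; first by rewrite tch0 expr0n gtn_eqF ?prime_gt0.
transitivity (tch x ^+ d.+1); last by rewrite exprS tch_expd // mulr1.
by congr (_ ^+ _); rewrite prednK ?prime_gt0.
Qed.

Lemma tch_uniq x (z : Zp) : z ^+ d = 1 -> padic_red z = x -> tch x = z.
Proof.
move=> zd zx; have x0 : x != 0.
  apply/eqP => x0; have := padic_redX z d; rewrite zd zx x0 (padic_red_nat 1) expr0n gtn_eqF.
    by move/eqP; rewrite oner_eq0.
  by move: p_gt2; lia.
apply: (teichmuller_uniq (teichmullerP pp x0)); split=> //.
rewrite -zx /padic_red val_Fp_nat //= modn_small //.
by have := padic_res_lt z 1; rewrite expn1.
Qed.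

Lemma tchM x y : tch (x * y) = tch x * tch y.
Proof.
have [->|x0] := eqVneq x 0; first by rewrite mul0r tch0 mul0r.
have [->|y0] := eqVneq y 0; first by rewrite mulr0 tch0 mulr0.
apply: tch_uniq; first by rewrite exprMn !tch_expd // mulr1.
by rewrite padic_redM !tch_red.
Qed.

Lemma tch1 : tch 1 = 1.
Proof. by apply: tch_uniq; [rewrite expr1n | exact: (padic_red_nat 1)]. Qed.

Lemma tchN x : tch (- x) = - tch x.
Proof.
have [->|x0] := eqVneq x 0; first by rewrite oppr0 tch0 oppr0.
apply: tch_uniq; last by rewrite padic_redN tch_red.
by rewrite exprNn -signr_odd -hE oddD addbb expr0 mul1r hE tch_expd.
Qed.

Lemma tch_exph x : tch x ^+ h = (phi x)%:~R.
Proof.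
have [->|x0] := eqVneq x 0; first by rewrite tch0 phi0 expr0n gtn_eqF.
have e : (tch x ^+ h) ^+ 2 == 1 by rewrite -exprM muln2 -addnn hE tch_expd.
have r : padic_red (tch x ^+ h) = (phi x)%:~R.
  by rewrite padic_redX tch_red phi_euler.
have [e1|e1] := phi_range x0; rewrite e1 in r *;
  move: e r; rewrite sqrf_eq1 => /orP[]/eqP -> //; rewrite ?padic_redN (padic_red_nat 1) => /eqP.
  by rewrite (negPf (Fp_neq1N pp p_odd)).
by rewrite eq_sym (negPf (Fp_neq1N pp p_odd)).
Qed.

Local Notation gam i := (tofrac (gauss_gamma pp i) : K).

(** Coefficient of X^h in a product of two additive characters; for i > h it arises from degree h +
    d through X^d = - p. Up to normalisation it is a Jacobi sum of the quadratic character and a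
    power of the Teichmuller character. *)
Definition jacobi_coef i : K :=
  if (i <= h)%N then gam (h - i)%N * gam i else - p%:R * gam (h + d - i)%N * gam i.

(** Additivity with s = [tch x] and u = [tch (1 + x)], for which 1 + s and u agree mod p. In degree
    h = (p - 1) / 2 the power [u ^+ h] is phi(1 + x). *)
Lemma jacobi_expansion x : x != 0 ->
  \sum_(i < d) jacobi_coef i * tofrac (tch x) ^+ i = gam h * (phi (1 + x))%:~R.
Proof.
move=> x0.
have : padic_small 1 (tofrac (1 + tch x - tch (1 + x)) : K).
  apply/small_padic_res/padic_red_inj0.
  by rewrite !padic_redD padic_redN !tch_red (padic_red_nat 1) subrr.
move=> [v]; rewrite expr1 => hv.
have -> : ((phi (1 + x))%:~R : K) = tofrac (tch (1 + x)) ^+ h.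
  by rewrite -rmorphXn tch_exph rmorph_int.
apply: (@gam_additive p pp p_odd (fun i => gam i) _ _ _ _ (tofrac v)).
- by move=> r _; exact: small_tofrac.
- by move=> r N rd; exact: gauss_gamma_lim.
- exact: small_tofrac.
- exact: small_tofrac.
- exact: small_tofrac.
- by rewrite -rmorphXn tch_expd // rmorph1.
- by rewrite -rmorphXn tch_expp.
- by rewrite -hv rmorphB rmorphD rmorph1 [RHS]addrC subrK.
- by move: hE h_gt0; lia.
Qed.

Lemma sum_tch i j : (i < d)%N -> (j < d)%N ->
  \sum_(x | x != 0) tofrac (tch x) ^+ i * tofrac (tch x^-1) ^+ j =
  (if i == j then d%:R else 0 : K).
Proof.
move=> id jd; have tV x : x != 0 -> tofrac (tch x) * tofrac (tch x^-1) = 1 :> K.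
  by move=> x0; rewrite -rmorphM -tchM divff // tch1 rmorph1.
case: eqVneq => [<-|ij].
  under eq_bigr => x x0 do rewrite -exprMn tV // expr1n.
  rewrite sumr_const; congr (_ *+ _).
  by rewrite (eq_card (B := predC1 (0 : Fp))) // cardC1 card_Fp.
have [z hz] := Fp_primitive pp p_odd.
have z0 : z != 0.
  apply/eqP => z0; have := prim_expr_order hz; rewrite z0 expr0n gtn_eqF //.
  by move: p_gt2; lia.
set S := \sum_(_ | _) _.
have e : S = (tofrac (tch z) ^+ i * tofrac (tch z^-1) ^+ j) * S.
  rewrite {1}/S (reindex_inj (mulfI z0)) /= mulr_sumr; apply: eq_big => [x|x x0].
    by rewrite mulf_eq0 (negPf z0).
  by rewrite invfM !tchM !rmorphM !exprMn; ring.
have : (1 - tofrac (tch z) ^+ i * tofrac (tch z^-1) ^+ j) * S == 0.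
  by rewrite mulrBl mul1r -e subrr.
rewrite mulf_eq0 => /orP[|/eqP //]; rewrite subr_eq0 => /eqP e1.
have : tofrac (tch z) ^+ i = tofrac (tch z) ^+ j :> K.
  have -> : (tofrac (tch z) ^+ j : K) = tofrac (tch z) ^+ j * 1 by rewrite mulr1.
  rewrite e1 mulrCA -exprMn tV // expr1n mulr1 //.
rewrite -!rmorphXn => /eqP; rewrite tofrac_eq => /eqP /(congr1 padic_red).
rewrite !padic_redX !tch_red => /eqP; rewrite (eq_prim_root_expr hz) /eqn.
by rewrite !modn_small // (negPf ij).
Qed.

(** Multiply the expansion at x by those at 1/x and -1/x: summation over x leaves i = j, and the
    factor [1 + (-1) ^+ j] leaves the even indices. *)
Lemma jacobi_parseval :
  gam h ^+ 2 * (\sum_(x | x != 0)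
     (phi (1 + x) * phi (1 + x^-1) + phi (1 + x) * phi (1 - x^-1)))%:~R =
  2%:R * d%:R * \sum_(j < h) jacobi_coef j.*2 ^+ 2.
Proof.
rewrite rmorph_sum mulr_sumr /=.
have E x : x != 0 -> gam h ^+ 2 * (phi (1 + x) * phi (1 + x^-1) + phi (1 + x) * phi (1 - x^-1))%:~R
  = \sum_(i < d) \sum_(j < d) jacobi_coef i * jacobi_coef j * (1 + (-1) ^+ j) *
      (tofrac (tch x) ^+ i * tofrac (tch x^-1) ^+ j).
  move=> x0; rewrite intrD !intrM.
  have V0 : x^-1 != 0 by rewrite invr_eq0.
  have V1 : - x^-1 != 0 by rewrite oppr_eq0.
  transitivity ((gam h * (phi (1 + x))%:~R) * (gam h * (phi (1 + x^-1))%:~R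
     + gam h * (phi (1 - x^-1))%:~R) : K); first by ring.
  rewrite -!jacobi_expansion // -big_split /= mulr_suml; apply: eq_bigr => i _.
  rewrite mulr_sumr; apply: eq_bigr => j _.
  by rewrite tchN rmorphN [in X in _ * (_ + X)]exprNn; ring.
rewrite (eq_bigr _ E) exchange_big /=.
have -> : \sum_(i < d) \sum_(x | x != 0) \sum_(j < d) jacobi_coef i * jacobi_coef j * (1 + (-1) ^+ j) *
      (tofrac (tch x) ^+ i * tofrac (tch x^-1) ^+ j) =
   \sum_(i < d) d%:R * (jacobi_coef i ^+ 2 * (1 + (-1) ^+ i)).
  apply: eq_bigr => i _; rewrite exchange_big /=.
  under eq_bigr => j _ do rewrite -mulr_sumr sum_tch // (inj_eq val_inj).
  rewrite (bigD1 i) //= eqxx big1 ?addr0; first ring.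
  by move=> j /negPf ji; rewrite eq_sym ji mulr0.
rewrite -mulr_sumr -mulrA mulrCA; congr (_ * _).
rewrite -(big_mkord xpredT (fun i => jacobi_coef i ^+ 2 * (1 + (-1) ^+ i))).
have dE : d = h.*2 by rewrite -addnn hE.
rewrite [in LHS]dE; elim: (h) => [|k IH]; first by rewrite big_nil big_ord0 mulr0.
have e : (-1) ^+ k.*2 = 1 :> K by rewrite -signr_odd odd_double.
have e' : (-1) ^+ k.*2.+1 = -1 :> K by rewrite exprS e mulr1.
rewrite doubleS !big_nat_recr //= IH big_ord_recr /= e e'; ring.
Qed.

End JacobiSums.

(** * The hypergeometric function *)

Section Hypergeometric.
Context (p : nat) (pp : prime p) (p_odd : odd p).
Local Notation Zp := (padic_int pp).
Local Notation K := 'Q_[pp].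
Local Notation d := p.-1.
Local Notation h := p.-1./2.
Local Notation phi := (@quad_char p).
Local Notation Gam := (@morita_gamma p pp).
Local Notation jc := (jacobi_coef pp).
Implicit Types (n f : int).

Let p_gt2 : (2 < p)%N. Proof. by case: (p) pp p_odd => [|[|[|]]]. Qed.
Let hE : (h + h = d)%N.
Proof. by rewrite addnn halfK -subn1 oddB ?prime_gt0 // p_odd subn0. Qed.
Let h_gt0 : (0 < h)%N. Proof. by move: hE p_gt2; lia. Qed.

(** [ratr] divides by [denq x], which divides m and is therefore a unit of Z_p. *)
Lemma ratr_frac (x : rat) n (m : nat) : ~~ (p %| m)%N -> x * m%:R = n%:~R ->
  ratr x = n%:~R / m%:R :> Zp.
Proof.
move=> pm xm; have mu : (m%:R : Zp) \is a GRing.unit by exact: padic_unit_nat.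
have e : numq x * m%:Z = n * denq x.
  apply: (@intr_inj rat); rewrite !intrM -xm numqE -pmulrn; exact: mulrAC.
have dm : (denq x %| m%:Z)%Z.
  have : (denq x %| numq x * m%:Z)%Z by rewrite e dvdz_mull.
  by rewrite Gauss_dvdzr // coprimezE coprime_sym coprime_num_den.
have du : ((denq x)%:~R : Zp) \is a GRing.unit.
  have [k kE] := dvdzP dm.
  have : (k%:~R * (denq x)%:~R : Zp) \is a GRing.unit by rewrite -rmorphM -kE.
  by rewrite unitrM => /andP[].
rewrite /ratr; apply: (mulIr mu); rewrite divrK // mulrAC.
apply: (mulIr du); rewrite divrK //.
by have := congr1 (intr : int -> Zp) e; rewrite !rmorphM.
Qed.

(** Every rational argument below has denominator dividing 4 (p - 1). Over this common denominator
    floors become integer inequalities and gamma arguments become linear forms. *)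
Definition rq n : rat := n%:~R / (4 * d)%:R.
Definition zq n : Zp := n%:~R / (4 * d)%:R.

Let d4 : ~~ (p %| 4 * d)%N.
Proof.
have p4 : ~~ (p %| 2 * 2)%N by rewrite Euclid_dvdM // orbb gtnNdvd.
rewrite Euclid_dvdM // negb_or p4 gtnNdvd //; by move: p_gt2; lia.
Qed.
Let d4_gt0 : (0 < (4 * d)%:R :> rat). Proof. by rewrite ltr0n; move: p_gt2; lia. Qed.
Let d4_unit : ((4 * d)%:R : Zp) \is a GRing.unit. Proof. exact: padic_unit_nat. Qed.

Lemma gammaQ_rq n : gammaQ pp (rq n) = tofrac (Gam (zq n)).
Proof.
rewrite /gammaQ (@ratr_frac _ n (4 * d)) // /rq divfK //.
by rewrite gt_eqF.
Qed.

Lemma floor_rq n f : (4 * d)%:Z * f <= n < (4 * d)%:Z * (f + 1) -> Num.floor (rq n) = f.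
Proof.
move=> /andP[h1 h2]; apply: floor_def.
rewrite /rq ler_pdivlMr // ltr_pdivrMr // -[(4 * d)%:R]/((4 * d)%:Z%:~R).
by rewrite -!intrM ler_int ltr_int ![_ * (4 * d)%:Z]mulrC h1 h2.
Qed.

Lemma rqB m n : rq m - rq n = rq (m - n).
Proof. by rewrite /rq intrB mulrBl. Qed.

Lemma rqD m n : rq m + rq n = rq (m + n).
Proof. by rewrite /rq intrD mulrDl. Qed.

Lemma rqN n : - rq n = rq (- n).
Proof. by rewrite /rq intrN mulNr. Qed.

Lemma rq_int f : f%:~R = rq ((4 * d)%:Z * f).
Proof. by rewrite /rq intrM mulrAC divff ?mul1r // gt_eqF. Qed.

Lemma fracpart_rq n f : (4 * d)%:Z * f <= n < (4 * d)%:Z * (f + 1) ->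
  fracpart (rq n) = rq (n - (4 * d)%:Z * f).
Proof. by move=> hf; rewrite /fracpart (floor_rq hf) rq_int rqB. Qed.

Lemma zqD m n : zq (m + n) = zq m + zq n.
Proof. by rewrite /zq intrD mulrDl. Qed.

Lemma zqN n : zq (- n) = - zq n.
Proof. by rewrite /zq intrN mulNr. Qed.

Let unit2 : (2%:R : Zp) \is a GRing.unit.
Proof. by apply: padic_unit_nat; rewrite gtnNdvd. Qed.

Lemma zq_half : 2%:R^-1 = zq (2 * d%:Z).
Proof.
apply: (mulIr d4_unit); rewrite /zq divrK //; apply: (mulrI unit2).
rewrite mulrA divrr // mul1r -[RHS](rmorphM (intr : int -> Zp) 2 (2 * d%:Z)).
by rewrite mulrA -PoszM.
Qed.

Lemma zq_quarter : 4%:R^-1 = zq d%:Z.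
Proof.
have u4 : (4%:R : Zp) \is a GRing.unit by rewrite (natrM _ 2 2) unitrM unit2.
apply: (mulIr d4_unit); rewrite /zq divrK //; apply: (mulrI u4).
by rewrite mulrA divrr // mul1r -natrM.
Qed.

Lemma zq_ratio s : ratio_d pp s = zq (4 * s%:Z).
Proof.
apply: (mulIr d4_unit); rewrite /zq divrK // /ratio_d natrM mulrCA divrK ?d_unit //.
by rewrite intrM.
Qed.

Lemma zq_half_ratio s : ratio_d pp s * 2%:R^-1 = zq (2 * s%:Z).
Proof.
apply: (mulIr unit2); rewrite divrK // zq_ratio mulr_natr mulr2n -zqD; congr zq; lia.
Qed.

Lemma zq1 : 1 = zq (4 * d%:Z).
Proof. by rewrite /zq -PoszM divrr. Qed.

Definition hg_factor (a b t : rat) : K :=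
  gammaQ pp (fracpart (a - t)) / gammaQ pp (fracpart a) *
  (gammaQ pp (fracpart (- b + t)) / gammaQ pp (fracpart (- b))) *
  (- p%:R) ^ (- Num.floor (fracpart a - t) - Num.floor (fracpart (- b) + t)).

Let dZ_gt0 : (0 < d%:Z). Proof. by rewrite ltz_nat; move: p_gt2; lia. Qed.

Let d4E : (4 * d)%:Z = 4 * d%:Z. Proof. by rewrite PoszM. Qed.

Lemma hg_factor_quarter (j : nat) f : (j < d)%N ->
  4 * d%:Z * f <= d%:Z - 4 * j%:Z < 4 * d%:Z * (f + 1) ->
  hg_factor (rq d) (rq (4 * d%:Z)) (rq (4 * j%:Z)) =
  tofrac (Gam (zq (d%:Z - 4 * j%:Z - 4 * d%:Z * f))) / tofrac (Gam (zq d)) *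
  tofrac (Gam (zq (4 * j%:Z))) * (- p%:R) ^ (- f).
Proof.
move=> jd hf; have jdZ : 0 <= j%:Z < d%:Z by rewrite ltz_nat jd andbT.
have [dZ dE] := (dZ_gt0, d4E).
rewrite /hg_factor !(rqN, rqB, rqD).
have -> : fracpart (rq d%:Z) = rq d%:Z.
  by rewrite (@fracpart_rq _ 0); [congr rq|]; lia.
have -> : fracpart (rq (- (4 * d%:Z))) = rq 0.
  by rewrite (@fracpart_rq _ (-1)); [congr rq|]; lia.
rewrite (@fracpart_rq (d%:Z - 4 * j%:Z) f) ?dE // !rqD (@floor_rq (d%:Z - 4 * j%:Z) f) ?dE //.
have -> : fracpart (rq (- (4 * d%:Z) + 4 * j%:Z)) = rq (4 * j%:Z).
  by rewrite (@fracpart_rq _ (-1)); [congr rq|]; lia.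
have -> : Num.floor (rq (0 + 4 * j%:Z)) = 0 by apply: floor_rq; lia.
rewrite !gammaQ_rq subr0.
have -> : zq 0 = 0 by rewrite /zq mul0r.
by rewrite gamma0 // rmorph1 divr1.
Qed.

Lemma hg_factor_3quarter (j : nat) f g : (j < d)%N ->
  4 * d%:Z * f <= 3 * d%:Z - 4 * j%:Z < 4 * d%:Z * (f + 1) ->
  4 * d%:Z * g <= 2 * d%:Z + 4 * j%:Z < 4 * d%:Z * (g + 1) ->
  hg_factor (rq (3 * d%:Z)) (rq (2 * d%:Z)) (rq (4 * j%:Z)) =
  tofrac (Gam (zq (3 * d%:Z - 4 * j%:Z - 4 * d%:Z * f))) / tofrac (Gam (zq (3 * d%:Z))) *
  (tofrac (Gam (zq (2 * d%:Z + 4 * j%:Z - 4 * d%:Z * g))) / tofrac (Gam (zq (2 * d%:Z)))) *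
  (- p%:R) ^ (- f - g).
Proof.
move=> jd hf hg; have jdZ : 0 <= j%:Z < d%:Z by rewrite ltz_nat jd andbT.
have [dZ dE] := (dZ_gt0, d4E).
rewrite /hg_factor !(rqN, rqB, rqD).
have -> : fracpart (rq (3 * d%:Z)) = rq (3 * d%:Z).
  by rewrite (@fracpart_rq _ 0); [congr rq|]; lia.
have -> : fracpart (rq (- (2 * d%:Z))) = rq (2 * d%:Z).
  by rewrite (@fracpart_rq _ (-1)); [congr rq|]; lia.
rewrite (@fracpart_rq (3 * d%:Z - 4 * j%:Z) f) ?dE //.
rewrite !rqD (@floor_rq (3 * d%:Z - 4 * j%:Z) f) ?dE // (@floor_rq (2 * d%:Z + 4 * j%:Z) g) ?dE //.
have -> : fracpart (rq (- (2 * d%:Z) + 4 * j%:Z)) = rq (2 * d%:Z + 4 * j%:Z - 4 * d%:Z * g).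
  rewrite (@fracpart_rq _ (g - 1)); first by congr rq; rewrite dE; ring.
  by rewrite dE; move: hg; rewrite mulrDr mulrBr; lia.
by rewrite !gammaQ_rq.
Qed.

(** s / (p - 1) is congruent to - s, so for s > 0 its residue is p - s. Thus the correction [e] of
    the duplication formula is 1 exactly when [jacobi_coef] wraps around. *)
Lemma res1_ratio (s : nat) : (s < d)%N ->
  (0 < padic_res (ratio_d pp s) 1 <= h)%N = (h < s)%N.
Proof.
move=> sd; have e : ratio_d pp s * d%:R = s%:R by rewrite divrK // d_unit.
have := congr1 (fun z => padic_res z 1) e; rewrite padic_resM !padic_res_nat expn1 modnMmr.
have := padic_res_lt (ratio_d pp s) 1; rewrite expn1.
move: (padic_res _ _) => c cp cs.
have : (p %| c + s)%N.
  by rewrite /dvdn -modnDmr -cs modnDmr -mulnS prednK ?prime_gt0 // modnMl.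
case/dvdnP => q qE; have q2 : (q < 2)%N.
  by rewrite -(ltn_pmul2r (prime_gt0 pp)) -qE; lia.
by case: q q2 qE => [|[|//]] _ qE; apply/idP/idP; move: hE h_gt0; lia.
Qed.

(** s is 2j reduced mod d, and f, g, k are the floors of 1/4 - j/d, 3/4 - j/d and 1/2 + j/d. The
    gamma values depending on j are, up to order, those of the duplication formula at s / d; the
    last hypothesis separates j < h from j >= h, where the order changes. *)
Lemma hg_term_zq (j s : nat) (e : bool) (f g k : int) : (j < d)%N -> (s < d)%N ->
  e = (h < s)%N ->
  4 * d%:Z * f <= d%:Z - 4 * j%:Z < 4 * d%:Z * (f + 1) ->
  4 * d%:Z * g <= 3 * d%:Z - 4 * j%:Z < 4 * d%:Z * (g + 1) ->
  4 * d%:Z * k <= 2 * d%:Z + 4 * j%:Z < 4 * d%:Z * (k + 1) ->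
  s%:Z = 2 * j%:Z - d%:Z * k -> e%:Z = - (f + g + k) ->
  (k = 0 /\ g = 0) \/ (k = 1 /\ f = -1) ->
  hg_factor (rq d) (rq (4 * d%:Z)) (rq (4 * j%:Z)) *
  hg_factor (rq (3 * d%:Z)) (rq (2 * d%:Z)) (rq (4 * j%:Z)) =
  tofrac (Gam (zq (4 * s%:Z))) * tofrac (Gam (zq (2 * d%:Z - 4 * s%:Z + 4 * d%:Z * e%:Z))) /
  tofrac (Gam (zq (2 * d%:Z))) * (- p%:R) ^+ e.
Proof.
move=> jd sd eE hf hg hk hs he hc.
rewrite (hg_factor_quarter jd hf) (hg_factor_3quarter jd hg hk).
have p0 : - p%:R != 0 :> K by rewrite oppr_eq0 pK_neq0.
have pe : (- p%:R : K) ^ (- f) * (- p%:R) ^ (- g - k) = (- p%:R) ^+ e.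
  rewrite -expfzDr // -[RHS]/((- p%:R) ^ (e%:Z)); congr (_ ^ _); rewrite he; ring.
have D : Gam (zq (2 * s%:Z)) * Gam (zq (2 * s%:Z + 2 * d%:Z)) *
    (Gam (zq (d%:Z - 2 * s%:Z + 2 * d%:Z * e%:Z)) * Gam (zq (3 * d%:Z - 2 * s%:Z + 2 * d%:Z * e%:Z))) =
    Gam (zq d) * Gam (zq (3 * d%:Z)) *
    (Gam (zq (4 * s%:Z)) * Gam (zq (2 * d%:Z - 4 * s%:Z + 4 * d%:Z * e%:Z))).
  have := gamma_duplication_padic p_odd (ratio_d pp s).
  rewrite (res1_ratio sd) -eE /gamma_pair /=.
  rewrite mulrBl zq_half_ratio zq_half zq_quarter zq_ratio.
  have -> : e%:R = zq (4 * d%:Z * e%:Z) by case: (e); rewrite ?mulr1 ?mulr0 -?zq1 // /zq mul0r.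
  have -> : zq (4 * d%:Z * e%:Z) * zq (2 * d%:Z) = zq (2 * d%:Z * e%:Z).
    by case: (e); rewrite ?mulr1 ?mulr0 -?zq1 ?mul1r // /zq mul0r mul0r.
  rewrite -!zqN -!zqD -!zqN -!zqD => D.
  have -> : 3 * d%:Z = d%:Z + 2 * d%:Z by ring.
  move: D; rewrite !opprB !addrA.
  have -> : d%:Z + 2 * d%:Z * e%:Z - 2 * s%:Z + 2 * d%:Z = d%:Z + 2 * d%:Z - 2 * s%:Z + 2 * d%:Z * e%:Z by ring.
  have -> : d%:Z + 2 * d%:Z * e%:Z - 2 * s%:Z = d%:Z - 2 * s%:Z + 2 * d%:Z * e%:Z by ring.
  by have -> : 2 * d%:Z + 4 * d%:Z * e%:Z - 4 * s%:Z = 2 * d%:Z - 4 * s%:Z + 4 * d%:Z * e%:Z by ring.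
have G : Gam (zq (d%:Z - 4 * j%:Z - 4 * d%:Z * f)) * Gam (zq (4 * j%:Z)) *
    (Gam (zq (3 * d%:Z - 4 * j%:Z - 4 * d%:Z * g)) * Gam (zq (2 * d%:Z + 4 * j%:Z - 4 * d%:Z * k))) =
    Gam (zq d) * Gam (zq (3 * d%:Z)) *
    (Gam (zq (4 * s%:Z)) * Gam (zq (2 * d%:Z - 4 * s%:Z + 4 * d%:Z * e%:Z))).
  rewrite -D; case: hc => [[k0 g0]|[k1 f1]].
    have fE : f = - e%:Z by lia.
    rewrite k0 mulr0 subr0 in hs *; rewrite hs g0 fE.
    have -> : 2 * (2 * j%:Z) = 4 * j%:Z by ring.
    have -> : 4 * j%:Z + 2 * d%:Z = 2 * d%:Z + 4 * j%:Z by ring.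
    case: (e) => /=; rewrite ?mulr0 ?oppr0 ?mulr0 ?subr0 ?addr0; last by ring.
    have -> : d%:Z - 4 * j%:Z - 4 * d%:Z * - 1%Z = 3 * d%:Z - 4 * j%:Z + 2 * d%:Z * 1%Z by ring.
    have -> : 3 * d%:Z - 4 * j%:Z = d%:Z - 4 * j%:Z + 2 * d%:Z * 1%Z by ring.
    ring.
  have gE : g = - e%:Z by lia.
  rewrite k1 !mulr1 in hs *; rewrite hs gE f1.
  have -> : 2 * (2 * j%:Z - d%:Z) + 2 * d%:Z = 4 * j%:Z by ring.
  have -> : 2 * (2 * j%:Z - d%:Z) = 2 * d%:Z + 4 * j%:Z - 4 * d%:Z by ring.
  case: (e) => /=; rewrite ?mulr0 ?oppr0 ?mulr0 ?subr0 ?addr0.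
    have -> : d%:Z - 4 * j%:Z - 4 * d%:Z * - 1 =
       d%:Z - (2 * d%:Z + 4 * j%:Z - 4 * d%:Z) + 2 * d%:Z * 1%Z by ring.
    have -> : 3 * d%:Z - 4 * j%:Z - 4 * d%:Z * - 1%Z =
       3 * d%:Z - (2 * d%:Z + 4 * j%:Z - 4 * d%:Z) + 2 * d%:Z * 1%Z by ring.
    ring.
  have -> : d%:Z - 4 * j%:Z - 4 * d%:Z * - 1 = 3 * d%:Z - (2 * d%:Z + 4 * j%:Z - 4 * d%:Z) by ring.
  have -> : 3 * d%:Z - 4 * j%:Z = d%:Z - (2 * d%:Z + 4 * j%:Z - 4 * d%:Z) by ring.
  ring.
have t0 n : tofrac (Gam (zq n)) != 0 :> K.
  by rewrite tofrac_eq0; apply: contraTneq (gamma_unit p_odd (zq n)) => ->; rewrite unitr0.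
have alg (F : fieldType) (g1 g2 g3 g4 a b c x y P1 P2 : F) : a != 0 -> b != 0 -> c != 0 ->
    g1 * g2 * (g3 * g4) = a * b * (x * y) ->
    g1 / a * g2 * P1 * (g3 / b * (g4 / c) * P2) = x * y / c * (P1 * P2).
  move=> a0 b0 c0 E.
  transitivity (g1 * g2 * (g3 * g4) / (a * b * c) * (P1 * P2)).
    by field; rewrite a0 b0 c0.
  by rewrite E; field; rewrite a0 b0 c0.
by rewrite -pe; apply: alg; [exact: t0 | exact: t0 | exact: t0 | rewrite -!rmorphM G].
Qed.

Lemma gam_frac_sq r : (tofrac (gauss_gamma pp r) * d%:R) ^+ 2 = tofrac (Gam (ratio_d pp r)) ^+ 2 :> K.
Proof. by rewrite -(rmorph_nat (@tofrac Zp)) -rmorphM -!rmorphXn gauss_gamma_sq. Qed.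

Lemma hg_term (j s : nat) : (j < d)%N -> (s < d)%N -> (s = j.*2 \/ s + d = j.*2)%N ->
  (hg_factor (rq d) (rq (4 * d%:Z)) (rq (4 * j%:Z)) *
   hg_factor (rq (3 * d%:Z)) (rq (2 * d%:Z)) (rq (4 * j%:Z))) ^+ 2 =
  (d%:R * jc s / tofrac (gauss_gamma pp h)) ^+ 2.
Proof.
move=> jd sd hs; have p0 : (p%:R : K) != 0 := pK_neq0 pp.
have -> : hg_factor (rq d) (rq (4 * d%:Z)) (rq (4 * j%:Z)) *
   hg_factor (rq (3 * d%:Z)) (rq (2 * d%:Z)) (rq (4 * j%:Z)) =
   tofrac (Gam (ratio_d pp s)) *
   tofrac (Gam (ratio_d pp (if (h < s)%N then h + d - s else h - s)%N)) /
   tofrac (Gam (ratio_d pp h)) * (- p%:R) ^+ (h < s)%N.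
  rewrite !zq_ratio.
  have -> : 4 * (if (h < s)%N then h + d - s else h - s)%N%:Z =
    2 * d%:Z - 4 * s%:Z + 4 * d%:Z * (h < s)%N%:Z by case: ltnP => hs'; move: hE; lia.
  have -> : 4 * h%:Z = 2 * d%:Z by move: hE; lia.
  (* The four quarters of the range of j: the floors jump at d/4, d/2 and 3d/4. *)
  case: (ltnP h s) => hsl; case: hs => hsE.
  - by apply: (@hg_term_zq j s true (-1) 0 0) => //; rewrite ?hsl //; move: hE; lia || left.
  - by apply: (@hg_term_zq j s true (-1) (-1) 1) => //; rewrite ?hsl //; move: hE; lia || right.
  - by apply: (@hg_term_zq j s false 0 0 0) => //; rewrite 1?ltnNge ?hsl //; move: hE; lia || left.
  - by apply: (@hg_term_zq j s false (-1) 0 1) => //; rewrite 1?ltnNge ?hsl //; move: hE; lia || right.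
have dK : (d%:R : K) != 0 by apply: d_frac_neq0.
have gK r : tofrac (Gam (ratio_d pp r)) != 0 :> K.
  by rewrite tofrac_eq0; apply: contraTneq (gamma_unit p_odd (ratio_d pp r)) => ->; rewrite unitr0.
have hK : tofrac (gauss_gamma pp h) != 0 :> K.
  apply/eqP => g0; have := gam_frac_sq h; rewrite g0 mul0r expr0n /= => /esym/eqP.
  by rewrite expf_eq0 (negPf (gK h)).
(* Only squares of gamma values are replaced, which is all that [gauss_gamma_sq] allows. *)
have alg (F : fieldType) (A B C P u v w D : F) : w != 0 -> D != 0 ->
    (u * D) ^+ 2 = A ^+ 2 -> (v * D) ^+ 2 = B ^+ 2 -> (w * D) ^+ 2 = C ^+ 2 ->
    (A * B / C * P) ^+ 2 = (D * (P * v * u) / w) ^+ 2.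
  move=> w0 D0 hA hB hC; rewrite !exprMn !exprVn -hA -hB -hC.
  by field; rewrite w0 D0.
rewrite (alg _ _ _ _ _ _ _ _ _ hK dK (gam_frac_sq _) (gam_frac_sq _) (gam_frac_sq _)).
congr ((_ * _ / _) ^+ 2); rewrite /jacobi_coef [(s <= h)%N]leqNgt; by case: ltnP => _ /=; rewrite ?mul1r.
Qed.

Lemma hypergeomG_jacobi :
  hypergeomG pp [tuple 1 / 4%:R; 3%:R / 4%:R; 1 / 4%:R; 3%:R / 4%:R]
                [tuple 1; 1 / 2%:R; 1; 1 / 2%:R] 1 =
  (phi (-1) - \sum_x phi (x ^+ 3 - x))%:~R.
Proof.
have d0 : (d%:R : rat) != 0 by rewrite pnatr_eq0 -lt0n; move: p_gt2; lia.
have e1 : (1 / 4%:R : rat) = rq d by rewrite /rq natrM; field.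
have e3 : (3%:R / 4%:R : rat) = rq (3 * d%:Z) by rewrite /rq natrM intrM; field.
have e2 : (1 / 2%:R : rat) = rq (2 * d%:Z) by rewrite /rq natrM intrM; field.
have e4 : (1 : rat) = rq (4 * d%:Z) by rewrite /rq natrM intrM; field.
have et (j : nat) : (j%:R / (p%:R - 1) : rat) = rq (4 * j%:Z).
  by rewrite -natr_d // /rq natrM intrM; field.
(* The parameters have period two, so the product of four factors is a square; the sign (-1)^(4j)
   and the character at 1 are trivial. *)
have T (j : nat) : let t : rat := j%:R / (p%:R - 1) in
    (-1) ^+ (j * 4) * tofrac (teichmullerV_exp pp j 1) *
    \prod_(i < 4)
      (gammaQ pp (fracpart (tnth [tuple 1 / 4%:R; 3%:R / 4%:R; 1 / 4%:R; 3%:R / 4%:R] i - t)) /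
       gammaQ pp (fracpart (tnth [tuple 1 / 4%:R; 3%:R / 4%:R; 1 / 4%:R; 3%:R / 4%:R] i)) *
       (gammaQ pp (fracpart (- tnth [tuple 1; 1 / 2%:R; 1; 1 / 2%:R] i + t)) /
        gammaQ pp (fracpart (- tnth [tuple 1; 1 / 2%:R; 1; 1 / 2%:R] i))) *
       (- p%:R) ^ (- Num.floor (fracpart (tnth [tuple 1 / 4%:R; 3%:R / 4%:R; 1 / 4%:R; 3%:R / 4%:R] i) - t)
                   - Num.floor (fracpart (- tnth [tuple 1; 1 / 2%:R; 1; 1 / 2%:R] i) + t))) =
    (hg_factor (rq d) (rq (4 * d%:Z)) (rq (4 * j%:Z)) *
     hg_factor (rq (3 * d%:Z)) (rq (2 * d%:Z)) (rq (4 * j%:Z))) ^+ 2.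
  move=> t; rewrite mulnC exprM -signr_odd expr0 expr1n.
  rewrite /teichmullerV_exp oner_eq0 tch1 // invr1 expr1n rmorph1 mulr1 mul1r.
  rewrite !big_ord_recl big_ord0 !(tnth_nth 0) /= -!/(hg_factor _ _ _).
  by rewrite /t et e1 e3 e2 e4 mulr1 expr2 !mulrA.
have dK : (d%:R : K) != 0 by exact: d_frac_neq0.
have S : \sum_(0 <= j < d) (hg_factor (rq d) (rq (4 * d%:Z)) (rq (4 * j%:Z)) *
    hg_factor (rq (3 * d%:Z)) (rq (2 * d%:Z)) (rq (4 * j%:Z))) ^+ 2 =
    d%:R * (\sum_x phi (x ^+ 3 - x) - phi (-1))%:~R :> K.
  pose U (s : nat) : K := (d%:R * jc s / tofrac (gauss_gamma pp h)) ^+ 2.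
  (* 2j mod d takes each even value twice, once in each half of the range of j. *)
  have -> : \sum_(0 <= j < d) (hg_factor (rq d) (rq (4 * d%:Z)) (rq (4 * j%:Z)) *
    hg_factor (rq (3 * d%:Z)) (rq (2 * d%:Z)) (rq (4 * j%:Z))) ^+ 2 =
    \sum_(j < h) U j.*2 + \sum_(j < h) U j.*2.
    have hd : (h <= d)%N by move: hE; lia.
    have dh : (d - h = h)%N by move: hE; lia.
    rewrite (@big_cat_nat _ _ _ h) //=; congr (_ + _).
      rewrite big_mkord; apply: eq_bigr => j _; apply: hg_term; try by left.
        exact: leq_trans (ltn_ord j) hd.
      by rewrite -addnn; have := ltn_ord j; move: hE; lia.
    rewrite -[X in \sum_(X <= _ < _) _](add0n h) big_addn dh big_mkord; apply: eq_bigr => j _.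
    have := ltn_ord j => jh; apply: hg_term; rewrite -?addnn; move: hE; lia.
  have hK : tofrac (gauss_gamma pp h) != 0 :> K.
    apply/eqP => g0; have := gam_frac_sq h; rewrite g0 mul0r expr0n /= => /esym/eqP.
    rewrite expf_eq0 /= tofrac_eq0 => /eqP e0.
    by have := gamma_unit p_odd (ratio_d pp h); rewrite e0 unitr0.
  have := jacobi_parseval pp p_odd; rewrite sum_phi_pairs // addrC => P.
  have -> : \sum_(j < h) U j.*2 = (d%:R / tofrac (gauss_gamma pp h)) ^+ 2 * \sum_(j < h) jc j.*2 ^+ 2.
    by rewrite mulr_sumr; apply: eq_bigr => j _; rewrite /U mulrAC exprMn.
  apply: (mulfI (expf_neq0 2 hK)).
  have alg (F : fieldType) (g D s : F) : g != 0 ->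
      g ^+ 2 * ((D / g) ^+ 2 * s + (D / g) ^+ 2 * s) = D * (2%:R * D * s).
    by move=> g0; field.
  by rewrite [RHS]mulrCA P; exact: alg.
rewrite /hypergeomG (eq_bigr _ (fun j _ => T j)) S -natr_d // mulrA divfK // mulN1r.
by rewrite -intrN opprB.
Qed.

End Hypergeometric.

(** * The Jacobsthal sum *)

(** The order of ['I_n] selects one point in each orbit, so that the count can be iterated with a
    second involution on the selected points. *)
Lemma card_involution (n : nat) (A : {set 'I_n}) (f : 'I_n -> 'I_n) :
  (forall x, x \in A -> [/\ f x \in A, f (f x) = x & f x != x]) ->
  #|A| = (2 * #|[set x in A | (x < f x)%N]|)%N.
Proof.
move=> hf; pose A1 := [set x in A | (x < f x)%N].
have fA1 : [set x in A | ~~ (x < f x)%N] = f @: A1.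
  apply/setP => x; rewrite !inE; apply/andP/imsetP => [[xA xf]|[y]].
    have [h1 h2 h3] := hf x xA; exists (f x); rewrite ?h2 // inE h1 h2 /=.
    by rewrite ltn_neqAle leqNgt xf andbT (inj_eq val_inj).
  rewrite inE => /andP[yA yf] ->; have [h1 h2 h3] := hf y yA.
  by rewrite h1 h2 -leqNgt ltnW.
rewrite -(cardsID [set x : 'I_n | (x < f x)%N] A) mul2n -addnn; congr (_ + _)%N.
  by apply: eq_card => x; rewrite !inE.
transitivity #|f @: A1|.
  by rewrite -fA1; apply: eq_card => x; rewrite !inE andbC.
rewrite card_in_imset // => x y; rewrite !inE => /andP[xA _] /andP[yA _] e.
by have [_ <- _] := hf x xA; have [_ <- _] := hf y yA; rewrite e.
Qed.

Section Jacobsthal.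
Context (p : nat) (pp : prime p) (p_odd : odd p).
Local Notation d := p.-1.
Local Notation h := p.-1./2.
Local Notation Fp := 'F_p.
Local Notation phi := (@quad_char p).
Implicit Types (x y k : Fp).

Let p_gt2 : (2 < p)%N. Proof. by case: (p) pp p_odd => [|[|[|]]]. Qed.
Let hE : (h + h = d)%N.
Proof. by rewrite addnn halfK -subn1 oddB ?prime_gt0 // p_odd subn0. Qed.

Definition jacobsthal k : int := \sum_x phi (x ^+ 3 - k * x).
Local Notation S := jacobsthal.

Let phiMp := phiM pp p_odd.
Let phi_sqrp := phi_sqr pp p_odd.
Let sum_phip := sum_phi pp p_odd.

Lemma jacobsthal_scale k u : u != 0 -> S (k * u ^+ 2) = phi u * S k.
Proof.
move=> u0; rewrite /S (reindex_inj (mulfI u0)) mulr_sumr; apply: eq_bigr => x _.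
have -> : (u * x) ^+ 3 - k * u ^+ 2 * (u * x) = u * u ^+ 2 * (x ^+ 3 - k * x) by ring.
by rewrite 2!phiMp phi_sq // mulr1.
Qed.

Lemma jacobsthal0 : S 0 = 0.
Proof.
rewrite -[RHS]sum_phip; apply: eq_bigr => x _; rewrite mul0r subr0.
have [->|x0] := eqVneq x 0; first by rewrite expr0n.
by rewrite exprS phiMp phi_sq // mulr1.
Qed.

(** Off the diagonal, dividing (c + k) k by k^2 gives phi(1 + c/k): a complete sum of phi without
    its term at 1. *)
Lemma sum_phi_quad x y : \sum_k phi ((x - k) * (y - k)) = (if x == y then d%:Z else -1).
Proof.
have sub_inj : injective (fun k => y - k) by move=> a b /addrI/oppr_inj.
rewrite (reindex_inj sub_inj) /=.
under eq_bigr do rewrite subKr opprB addrCA addrC.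
case: eqVneq => [->|xy].
  under eq_bigr do rewrite subrr add0r.
  rewrite (bigD1 0) //= mul0r phi0 add0r.
  under eq_bigr => k k0 do rewrite phiMp phi_sqrp //.
  rewrite sumr_const -[RHS]natz; congr (_ *+ _).
  by rewrite (eq_card (B := predC1 (0 : Fp))) // cardC1 card_Fp.
have c0 : x - y != 0 by rewrite subr_eq0.
move: (x - y) c0 => c c0.
rewrite (bigD1 0) //= mulr0 phi0 add0r.
have -> : \sum_(k | k != 0) phi ((c + k) * k) = \sum_(k | k != 0) phi (1 + c * k^-1).
  apply: eq_bigr => k k0; rewrite -[LHS]mulr1 -(phi_sqrp (x := k^-1)) ?invr_eq0 //.
  by rewrite -!phiMp; congr phi; field.
rewrite (reindex_inj (h := fun k => c * k^-1)) /=; last first.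
  by move=> a b /(mulfI c0)/invr_inj.
have -> : \sum_(k | c * k^-1 != 0) phi (1 + c * (c * k^-1)^-1) = \sum_(k | k != 0) phi (1 + k).
  apply: eq_big => [k|k]; first by rewrite mulf_eq0 (negPf c0) invr_eq0.
  by rewrite mulf_eq0 (negPf c0) invr_eq0 /= => k0; rewrite invfM invrK mulVKf.
have := sum_phip; rewrite (reindex_inj (addrI 1)) (bigD1 0) //= addr0 phi1 //.
by move/eqP; rewrite addrC addr_eq0 => /eqP.
Qed.

Context (p1 : phi (-1) = 1).

(** Summing over k first, [sum_phi_quad] leaves the pairs with y = x or y = - x. They contribute
    equally because phi(-1) = 1. *)
Lemma sum_jacobsthal_sq : \sum_k S k ^+ 2 = 2 * p%:Z * d%:Z.
Proof.
have e k : S k ^+ 2 = \sum_x \sum_y (phi (x * y) * phi ((x ^+ 2 - k) * (y ^+ 2 - k))).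
  rewrite expr2 /S mulr_suml; apply: eq_bigr => x _; rewrite mulr_sumr; apply: eq_bigr => y _.
  by rewrite -!phiMp; congr phi; ring.
rewrite (eq_bigr _ (fun k _ => e k)) exchange_big /=.
transitivity (\sum_x \sum_y phi (x * y) * (if x ^+ 2 == y ^+ 2 then d%:Z else -1)).
  apply: eq_bigr => x _; rewrite exchange_big /=; apply: eq_bigr => y _.
  by rewrite -mulr_sumr sum_phi_quad.
transitivity (\sum_x (p%:Z * (\sum_(y | x ^+ 2 == y ^+ 2) phi (x * y)) - phi x * \sum_y phi y)).
  apply: eq_bigr => x _; rewrite [X in p%:Z * X]big_mkcond !mulr_sumr -sumrB; apply: eq_bigr => y _.
  rewrite phiMp; case: eqVneq => _; last by rewrite mulr0 mulrN1 sub0r.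
  have -> : p%:Z = d%:Z + 1 by move: p_gt2; lia.
  by ring.
under eq_bigr do rewrite sum_phip mulr0 subr0.
rewrite -mulr_sumr mulrAC mulrC; congr (_ * _).
rewrite (bigD1 0) //= big1 ?add0r => [|y _]; last by rewrite mul0r phi0.
have nN x : x != 0 -> - x != x.
  move=> x0; rewrite -mulN1r -subr_eq0 -{2}[x]mul1r -mulrBl mulf_eq0 (negPf x0) orbF.
  by rewrite subr_eq0 (Fp_neq1N pp p_odd).
transitivity (\sum_(x : Fp | x != 0) (2 : int)).
  apply: eq_bigr => x x0; rewrite (bigD1 x) //= phiMp phi_sqrp //.
  rewrite (bigD1 (- x)) /=; last by rewrite sqrrN eqxx nN.
  rewrite big1 => [|y /andP[/andP[xy yx] yNx]].
    by rewrite mulrN -mulN1r phiMp p1 mul1r phiMp phi_sqrp.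
  by move: xy; rewrite eq_sym eqf_sqr (negPf yx) (negPf yNx).
rewrite sumr_const (eq_card (B := predC1 (0 : Fp))) // cardC1 card_Fp //.
by rewrite -mulr_natr natz; ring.
Qed.

(** By [jacobsthal_scale], [S k ^+ 2] only depends on the quadratic class of k, so the sum of
    squares is d/2 times the two values at 1 and at a nonresidue g. *)
Lemma jacobsthal_two_squares : exists v : int, S 1 ^+ 2 + v ^+ 2 = 4 * p%:Z.
Proof.
have [g g0 hg] := phi_nonresidue pp p_odd; exists (S g).
have sq k : k != 0 -> 2 * S k ^+ 2 = (1 + phi k) * S 1 ^+ 2 + (1 - phi k) * S g ^+ 2.
  have scale u : u != 0 -> phi u ^+ 2 = 1 by move=> u0; rewrite expr2 phi_sqrp.
  move=> k0; have [hk|hk] := phi_range k0; rewrite hk.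
    move: hk; rewrite /quad_char (negPf k0); case: ifP => // /existsP[u /eqP uk] _.
    have u0 : u != 0 by apply: contraNneq k0 => u0; rewrite -uk u0 expr0n.
    by rewrite -uk -[u ^+ 2]mul1r jacobsthal_scale // exprMn scale //; ring.
  have : phi (k / g) = 1 by rewrite phiMp phiV // hk hg.
  have kg0 : k / g != 0 by rewrite mulf_neq0 ?invr_eq0.
  rewrite {1}/quad_char (negPf kg0); case: ifP => // /existsP[u /eqP uk] _.
  have u0 : u != 0 by apply: contraNneq kg0 => u0; rewrite -uk u0 expr0n.
  have -> : k = g * u ^+ 2 by rewrite uk mulrC divfK.
  by rewrite jacobsthal_scale // exprMn scale //; ring.
have := sum_jacobsthal_sq; rewrite (bigD1 0) //= jacobsthal0 expr0n add0r => E.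
have E2 : 2 * \sum_(k | k != 0) S k ^+ 2 = d%:Z * (S 1 ^+ 2 + S g ^+ 2).
  rewrite mulr_sumr (eq_bigr _ sq) big_split /= -!mulr_suml !big_split /= sumrN.
  have -> : \sum_(k | k != 0) phi k = 0.
    by have := sum_phip; rewrite (bigD1 0) //= phi0 add0r.
  have -> : \sum_(k : Fp | k != 0) (1 : int) = d%:Z.
    by rewrite sumr_const (eq_card (B := predC1 (0 : Fp))) // cardC1 card_Fp // natz.
  by ring.
have d0 : d%:Z != 0 by rewrite -lt0n; move: p_gt2; lia.
by apply: (mulfI d0); rewrite -E2 E; ring.
Qed.

(** The maps x -> -x and x -> 1/x preserve phi(x^3 - x) and generate a group of order 4 acting
    freely outside 0, 1, -1, i, -i. So 4t points there have value -1, and the sum is (p - 5) - 8t +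
    2, the 2 coming from i and -i. *)
Lemma jacobsthal1_mod8 : exists t : nat, S 1 = p%:Z - 3 - 8 * t%:Z.
Proof.
have [i iE] : exists i : Fp, i ^+ 2 = -1.
  move: p1; rewrite /quad_char oppr_eq0 oner_eq0; case: ifP => // /existsP[i /eqP iE] _.
  by exists i.
have n1 := Fp_neq1N pp p_odd; have n0 : (1 : Fp) != 0 := oner_neq0 _.
have i0 : i != 0 by apply: contra_eq_neq iE => ->; rewrite expr0n eq_sym oppr_eq0.
have i1 : i != 1 by apply: contra_eq_neq iE => ->; rewrite expr1n eq_sym.
have iN1 : i != -1 by apply: contra_eq_neq iE => ->; rewrite sqrrN expr1n eq_sym.
have nN x : x != 0 -> - x != x.
  move=> x0; rewrite -mulN1r -subr_eq0 -{2}[x]mul1r -mulrBl mulf_eq0 (negPf x0) orbF.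
  by rewrite subr_eq0.
pose E : {set Fp} := [set 0; 1; -1; i; - i].
pose f x := phi (x ^+ 3 - x).
have fN x : f (- x) = f x.
  by rewrite /f -[RHS]mul1r -p1 -phiMp; congr phi; ring.
have fV x : x != 0 -> f x^-1 = f x.
  move=> x0; rewrite /f -[LHS]mul1r -p1 -phiMp -[LHS]mulr1 -(phi_sq (x := x ^+ 2)).
    by rewrite -phiMp; congr phi; field.
  by rewrite expf_eq0.
pose B x := [&& x != 0, x ^+ 2 != 1 & x ^+ 2 != -1].
have BE x : B x = (x \notin E).
  rewrite /B !inE sqrf_eq1 -iE eqf_sqr !negb_or -!andbA; by [].
pose A := [set x | B x && (f x == -1)].
have AN x : x \in A -> - x \in A.
  by rewrite !inE fN /B sqrrN oppr_eq0.
have AV x : x \in A -> x^-1 \in A.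
  rewrite !inE => /andP[/and3P[x0 x1 x2]]; rewrite fV // => ->.
  rewrite /B invr_eq0 x0 exprVn invr_eq1 x1 /= andbT.
  by rewrite -[-1]invrN1 (inj_eq invr_inj).
(* The inversion on the pairs {x, -x}, each represented by its smaller member. *)
pose g x := if ((x^-1 : nat) < (- x^-1)%R)%N then x^-1 else - x^-1.
have c1 : #|A| = (2 * #|[set x in A | (x < (- x)%R)%N]|)%N.
  apply: card_involution => x xA; split; [exact: AN | exact: opprK | apply: nN].
  by move: xA; rewrite !inE => /andP[/and3P[]].
pose A1 := [set x in A | (x < (- x)%R)%N].
have c2 : #|A1| = (2 * #|[set x in A1 | (x < g x)%N]|)%N.
  apply: card_involution => x.
  rewrite inE => /andP[xA xN]; have xA' := xA; move: xA'; rewrite inE => /andP[/and3P[x0 x1 x2] _].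
  have gA : g x \in A by rewrite /g; case: ifP => _; [exact: AV | apply/AN/AV].
  have V0 : x^-1 != 0 by rewrite invr_eq0.
  split.
  - rewrite inE gA /g; case: ifP => // /negbT; rewrite -leqNgt opprK => le.
    by rewrite ltn_neqAle le andbT (inj_eq val_inj) nN.
  - rewrite {2}/g; case: ifP => _; rewrite /g ?invrN invrK; first by rewrite xN.
    by rewrite opprK ltnNge (ltnW xN).
  - rewrite /g; case: ifP => _.
      apply: contra x1 => /eqP e; by rewrite expr2 -{1}e mulVf.
    apply: contra x2 => /eqP e; by rewrite expr2 -{1}e mulNr mulVf.
rewrite -/A1 c2 in c1; exists #|[set x in A1 | (x < g x)%N]|.
have sB : \sum_(x | B x) f x = #|B|%:Z - 2 * #|A|%:Z.
  have -> : #|B|%:Z = \sum_(x | B x) 1 by rewrite sumr_const natz.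
  have -> : #|A|%:Z = \sum_(x | B x) (f x == -1)%:R.
    rewrite -natz -sum1_card natr_sum big_mkcond [RHS]big_mkcond; apply: eq_bigr => x _.
    by rewrite inE; case: (B x) => //=; case: (f x == -1).
  rewrite mulr_sumr -sumrB; apply: eq_bigr => x /and3P[x0 x1 _].
  have fx : x ^+ 3 - x != 0.
    rewrite (_ : x ^+ 3 - x = x * (x ^+ 2 - 1)); last by ring.
    by rewrite mulf_neq0 // subr_eq0.
  by rewrite /f; have [->|->] := phi_range fx; rewrite ?eqxx //= mulr0 subr0.
have ne2 (x y : Fp) : x ^+ 2 != y ^+ 2 -> x != y by apply: contra => /eqP ->.
have e1 : 0 \notin 1 |: (-1 |: (i |: [set - i])).
  by rewrite !inE !negb_or !(eq_sym 0) oppr_eq0 n0 i0 oppr_eq0 i0.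
have e2 : 1 \notin -1 |: (i |: [set - i]).
  by rewrite !inE !negb_or !(eq_sym 1) n1 i1 eqr_oppLR iN1.
have e3 : -1 \notin i |: [set - i].
  by rewrite !inE !negb_or !(eq_sym (-1)) iN1 eqr_opp i1.
have e4 : i \notin [set - i] by rewrite inE eq_sym nN.
have E5 : E = 0 |: (1 |: (-1 |: (i |: [set - i]))) by rewrite /E !finset.setUA.
have cE : #|E| = 5%N by rewrite E5 !cardsU1 e1 e2 e3 e4 cards1.
have cB : (#|B| + 5 = p)%N.
  apply: etrans (card_Fp pp); rewrite -(cardC (mem E)) cE addnC; congr (_ + _)%N.
  by apply: eq_card => x; rewrite [LHS]BE.
have fi : f i = 1.
  have -> : f i = phi ((1 - i) ^+ 2).
    rewrite /f; congr phi; rewrite sqrrB expr1n iE [i ^+ 3]exprS iE; ring.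
  by rewrite phi_sq // subr_eq0 eq_sym.
have sE : \sum_(x | ~~ B x) f x = 2.
  rewrite (eq_bigl (mem E)) => [|x]; last by rewrite BE negbK.
  rewrite E5 !big_setU1 // big_set1 fN fi {1 2}/f.
  have -> : f (-1) = 0 by rewrite fN /f expr1n subrr phi0.
  by rewrite !expr0n expr1n !subrr phi0.
have -> : S 1 = \sum_x f x by apply: eq_bigr => x _; rewrite mul1r.
rewrite (bigID B) /= sB sE; move: cB c1.
have arith (b a t q : nat) : (b + 5 = q)%N -> (a = 2 * (2 * t))%N ->
    b%:Z - 2 * a%:Z + 2 = q%:Z - 3 - 8 * t%:Z by clear; lia.
exact: arith.
Qed.

Lemma jacobsthal1_decomp : exists s m : int,
  [/\ S 1 = 2 * s, p%:Z = s ^+ 2 + 4 * m ^+ 2 & exists t : int, 2 * s = p%:Z - 3 - 8 * t].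
Proof.
have [t tE] := jacobsthal1_mod8; have [v vE] := jacobsthal_two_squares.
have h_even : ~~ odd h.
  apply/negP => ho; have := phiN1 pp p_odd; rewrite p1 -signr_odd ho; by [].
have [q qE] : exists q : nat, p = (4 * q + 1)%N.
  exists (h./2); have := odd_double_half h; rewrite (negPf h_even) add0n -addnn.
  by move: hE p_gt2; lia.
pose s : int := 2 * q%:Z - 1 - 4 * t%:Z.
have sE : S 1 = 2 * s by rewrite tE /s qE; lia.
have [w wE] : exists w : int, v = 2 * w.
  have : (2 %| `|v|)%N.
    have : (2 %| `|v| ^ 2)%N.
      rewrite -abszX; have -> : v ^+ 2 = 4 * p%:Z - (2 * s) ^+ 2 by rewrite -sE -vE; ring.
      have -> : 4 * p%:Z - (2 * s) ^+ 2 = 2 * (2 * p%:Z - 2 * s ^+ 2) by ring.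
      by rewrite abszM dvdn_mulr.
    by rewrite Euclid_dvdX // => /andP[].
  move/dvdnP => [k kE]; exists ((-1) ^+ (v < 0)%R * k%:Z).
  by rewrite {1}(intEsign v) kE PoszM mulrA mulrC.
have pE : p%:Z = s ^+ 2 + w ^+ 2.
  have := vE; rewrite sE wE => e; have : 4 * (s ^+ 2 + w ^+ 2) = 4 * p%:Z by rewrite -e; ring.
  by move/mulfI => ->.
have [m mE] : exists m : int, w = 2 * m.
  have : (2 %| `|w|)%N.
    have : (2 %| `|w| ^ 2)%N.
      rewrite -abszX; have -> : w ^+ 2 = p%:Z - s ^+ 2 by rewrite pE; ring.
      have -> : p%:Z - s ^+ 2 = 2 * (2 * q%:Z - 2 * (q%:Z - 2 * t%:Z) ^+ 2 + 2 * (q%:Z - 2 * t%:Z)).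
        by rewrite qE /s PoszD PoszM; ring.
      by rewrite abszM dvdn_mulr.
    by rewrite Euclid_dvdX // => /andP[].
  move/dvdnP => [k kE]; exists ((-1) ^+ (w < 0)%R * k%:Z).
  by rewrite {1}(intEsign w) kE PoszM mulrA mulrC.
exists s, m; split => //; first by rewrite pE mE; ring.
by exists t%:Z; rewrite -tE sE.
Qed.

End Jacobsthal.

(** p divides one of D = UV' - VU' and D = UV' + VU', and p^2 = D^2 + C^2 with C = UU' + VV' or C =
    UU' - VV'. Parity makes C nonzero, so D is 0 and V^2 = V'^2. *)
Lemma two_squares_uniq (p u v u' v' : nat) : prime p -> odd u -> odd u' ->
  (u ^ 2 + 4 * v ^ 2 = p)%N -> (u' ^ 2 + 4 * v' ^ 2 = p)%N -> u = u' /\ v = v'.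
Proof.
move=> pp ou ou' e e'.
pose U := u%:Z; pose U' := u'%:Z; pose V := 2 * v%:Z; pose V' := 2 * v'%:Z.
have E : U ^+ 2 + V ^+ 2 = p%:Z by rewrite -e /U /V PoszD PoszM -!mulnn !PoszM; ring.
have E' : U' ^+ 2 + V' ^+ 2 = p%:Z by rewrite -e' /U' /V' PoszD PoszM -!mulnn !PoszM; ring.
have u0 : 0 < U * U' by rewrite /U /U' -PoszM ltz_nat muln_gt0; case: u u' ou ou' {e e' U U' E E'} => [|u] [|u'].
have odd_nz (w : int) : U * U' - 2 * w != 0.
  apply/eqP => e0; have := congr1 (fun z : int => odd `|z|) (eqP (_ : U * U' == 2 * w)).
  by rewrite -subr_eq0 e0 eqxx => /(_ isT); rewrite !abszM /= oddM ou ou' oddM.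
have key D C : (p %| `|D|)%N -> D ^+ 2 + C ^+ 2 = p%:Z ^+ 2 -> C != 0 -> D = 0.
  move=> /dvdnP[k kE] DC C0; have C2 : 0 < C ^+ 2 by rewrite exprn_even_gt0.
  have D2 : D ^+ 2 = (k * p)%N%:Z ^+ 2 by rewrite -kE abszE real_normK ?num_real.
  case: k kE D2 => [/eqP|k _ D2]; first by rewrite absz_eq0 => /eqP.
  have : p%:Z ^+ 2 <= D ^+ 2 by rewrite D2 ler_sqr ?nnegrE // lez_nat leq_pmull.
  by rewrite -DC; lia.
have VV : V ^+ 2 = V' ^+ 2.
  have p0 : p%:Z != 0 by have := prime_gt0 pp; rewrite -lt0n.
  have prodE : (U * V' - V * U') * (U * V' + V * U') = p%:Z * (V' ^+ 2 - V ^+ 2).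
    transitivity ((U ^+ 2 + V ^+ 2) * V' ^+ 2 - V ^+ 2 * (U' ^+ 2 + V' ^+ 2)); first ring.
    by rewrite E E'; ring.
  have : (p %| `|((U * V' - V * U') * (U * V' + V * U'))%R|)%N.
    by rewrite prodE abszM dvdn_mulr.
  rewrite abszM Euclid_dvdM // => /orP[] hd.
    have D0 := key _ (U * U' + V * V') hd.
    move: prodE; rewrite D0 ?mul0r; first by move/esym/eqP; rewrite mulf_eq0 (negPf p0) subr_eq0 => /eqP.
      by transitivity ((U ^+ 2 + V ^+ 2) * (U' ^+ 2 + V' ^+ 2)); [ring | rewrite E E'].
    by rewrite gt_eqF // ltr_wpDr // /V /V'; lia.
  have D0 := key _ (U * U' - V * V') hd.
  move: prodE; rewrite D0 ?mulr0; first by move/esym/eqP; rewrite mulf_eq0 (negPf p0) subr_eq0 => /eqP.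
    by transitivity ((U ^+ 2 + V ^+ 2) * (U' ^+ 2 + V' ^+ 2)); [ring | rewrite E E'].
  by have := odd_nz (v%:Z * V'); rewrite /V mulrA.
have UU : U ^+ 2 = U' ^+ 2 by move: E'; rewrite -E VV => /addIr.
move/eqP: UU; move/eqP: VV; rewrite !eqrXn2 ?/V ?/V' ?/U ?/U' //; lia.
Qed.

(** Coefficient of q^(j^2) in the theta series with signs (-1)^j, the terms of j and -j being
    merged. *)
Definition theta_weight (j : nat) : int := (-1) ^+ j * (if j == 0%N then 1 else 2).
Definition jacobi_weight (k : nat) : int := (-1) ^+ k * (2 * k + 1)%N%:Z.

Definition theta_jacobi L n : int := \sum_(j < L) \sum_(k < L)
  (if (4 * j ^ 2 + (2 * k + 1) ^ 2 == n)%N then theta_weight j * jacobi_weight k else 0).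

(** For p = 1 mod 4, uniqueness of p = s^2 + 4m^2 leaves one term, at j = |m| and 2k + 1 = |s|. For
    p = 3 mod 4 there is no term, and x -> -x annihilates the character sum. *)
Lemma theta_jacobi_prime p L (pp : prime p) : odd p -> (p <= L)%N ->
  theta_jacobi L p = - \sum_(x : 'F_p) quad_char (x ^+ 3 - x).
Proof.
move=> p_odd pL.
have h2 : (p.-1 = p.-1./2.*2)%N.
  by rewrite -[LHS]odd_double_half -subn1 oddB ?prime_gt0 // p_odd.
have p_gt2 : (2 < p)%N by case: (p) pp p_odd => [|[|[|]]].
have [n1|n1] : quad_char (-1 : 'F_p) = 1 \/ quad_char (-1 : 'F_p) = -1.
  by apply: phi_range; rewrite oppr_eq0 oner_eq0.
  have [s [m [S1 pE [t tE]]]] := jacobsthal1_decomp pp p_odd n1.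
  have -> : \sum_(x : 'F_p) quad_char (x ^+ 3 - x) = 2 * s.
    by rewrite -S1; apply: eq_bigr => x _; rewrite mul1r.
  have p4 : exists q : int, p%:Z = 4 * q + 1.
    have : ~~ odd p.-1./2.
      by apply/negP => ho; have := phiN1 pp p_odd; rewrite n1 -signr_odd ho.
    move=> he; exists (p.-1./2./2%:Z); have := odd_double_half p.-1./2.
    by rewrite (negPf he) add0n; move: h2 p_gt2; rewrite -!addnn; lia.
  have [q qE] := p4.
  have sodd : s = 2 * (q * 2 - 2 * t - 1) + 1 - q * 2 by lia.
  have so : odd `|s| by move: tE; rewrite qE => tE; lia.
  have pN : (`|s| ^ 2 + 4 * `|m| ^ 2 = p)%N.
    by apply/eqP; rewrite -eqz_nat pE PoszD PoszM -!abszX !abszE !ger0_norm ?sqr_ge0.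
  (* A prime is not a square; hence the weight at j = |m| carries the factor 2. *)
  have m0 : (`|m| != 0)%N.
    apply/negP => /eqP m0; move: pp; rewrite -pN m0 muln0 addn0.
    by rewrite -mulnn; apply/negP/primePn; right; exists `|s|%N; rewrite ?dvdn_mulr //;
       move: p_gt2; rewrite -pN m0 muln0 addn0; case: (`|s|%N) => [|[|n]] // _; rewrite /= ltn_Pmull.
  have sE : `|s|%N = (2 * `|s|./2 + 1)%N by rewrite -[LHS]odd_double_half so addnC -mul2n.
  have aux a : (a <= a ^ 2)%N by rewrite -mulnn; case: a => // a; rewrite leq_pmulr.
  have mp : (`|m| < L)%N.
    apply: leq_trans pL; move: (aux `|m|%N) (aux `|s|%N); rewrite -pN.
    by move: so; move: (`|m| ^ 2)%N (`|s| ^ 2)%N `|m|%N `|s|%N => a b c e; clear; lia.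
  have sp : (`|s|./2 < L)%N.
    apply: leq_trans pL; move: (aux `|s|%N); rewrite -pN.
    by move: so; move: (`|m| ^ 2)%N (`|s| ^ 2)%N `|s|%N => a b c; clear; lia.
  have cond (j k : 'I_L) : ((4 * j ^ 2 + (2 * k + 1) ^ 2 == p) = ((j : nat) == `|m|) && ((k : nat) == `|s|./2))%N.
    apply/eqP/andP => [e|[/eqP -> /eqP ->]]; last by rewrite -sE addnC.
    have o1 : odd (2 * k + 1) by rewrite oddD oddM.
    have [e1 e2] := two_squares_uniq pp o1 so (etrans (addnC _ _) e) pN.
    by rewrite e2 eqxx; split => //; apply/eqP; rewrite -e1 addn1 mul2n /= uphalf_double.
  rewrite /theta_jacobi (bigD1 (Ordinal mp)) //= (bigD1 (Ordinal sp)) //=.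
  rewrite (cond (Ordinal mp) (Ordinal sp)) /= !eqxx /= big1 => [|k ks]; last first.
    by rewrite (cond (Ordinal mp)) /= eqxx; move: ks; rewrite -(inj_eq val_inj) /= => /negPf ->.
  rewrite big1 => [|j js]; last first.
    apply: big1 => k _; rewrite cond; move: js; rewrite -(inj_eq val_inj) /= => /negPf ->.
    by [].
  rewrite !addr0 /theta_weight (negPf m0) /jacobi_weight -sE.
  rewrite -signr_odd -[(-1) ^+ _./2]signr_odd.
  have mm : exists r : int, m ^+ 2 = (odd `|m|)%:Z + 2 * r.
    have -> : m ^+ 2 = `|m|%N%:Z ^+ 2 by rewrite abszE real_normK // num_real.
    rewrite -{1}(odd_double_half `|m|) -mul2n PoszD PoszM; move: (`|m|./2) => g.
    case: (odd _) => /=; first by exists (2 * g%:Z + 2 * g%:Z ^+ 2); ring.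
    by exists (2 * g%:Z ^+ 2); ring.
  have ss : exists r : int, s ^+ 2 = 1 + 8 * r.
    have -> : s ^+ 2 = `|s|%N%:Z ^+ 2 by rewrite abszE real_normK // num_real.
    rewrite {1}sE PoszD PoszM -{1}(odd_double_half `|s|./2) -mul2n PoszD PoszM.
    move: (`|s|./2./2) => g; case: (odd _) => /=.
      by exists ((1 + 2 * g%:Z) * (1 + g%:Z)); ring.
    by exists (g%:Z * (2 * g%:Z + 1)); ring.
  have [r1 e1] := mm; have [r2 e2] := ss.
  have k2 := odd_double_half `|s|./2; rewrite -addnn in k2.
  have gen (z : int) : z = `|z|%N%:Z \/ z = - `|z|%N%:Z.
    by case: z => n; [left | right; rewrite NegzE abszN absz_nat].
  have se := gen s.
  (* Mod 8, p is 1 for even m and 5 for odd m, and 2s = p - 3; so s is -1 or 1 mod 4 accordingly. As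
     (-1)^k (2k + 1) is 1 mod 4, this forces s = - (-1)^(m + k) (2k + 1). *)
  move: se tE; rewrite pE e1 e2; move: (`|s|./2) sE k2 => k -> k2.
  move: (odd k) (k./2) k2 (odd `|m|) => c g k2 b.
  by clear -k2; case: b; case: c k2 => /= k2 -[->|->]; rewrite ?expr0 ?expr1; lia.
have -> : \sum_(x : 'F_p) quad_char (x ^+ 3 - x) = 0.
  have : \sum_(x : 'F_p) quad_char (x ^+ 3 - x) = - \sum_(x : 'F_p) quad_char (x ^+ 3 - x).
    rewrite {1}(reindex_inj (@oppr_inj _)) -sumrN; apply: eq_bigr => x _.
    by rewrite -[RHS]mulN1r -n1 -phiM //; congr quad_char; ring.
  by move: (\sum_(_ : _) _) => w; lia.
rewrite oppr0; apply: big1 => j _; apply: big1 => k _; case: eqP => // e; exfalso.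
have ho : odd p.-1./2.
  by apply: contraT => he; have := phiN1 pp p_odd; rewrite n1 -signr_odd (negPf he).
have := odd_double_half p.-1./2; rewrite ho -!addnn => h4.
move: h2 e; rewrite -!mulnn -!addnn => h2 e.
have : (4 * (j * j + k * k + k) + 1 = p)%N by rewrite -e; ring.
by move: (j * j + k * k + k)%N => w; move: p_gt2; lia.
Qed.

(** * The identities of Gauss and Jacobi *)

Section QBinomial.
Context (A : idomainType) (Q : A).

Fixpoint qbin (N m : nat) : A :=
  match N, m with
  | _, 0 => 1
  | 0, _.+1 => 0
  | N'.+1, m'.+1 => Q ^+ (N' - m') * qbin N' m' + qbin N' m
  end.

Definition qfact n : A := \prod_(i < n) (1 - Q ^+ i.+1).

Lemma qbinn0 N : qbin N 0 = 1. Proof. by case: N. Qed.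

Lemma qbinS N m : qbin N.+1 m.+1 = Q ^+ (N - m) * qbin N m + qbin N m.+1.
Proof. by []. Qed.

Arguments qbin : simpl never.

Lemma qbin_small N m : (N < m)%N -> qbin N m = 0.
Proof.
elim: N m => [|N IH] [|m] // Nm; rewrite qbinS !IH ?mulr0 ?addr0 //; exact: ltnW.
Qed.

Lemma qfactS n : qfact n.+1 = qfact n * (1 - Q ^+ n.+1).
Proof. exact: big_ord_recr. Qed.

Lemma qfact0 : qfact 0 = 1. Proof. exact: big_ord0. Qed.

Lemma qbin_fact N m : (m <= N)%N -> qbin N m * (qfact m * qfact (N - m)) = qfact N.
Proof.
elim: N m => [|N IH] [|m] // mN; rewrite ?qbinn0 ?subn0 ?qfact0 ?mul1r //.
rewrite qbinS subSS mulrDl [in RHS]qfactS.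
have -> : Q ^+ (N - m) * qbin N m * (qfact m.+1 * qfact (N - m)) =
    Q ^+ (N - m) * (1 - Q ^+ m.+1) * qfact N.
  by rewrite -(IH m) // qfactS; ring.
have -> : qbin N m.+1 * (qfact m.+1 * qfact (N - m)) = (1 - Q ^+ (N - m)) * qfact N.
  move: mN; rewrite ltnS leq_eqVlt => /orP[/eqP <-|mN].
    by rewrite subnn expr0 subrr mul0r qbin_small ?mul0r.
  by rewrite -(IH m.+1) // -(subnSK mN) (qfactS (N - m.+1)); ring.
rewrite -mulrDl mulrC; congr (_ * _).
have -> : Q ^+ N.+1 = Q ^+ (N - m) * Q ^+ m.+1 by rewrite -exprD; congr (_ ^+ _); lia.
ring.
Qed.

(** The form [w - Q ^+ k] serves both applications: w becomes a power of X for Gauss, and for Jacobi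
    the identity is differentiated at a zero w = Q^n. *)
Lemma qbin_rothe N w : \prod_(k < N) (w - Q ^+ k) =
  \sum_(j < N.+1) (-1) ^+ j * Q ^+ 'C(j, 2) * qbin N j * w ^+ (N - j).
Proof.
elim: N => [|N IH]; first by rewrite big_ord0 big_ord1 bin0n subn0 !expr0 !mulr1.
rewrite big_ord_recr /= IH mulrBr.
rewrite [RHS]big_ord_recl bin0n expr0 expr0 qbinn0 subn0 !mul1r.
under [in RHS]eq_bigr => j _.
  rewrite /= /bump add1n qbinS subSS mulrDr mulrDl.
  over.
rewrite big_split /= [in RHS]addrA addrAC; congr (_ + _).
  rewrite mulr_suml big_ord_recl /= bin0n expr0 expr0 qbinn0 subn0 !mul1r -exprSr.
  rewrite [in RHS]big_ord_recr /= qbin_small // mulr0 mul0r addr0; congr (_ + _).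
  apply: eq_bigr => j _; rewrite /bump add1n.
  by have -> : (N - j = (N - j.+1).+1)%N; [have := ltn_ord j; lia | rewrite [w ^+ _.+1]exprSr mulrA].
rewrite mulr_suml -sumrN; apply: eq_bigr => j _; have jN := ltn_ord j.
have -> : Q ^+ N = Q ^+ (N - j) * Q ^+ j by rewrite -exprD subnK // -ltnS.
by rewrite binS bin1 exprD [(-1) ^+ j.+1]exprS; ring.
Qed.

End QBinomial.

Lemma double_bin2 j : (2 * 'C(j, 2) = j * j.-1)%N.
Proof. by rewrite bin2 mul2n even_halfK //; case: j => // k; rewrite /= oddM /= andNb. Qed.

(** Completes the square in the exponent of [qbin_rothe] for Q = X^2, N = 2n and w = X^(2n - 1),
    where n = m + 1. *)
Lemma gauss_exponent m j : (j <= m.+1.*2)%N ->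
  (m.+1 * (3 * m + 1) + `|j%:Z - m.+1%:Z| ^ 2 = 2 * 'C(j, 2) + m.*2.+1 * (m.+1.*2 - j))%N.
Proof.
rewrite double_bin2 -mulnn -!mul2n => jn; case: (leqP j m.+1) => jm.
  rewrite distnEr //; have [k kE] : exists k, m.+1 = (j + k)%N by exists (m.+1 - j)%N; lia.
  have -> : (m.+1 - j = k)%N by lia.
  have -> : (2 * m.+1 - j = j + 2 * k)%N by lia.
  case: j kE {jn jm} => [|i] kE; last by have -> : m = (i + k)%N; [lia | rewrite /=; ring].
  by have -> : k = m.+1 by []; ring.
rewrite distnEl ?(ltnW jm) //; have [k kE] : exists k, j = (m.+2 + k)%N by exists (j - m.+2)%N; lia.
have -> : (j - m.+1 = k.+1)%N by lia.
have [l lE] : exists l, m = (k + l)%N by exists (m - k)%N; lia.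
have -> : (2 * m.+1 - j = l)%N by lia.
by rewrite kE /= lE; ring.
Qed.

Lemma jacobi_exponent_low n k : (k <= n)%N ->
  ('C(n - k, 2) + n * (n + k) = 'C(n, 2) + n * n + 'C(k.+1, 2))%N.
Proof.
move=> kn; move: (double_bin2 (n - k)) (double_bin2 n) (double_bin2 k.+1).
move: 'C(n - k, 2) 'C(n, 2) 'C(k.+1, 2) => a b c ha hb hc.
apply/eqP; rewrite -(eqn_pmul2l (isT : (0 < 2)%N)) !mulnDr ha hb hc {a b c ha hb hc}.
move: (subnKC kn); move: (n - k)%N => i <-; apply/eqP.
case: i => [|i]; last by have -> : ((k + i.+1).-1 = k + i)%N; [lia | rewrite !succnK; ring].
by rewrite addn0 !succnK; case: k {kn} => [|k]; rewrite ?succnK; ring.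
Qed.

Lemma jacobi_exponent_high n k : (k < n)%N ->
  ('C(n.+1 + k, 2) + n * (n - k.+1) = 'C(n, 2) + n * n + 'C(k.+1, 2))%N.
Proof.
move=> kn; move: (double_bin2 (n.+1 + k)) (double_bin2 n) (double_bin2 k.+1).
move: 'C(n.+1 + k, 2) 'C(n, 2) 'C(k.+1, 2) => a b c ha hb hc.
apply/eqP; rewrite -(eqn_pmul2l (isT : (0 < 2)%N)) !mulnDr ha hb hc {a b c ha hb hc}.
move: (subnKC kn); move: (n - k.+1)%N => i <-; apply/eqP.
have -> : ((k.+1 + i).+1 + k).-1 = (k.+1 + i + k)%N by [].
by have -> : (k.+1 + i).-1 = (k + i)%N by []; rewrite succnK; ring.
Qed.

Lemma qbin_morph (A B : idomainType) (f : {rmorphism A -> B}) (Q : A) N m :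
  f (qbin Q N m) = qbin (f Q) N m.
Proof.
elim: N m => [|N IH] [|m]; rewrite ?qbinn0 ?rmorph1 //; first exact: rmorph0.
by rewrite !qbinS rmorphD rmorphM rmorphXn !IH.
Qed.

(** * Finite forms of the identities and their truncation *)

Section ThetaPolynomials.
Context (F : fieldType).
Local Notation PF := {poly F}.
Implicit Types (P : PF) (n k j e : nat).

Lemma qfact_horner0 e n : (0 < e)%N -> (qfact ('X^e : PF) n).[0] = 1.
Proof.
move=> e0; rewrite horner_prod big1 // => i _; rewrite !hornerE -exprM expr0n.
by rewrite muln_eq0 (gtn_eqF e0) subr0.
Qed.

Lemma qfact_neq0 e n : (0 < e)%N -> qfact ('X^e : PF) n != 0.
Proof.
move=> e0; apply/eqP => q0; have := qfact_horner0 n e0; rewrite q0 horner0 => /eqP.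
by rewrite eq_sym oner_eq0.
Qed.

Lemma qbin_sym e n m : (0 < e)%N -> (m <= n)%N ->
  qbin ('X^e : PF) n (n - m) = qbin ('X^e) n m.
Proof.
move=> e0 mn; have h : qfact ('X^e : PF) m * qfact 'X^e (n - m) != 0.
  by rewrite mulf_neq0 ?qfact_neq0.
apply: (mulIf h); rewrite [RHS]qbin_fact // -(qbin_fact _ (leq_subr m n)) subKn //.
by rewrite (mulrC (qfact _ m)).
Qed.

Lemma prod_polyXn n (f : nat -> nat) :
  \prod_(i < n) ('X^(f i) : PF) = 'X^(\sum_(i < n) f i).
Proof. by rewrite (big_morph (fun e => 'X^e : PF) (fun a b => exprD _ a b) (expr0 _)). Qed.

Lemma prod_double n (f : nat -> PF) :
  \prod_(i < n.*2) f i = \prod_(i < n) f i * \prod_(i < n) f (n + i)%N.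
Proof. by rewrite -addnn big_split_ord. Qed.

Lemma sum_double n : (\sum_(i < n.+1) i.*2 = n.+1 * n)%N.
Proof. by elim: n => [|n IH]; [rewrite big_ord1 | rewrite big_ord_recr /= IH -muln2; lia]. Qed.

(** With w = X^(2n - 1) and Q = X^2 the 2n factors of [qbin_rothe] lie symmetrically: up to sign and
    a monomial, each half is the product of the 1 - X^(2k + 1). *)
Lemma gauss_finite n : (\prod_(k < n) (1 - 'X^(k.*2.+1))) ^+ 2 =
  \sum_(j < n.*2.+1) (-1) ^+ (j + n) * 'X^(`|j%:Z - n%:Z| ^ 2) * qbin ('X^2 : PF) n.*2 j.
Proof.
case: n => [|m].
  by rewrite big_ord0 expr1n big_ord1 qbinn0 !expr0 !mulr1.
set n := m.+1; pose G : PF := \prod_(k < n) (1 - 'X^(k.*2.+1)).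
have X0 e : ('X^e : PF) != 0 by rewrite -size_poly_gt0 size_polyXn.
pose E := (n * (3 * m + 1))%N.
have := qbin_rothe ('X^2 : PF) n.*2 'X^(m.*2.+1).
rewrite (prod_double n (fun k => 'X^(m.*2.+1) - ('X^2) ^+ k)).
have -> : \prod_(i < n) ('X^(m.*2.+1) - ('X^2) ^+ i : PF) = (-1) ^+ n * 'X^(n * m) * G.
  rewrite -sum_double -(prod_polyXn n (fun i => i.*2)) /G (reindex_inj (@rev_ord_inj n)) /=.
  rewrite [X in _ = _ * X * _](reindex_inj (@rev_ord_inj n)) /=.
  rewrite -[n in (-1) ^+ n]card_ord -prodr_const -!big_split /=; apply: eq_bigr => i _.
  have im : (i <= m)%N by rewrite -ltnS.
  rewrite subSS -exprM mul2n.
  have -> : m.*2.+1 = ((m - i).*2 + i.*2.+1)%N by rewrite -!addnn; lia.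
  by rewrite exprD; ring.
have -> : \prod_(i < n) ('X^(m.*2.+1) - ('X^2) ^+ (n + i) : PF) = 'X^(n * (m.*2.+1)) * G.
  rewrite [(n * _)%N]mulnC exprM -[X in _ ^+ X * G](card_ord n) -prodr_const -big_split /=.
  apply: eq_bigr => i _; rewrite -exprM mul2n.
  have -> : ((n + i).*2 = m.*2.+1 + i.*2.+1)%N by rewrite /n -!addnn; lia.
  by rewrite exprD; ring.
move=> H; apply: (mulfI (X0 E)).
have -> : 'X^E * G ^+ 2 = (-1) ^+ n * ((-1) ^+ n * 'X^(n * m) * G * ('X^(n * (m.*2.+1)) * G)).
  have -> : 'X^E = 'X^(n * m) * 'X^(n * m.*2.+1) :> PF.
    by rewrite -exprD; congr 'X^_; rewrite /E -addnn; lia.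
  rewrite !mulrA -expr2 sqrr_sign; ring.
rewrite H !mulr_sumr; apply: eq_bigr => j _.
have -> : 'X^E * ((-1) ^+ (j + n) * 'X^(`|j%:Z - n%:Z| ^ 2) * qbin 'X^2 n.*2 j) =
    (-1) ^+ n * ((-1) ^+ j * ('X^E * 'X^(`|j%:Z - n%:Z| ^ 2)) * qbin ('X^2 : PF) n.*2 j).
  by rewrite exprD; ring.
rewrite -exprD; have -> : (E + `|j%:Z - n%:Z| ^ 2 = 2 * 'C(j, 2) + m.*2.+1 * (n.*2 - j))%N.
  by apply: gauss_exponent; rewrite -ltnS.
by rewrite exprD exprM exprM; ring.
Qed.

(** Differentiate the product of the 2n + 1 factors w - X^k at w = X^n: only the vanishing factor is
    differentiated. The terms n - k and n + 1 + k have the same q-binomial, and their weights n + k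
    + 1 and n - k combine to 2k + 1. *)
Lemma jacobi_finite n : qfact ('X^1 : PF) n ^+ 2 =
  \sum_(k < n.+1) (-1) ^+ k * (2 * k + 1)%:R * 'X^('C(k.+1, 2)) * qbin ('X^1 : PF) (n + n.+1) (n - k).
Proof.
have X0 e : ('X^e : PF) != 0 by rewrite -size_poly_gt0 size_polyXn.
pose N := (n + n.+1)%N; pose q := qfact ('X^1 : PF) n.
pose P : {poly PF} := \prod_(k < N) ('X - (('X^1)%:P) ^+ k).
have dP : P^`().['X^n] = (-1) ^+ n * 'X^('C(n, 2)) * q * ('X^(n * n) * q).
  rewrite /P big_split_ord /= [X in _ * X]big_ord_recl /= addn0.
  rewrite mulrCA derivM hornerD !hornerM.
  have -> : ('X - ('X^1)%:P ^+ n : {poly PF}).['X^n] = 0.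
    by rewrite !hornerE -exprM mul1n subrr.
  have -> : ('X - ('X^1)%:P ^+ n : {poly PF})^`() = 1.
    by rewrite -rmorphXn derivXsubC.
  rewrite mul0r addr0 hornerC mul1r !horner_prod; congr (_ * _).
    have -> : 'X^('C(n, 2)) = \prod_(i < n) 'X^i :> PF by rewrite (@prod_polyXn n id) -bin2_sum big_mkord.
    rewrite /q /qfact [X in _ = _ * _ * X](reindex_inj rev_ord_inj) /=.
    rewrite -[X in (-1) ^+ X](card_ord n) -prodr_const -!big_split /=; apply: eq_bigr => i _.
    rewrite subnSK // !hornerE -!exprM !mul1n.
    by rewrite -[X in 'X^X - _](subnKC (ltnW (ltn_ord i))) exprD; ring.
  rewrite /q /qfact exprM -[X in _ ^+ X * _](card_ord n) -prodr_const -big_split /=.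
  apply: eq_bigr => i _; rewrite !hornerE -!exprM !mul1n /=.
  by have -> : (n + (0 <= i) + i = n + i.+1)%N; [lia | rewrite exprD; ring].
pose c j : PF := (-1) ^+ j * 'X^('C(j, 2)) * qbin ('X^1 : PF) N j.
have HS : \prod_(k < N) ('X - (('X^1)%:P) ^+ k) = \sum_(j < N.+1) c j *: 'X^(N - j) :> {poly PF}.
  rewrite (qbin_rothe (('X^1)%:P : {poly PF}) N 'X); apply: eq_bigr => j _.
  have eX : ('X^('C(j, 2)))%:P = (('X^1)%:P : {poly PF}) ^+ 'C(j, 2).
    by rewrite -rmorphXn /= -exprM mul1n.
  by rewrite -mul_polyC /c !rmorphM rmorph_sign qbin_morph /= eX.
have NE : N.+1 = (n.+1 + n.+1)%N by rewrite /N; lia.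
have : P^`().['X^n] = \sum_(j < N.+1) c j * ((N - j)%:R * 'X^(n * (N - j).-1)).
  rewrite /P HS raddf_sum horner_sum; apply: eq_bigr => j _ /=.
  by rewrite derivZ derivXn hornerZ hornerMn hornerXn -exprM mulr_natl.
have split (t : nat -> PF) : \sum_(j < N.+1) t j =
    \sum_(k < n.+1) (t (n - k)%N + t (n.+1 + k)%N).
  by rewrite NE big_split_ord big_split (reindex_inj rev_ord_inj).
rewrite dP (split (fun j => c j * ((N - j)%:R * 'X^(n * (N - j).-1)))) => E.
have s0 m : (-1) ^+ m * (-1) ^+ m = 1 :> PF by rewrite -expr2 sqrr_sign.
apply: (mulfI (X0 ('C(n, 2) + n * n)%N)); rewrite exprD.
transitivity ((-1) ^+ n * ((-1) ^+ n * 'X^('C(n, 2)) * q * ('X^(n * n) * q))).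
  by rewrite mulrA -/q; have := s0 n; move: ((-1) ^+ n) => u uu; rewrite !mulrA uu; ring.
rewrite {}E !mulr_sumr; apply: eq_bigr => k _.
have kn : (k <= n)%N by rewrite -ltnS.
have cs : qbin ('X^1 : PF) N (n.+1 + k) = qbin 'X^1 N (n - k).
  rewrite -[RHS](@qbin_sym 1) //; last by rewrite /N; lia.
  by congr qbin; rewrite /N; lia.
have t1 : c (n - k)%N * ((N - (n - k))%:R * 'X^(n * (N - (n - k)).-1)) =
    (-1) ^+ n * (-1) ^+ k * ('X^('C(n, 2)) * 'X^(n * n) * 'X^('C(k.+1, 2))) *
    (qbin 'X^1 N (n - k) * (n + k.+1)%:R).
  have -> : (N - (n - k) = n + k.+1)%N by rewrite /N; lia.
  have -> : 'X^('C(n, 2)) * 'X^(n * n) * 'X^('C(k.+1, 2)) =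
      'X^('C(n - k, 2)) * 'X^(n * (n + k)) :> PF by rewrite -!exprD jacobi_exponent_low.
  rewrite addnS succnK /c.
  have -> : (-1) ^+ (n - k) = (-1) ^+ n * (-1) ^+ k :> PF.
    by rewrite -[X in (-1) ^+ X * _](subnK kn) exprD -mulrA s0 mulr1.
  by ring.
have t2 : c (n.+1 + k)%N * ((N - (n.+1 + k))%:R * 'X^(n * (N - (n.+1 + k)).-1)) =
    - ((-1) ^+ n * (-1) ^+ k * ('X^('C(n, 2)) * 'X^(n * n) * 'X^('C(k.+1, 2))) *
    (qbin 'X^1 N (n - k) * (n - k)%:R)).
  have -> : (N - (n.+1 + k) = n - k)%N by rewrite /N; lia.
  have [nk|kn'] := leqP n k.
    by have -> : (n - k = 0)%N; [lia | rewrite !(mul0r, mulr0) oppr0].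
  have -> : 'X^('C(n, 2)) * 'X^(n * n) * 'X^('C(k.+1, 2)) =
      'X^('C(n.+1 + k, 2)) * 'X^(n * (n - k.+1)) :> PF.
    by rewrite -!exprD jacobi_exponent_high.
  have -> : (-1) ^+ n * (-1) ^+ k = - (-1) ^+ (n.+1 + k) :> PF.
    by rewrite -exprD addSn exprS mulN1r opprK.
  by rewrite -subnS /c cs; ring.
rewrite t1 t2; have -> : (2 * k + 1)%:R = (n + k.+1)%:R - (n - k)%:R :> PF.
  by rewrite -natrB; [congr _%:R; lia | lia].
rewrite -!mulrBr; have := s0 n; move: ((-1) ^+ n) => u uu.
by rewrite !mulrA uu; ring.
Qed.

Definition eqX e (P P' : PF) := 'X^e %| (P - P').

Lemma eqX_refl e P : eqX e P P. Proof. by rewrite /eqX subrr dvdp0. Qed.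

Lemma eqX_sym e P P' : eqX e P P' -> eqX e P' P.
Proof. by rewrite /eqX -opprB dvdpNr. Qed.

Lemma eqX_trans e P1 P2 P3 : eqX e P1 P2 -> eqX e P2 P3 -> eqX e P1 P3.
Proof. by rewrite /eqX => h1 h2; rewrite -(subrK P2 P1) -addrA dvdp_add. Qed.

Lemma eqX_le e e' P P' : (e' <= e)%N -> eqX e P P' -> eqX e' P P'.
Proof. by move=> ee; apply: dvdp_trans; rewrite dvdp_exp2l. Qed.

Lemma eqXM e P1 P2 P3 P4 : eqX e P1 P2 -> eqX e P3 P4 -> eqX e (P1 * P3) (P2 * P4).
Proof.
rewrite /eqX => h1 h2.
have -> : P1 * P3 - P2 * P4 = (P1 - P2) * P3 + P2 * (P3 - P4) by rewrite mulrBl mulrBr subrKA.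
by apply: dvdp_add; [exact: dvdp_mulr | exact: dvdp_mull].
Qed.

Lemma eqX_sum e n (f g : nat -> PF) : (forall i, (i < n)%N -> eqX e (f i) (g i)) ->
  eqX e (\sum_(i < n) f i) (\sum_(i < n) g i).
Proof.
by move=> h; rewrite /eqX -sumrB; apply: (big_ind (fun P => _ %| P)) => [|P1 P2|i _]; [exact: dvdp0 | exact: dvdp_add | exact: h].
Qed.

Lemma eqX_shift e e' P P' : eqX e P P' -> eqX (e' + e) ('X^e' * P) ('X^e' * P').
Proof. by rewrite /eqX exprD -mulrBr => h; rewrite dvdp_mul. Qed.

Lemma eqX_cancel e A P P' : A.[0] = 1 -> eqX e (A * P) (A * P') -> eqX e P P'.
Proof.
move=> A1; rewrite /eqX -mulrBr Gauss_dvdpr // coprimep_expl // coprimep_sym.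
by rewrite -[ 'X]subr0 coprimep_XsubC /root A1 oner_eq0.
Qed.

Lemma eqX_comp e c P P' : (0 < c)%N -> eqX e P P' -> eqX (c * e) (P \Po 'X^c) (P' \Po 'X^c).
Proof.
move=> c0; rewrite /eqX => /dvdpP[q qE].
by rewrite -linearB /= qE comp_polyM comp_Xn_poly -exprM dvdp_mulIr.
Qed.

Lemma qfact_comp c n : qfact ('X^1 : PF) n \Po 'X^c = qfact 'X^c n.
Proof.
rewrite /qfact rmorph_prod; apply: eq_bigr => i _ /=.
by rewrite linearB /= -exprM mul1n comp_Xn_poly comp_polyC.
Qed.

Lemma qfact_eqX e a b : (a <= b)%N -> eqX (e * a.+1) (qfact ('X^e) b) (qfact 'X^e a).
Proof.
move=> ab; rewrite -(subnKC ab); elim: (b - a)%N => [|c IH]; first by rewrite addn0 eqX_refl.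
apply: eqX_trans IH; rewrite addnS qfactS /eqX mulrBr mulr1 addrAC subrr add0r -exprM.
by rewrite dvdpNr dvdp_mull // dvdp_exp2l // leq_mul2l ltnS leq_addr orbT.
Qed.

(** [qbin_fact] writes the q-binomial as a quotient of q-factorials, all of which agree with
    [qfact 'X^e a] to this order. *)
Lemma qbin_eqX e n N j a : (0 < e)%N -> (a <= n)%N -> (a <= j)%N -> (a <= N - j)%N -> (j <= N)%N ->
  eqX (e * a.+1) (qfact 'X^e n * qbin 'X^e N j) 1.
Proof.
move=> e0 an aj aNj jN; pose qa := qfact ('X^e : PF) a.
have qa0 : qa.[0] = 1 by exact: qfact_horner0.
have aN : (a <= N)%N by exact: leq_trans aj jN.
apply: (@eqX_trans _ _ (qa * qbin 'X^e N j)); first by apply: eqXM; rewrite ?eqX_refl ?qfact_eqX.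
apply: (eqX_cancel qa0); rewrite mulr1.
apply: (@eqX_trans _ _ (qfact 'X^e N)); last exact: qfact_eqX.
rewrite -(qbin_fact _ jN).
have -> : qa * (qa * qbin 'X^e N j) = qbin 'X^e N j * (qa * qa) by ring.
apply: eqXM; first exact: eqX_refl.
by apply: eqXM; apply: eqX_sym; exact: qfact_eqX.
Qed.

Lemma qfact_double n : qfact ('X^1 : PF) n.*2 =
  \prod_(k < n) (1 - 'X^(k.*2.+1)) * qfact ('X^2) n.
Proof.
elim: n => [|n IH]; first by rewrite !qfact0 big_ord0 mulr1.
rewrite doubleS !qfactS IH big_ord_recr /= -!exprM !mul1n mul2n doubleS; ring.
Qed.

Definition theta_poly n : PF := \sum_(i < n.+1) (theta_weight i)%:~R * 'X^(i ^ 2).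
Definition jacobi_poly n : PF := \sum_(k < n.+1) (jacobi_weight k)%:~R * 'X^('C(k.+1, 2)).

Lemma theta_eqX n : eqX n.*2.+1 (qfact 'X^1 n.*2 ^+ 2) (qfact 'X^2 n * theta_poly n).
Proof.
rewrite qfact_double; set G := \prod_(k < n) _; set H := qfact _ n.
have -> : (G * H) ^+ 2 = H * (H * G ^+ 2) by ring.
apply: eqXM; first exact: eqX_refl.
rewrite gauss_finite mulr_sumr.
have -> : theta_poly n = \sum_(j < n.*2.+1) (-1) ^+ (j + n) * 'X^(`|j%:Z - n%:Z| ^ 2).
  have -> : \sum_(j < n.*2.+1) (-1) ^+ (j + n) * 'X^(`|j%:Z - n%:Z| ^ 2) =
    \sum_(j < n) (-1) ^+ j.+1 * 'X^(j.+1 ^ 2) + \sum_(j < n.+1) (-1) ^+ j * 'X^(j ^ 2) :> PF.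
    have nE : n.*2.+1 = (n + n.+1)%N by rewrite -addnn addnS.
    have split (t : nat -> PF) : \sum_(j < n.*2.+1) t j = \sum_(j < n) t j + \sum_(j < n.+1) t (n + j)%N.
      by rewrite nE big_split_ord.
    rewrite (split (fun j => (-1) ^+ (j + n) * 'X^(`|j%:Z - n%:Z| ^ 2))); congr (_ + _).
      rewrite (reindex_inj rev_ord_inj) /=; apply: eq_bigr => j _.
      have jn : (j < n)%N by [].
      congr (_ * 'X^(_ ^ 2)); last by rewrite distnEr ?leq_subr // subKn.
      rewrite -signr_odd -[RHS]signr_odd oddD oddB // addbAC addbb //.
    apply: eq_bigr => j _; rewrite distnEl ?leq_addr // addKn.
    by rewrite addnAC exprD -signr_odd addnn odd_double mul1r.
  rewrite /theta_poly big_ord_recl [X in _ = _ + X]big_ord_recl /= addrCA; congr (_ + _).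
  rewrite -big_split /=; apply: eq_bigr => j _.
  by rewrite /theta_weight /bump add1n /= intrM rmorph_sign; ring.
apply: (@eqX_sum _ _ (fun j => H * ((-1) ^+ (j + n) * 'X^(`|j%:Z - n%:Z| ^ 2) * qbin 'X^2 n.*2 j))
  (fun j => (-1) ^+ (j + n) * 'X^(`|j%:Z - n%:Z| ^ 2))) => j; rewrite ltnS => jn.
rewrite -mulrA mulrCA -{2}['X^_]mulr1; apply: eqXM; first exact: eqX_refl.
rewrite mulrCA; have [jn'|jn'] := leqP j n.
  apply: (eqX_le _ (eqX_shift _ (@qbin_eqX 2 n n.*2 j j _ _ _ _ _))) => //; last by rewrite -addnn; lia.
  (* With i = n - j, the inequality i^2 + 2 (n - i + 1) >= 2n + 1 is (i - 1)^2 >= 0. *)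
  by rewrite distnEr // -mulnn -!muln2; move: (subnKC jn'); move: (n - j)%N => i <-; nia.
apply: (eqX_le _ (eqX_shift _ (@qbin_eqX 2 n n.*2 j (n.*2 - j) _ _ _ _ _))) => //; rewrite -?addnn; try lia.
by rewrite distnEl ?(ltnW jn') // -mulnn; rewrite -addnn in jn; nia.
Qed.

Lemma jacobi_eqX n : eqX n.+1 (qfact 'X^1 n ^+ 3) (jacobi_poly n).
Proof.
rewrite exprS jacobi_finite mulr_sumr /jacobi_poly.
apply: (@eqX_sum _ _ (fun k => qfact 'X^1 n * ((-1) ^+ k * (2 * k + 1)%:R * 'X^('C(k.+1, 2)) * qbin 'X^1 (n + n.+1) (n - k)))
  (fun k => (jacobi_weight k)%:~R * 'X^('C(k.+1, 2)))) => k; rewrite ltnS => kn.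
rewrite /jacobi_weight intrM rmorph_sign -pmulrn -[X in eqX _ (_ * X)]mulrA mulrCA.
apply: eqXM; first exact: eqX_refl.
rewrite mulrCA -{2}['X^_]mulr1.
apply: (eqX_le _ (eqX_shift _ (@qbin_eqX 1 n (n + n.+1) (n - k) (n - k) _ _ _ _ _))) => //; try lia.
by rewrite binS bin1; lia.
Qed.

Definition eta_poly n : PF := 'X * (qfact 'X^4 n ^+ 2 * qfact 'X^8 n ^+ 2).

Lemma coef_eta_poly n p : (p <= 8 * n + 4)%N ->
  (eta_poly n.*2)`_p = (theta_jacobi n.+1 p)%:~R.
Proof.
move=> pn.
(* 8n + 4 = 4 (2n + 1) is the precision of [theta_eqX] after X -> X^4, and the products have 2n
   factors because that lemma concerns [qfact 'X^1 n.*2]. *)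
have E : eqX (8 * n + 4) (qfact 'X^4 n.*2 ^+ 2 * qfact 'X^8 n.*2 ^+ 2)
    ((theta_poly n \Po 'X^4) * (jacobi_poly n \Po 'X^8)).
  have h1 : eqX (8 * n + 4) (qfact 'X^4 n.*2 ^+ 2) (qfact 'X^8 n * (theta_poly n \Po 'X^4)).
    have := @eqX_comp _ 4 _ _ isT (theta_eqX n).
    rewrite (comp_polyM (qfact 'X^2 n)) !rmorphXn /= qfact_comp -(qfact_comp 2) -comp_polyA comp_Xn_poly -exprM qfact_comp.
    by apply: eqX_le; rewrite -addnn; lia.
  have h2 : eqX (8 * n + 4) (qfact 'X^8 n.*2 ^+ 2) (qfact 'X^8 n ^+ 2).
    have h : eqX (8 * n + 4) (qfact 'X^8 n.*2) (qfact 'X^8 n).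
      by apply: (eqX_le _ (@qfact_eqX 8 n n.*2 _)); rewrite -?addnn; lia.
    by rewrite !expr2; apply: eqXM.
  have h3 : eqX (8 * n + 4) (qfact 'X^8 n ^+ 3) (jacobi_poly n \Po 'X^8).
    have := @eqX_comp _ 8 _ _ isT (jacobi_eqX n); rewrite !rmorphXn /= qfact_comp.
    by apply: eqX_le; lia.
  apply: eqX_trans (eqXM h1 h2) _; rewrite mulrAC -exprS mulrC.
  by apply: eqXM h3; exact: eqX_refl.
rewrite /eta_poly coefXM; case: p pn => [_|p pn] /=.
  by rewrite /theta_jacobi big1 // => j _; rewrite big1 // => k _; rewrite addn_eq0 addn1 andbF.
have -> : (qfact 'X^4 n.*2 ^+ 2 * qfact 'X^8 n.*2 ^+ 2)`_p =
  ((theta_poly n \Po 'X^4) * (jacobi_poly n \Po 'X^8))`_p.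
  have /dvdpP[q qE] := E; apply/eqP; rewrite -subr_eq0 -coefB qE coefMXn.
  by rewrite pn.
have -> : theta_poly n \Po 'X^4 = \sum_(i < n.+1) (theta_weight i)%:~R * 'X^(4 * i ^ 2).
  rewrite /theta_poly rmorph_sum; apply: eq_bigr => i _ /=.
  by rewrite rmorphM rmorph_int /= comp_Xn_poly -exprM.
have -> : jacobi_poly n \Po 'X^8 = \sum_(k < n.+1) (jacobi_weight k)%:~R * 'X^(8 * 'C(k.+1, 2)).
  rewrite /jacobi_poly rmorph_sum; apply: eq_bigr => k _ /=.
  by rewrite rmorphM rmorph_int /= comp_Xn_poly -exprM.
rewrite mulr_suml coef_sum /theta_jacobi rmorph_sum; apply: eq_bigr => i _ /=.
rewrite mulr_sumr coef_sum rmorph_sum; apply: eq_bigr => k _ /=.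
rewrite mulrACA -exprD -rmorphM /= mulrzl -scaler_int coefZ coefXn.
(* (2k + 1)^2 is 1 plus 8 times the binomial of k + 1 over 2, the 1 being the leading factor X of
   [eta_poly]. *)
have -> : ((4 * i ^ 2 + (2 * k + 1) ^ 2 == p.+1) = (p == 4 * i ^ 2 + 8 * 'C(k.+1, 2)))%N.
  have c2 := double_bin2 k.+1; rewrite -!mulnn; apply/eqP/eqP; nia.
by case: eqP => _; rewrite ?mulr1 // mulr0.
Qed.

End ThetaPolynomials.

(** * Analytic expansion of the eta product *)

Section SmallPolynomial.
Context (F : numFieldType).
Implicit Types (P : {poly F}) (q K : F).

Lemma horner_norm_le P q : 0 <= q -> q <= 1 -> `|P.[q]| <= \sum_(i < size P) `|P`_i|.
Proof.
move=> q0 q1; rewrite horner_coef; apply: le_trans (ler_norm_sum _ _ _) _.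
apply: ler_sum => i _; rewrite normrM normrX (ger0_norm q0).
by rewrite ler_piMr ?exprn_ile1.
Qed.

Lemma coef0_small_poly P K m : 0 <= K ->
  (forall q, 0 < q -> q <= 1 / 4%:R -> `|P.[q]| <= K * q ^+ m.+1) -> P`_0 = 0.
Proof.
move=> K0 h; apply/eqP/negP => /negP c0.
pose P1 := drop_poly 1 P; pose B := \sum_(i < size P1) `|P1`_i|.
have B0 : 0 <= B by apply: sumr_ge0.
have PE : P = (P`_0)%:P + P1 * 'X.
  rewrite -[LHS](poly_take_drop 1) expr1; congr (_ + _).
  by apply/polyP => -[|i]; rewrite coef_take_poly coefC.
pose c := `|P`_0|; have cp : 0 < c by rewrite normr_gt0.
(* D >= c gives q <= 1/4, and D > K + B gives (K + B) q < c, against the bound c <= (K + B) q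
   derived below. *)
pose D := K + B + c + 1.
have D0 : 0 < D by rewrite ltr_wpDl // !addr_ge0 // ltW.
pose q := c / (4%:R * D).
have q0 : 0 < q by rewrite divr_gt0 // mulr_gt0.
have cD : c <= D by rewrite /D addrAC lerDr !addr_ge0.
have q4 : q <= 1 / 4%:R.
  by rewrite /q invfM mulrCA mulrC ler_pM2r ?invr_gt0 // ler_pdivrMr // mul1r.
have q1 : q <= 1 by apply: le_trans q4 _; rewrite ler_pdivrMr // mul1r ler1n.
have : c <= (K + B) * q.
  have -> : c = `|P.[q] - P1.[q] * q|.
    by rewrite [in P.[q]]PE hornerD hornerC hornerM hornerX addrK.
  apply: le_trans (ler_normB _ _) _; rewrite mulrDl lerD //.
    apply: le_trans (h q q0 q4) _; rewrite exprS ler_wpM2l // ler_piMr ?(ltW q0) //.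
    by rewrite exprn_ile1 // ltW.
  by rewrite normrM (gtr0_norm q0) ler_wpM2r ?horner_norm_le // ltW.
rewrite lt_geF // /q mulrA ltr_pdivrMr ?mulr_gt0 // mulrC ltr_pM2l //.
have KD : K + B < D by rewrite /D -addrA ltrDl ltr_wpDl // ltW.
by apply: lt_trans KD _; rewrite ltr_pMl // ltr1n.
Qed.

Lemma coef_small_poly P K m : 0 <= K ->
  (forall q, 0 < q -> q <= 1 / 4%:R -> `|P.[q]| <= K * q ^+ m) ->
  forall i, (i < m)%N -> P`_i = 0.
Proof.
elim: m P => // m IH P K0 h [_|i]; first exact: coef0_small_poly K0 h.
rewrite ltnS => im; rewrite -(addn1 i) -coef_drop_poly; apply: IH im => // q q0 q4.
rewrite -(ler_pM2r q0) -mulrA -exprSr; apply: le_trans (h q q0 q4).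
rewrite -{2}(poly_take_drop 1 P) expr1.
have -> : take_poly 1 P = 0.
  by apply/polyP => -[|j]; rewrite coef_take_poly coef0 // (coef0_small_poly K0 h).
by rewrite add0r hornerM hornerX normrM (gtr0_norm q0).
Qed.

End SmallPolynomial.

Import numFieldNormedType.Exports.

(** * Euler products at real points *)

Section EulerProduct.
Local Open Scope classical_set_scope.
Local Open Scope ring_scope.
Context (R : realType).
Implicit Types (x : R) (n m k : nat).

Lemma qfact_unit x n : 0 <= x -> x <= 1 -> 0 <= qfact x n <= 1.
Proof.
move=> x0 x1; apply/andP; split.
  by apply: prodr_ge0 => i _; rewrite subr_ge0 exprn_ile1.
by apply: prodr_ile1 => i _; rewrite subr_ge0 exprn_ile1 //= gerBl exprn_ge0.
Qed.

Lemma qfact_noninc x n k : 0 <= x -> x <= 1 -> qfact x (n + k) <= qfact x n.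
Proof.
move=> x0 x1; elim: k => [|k IH]; first by rewrite addn0.
apply: le_trans IH; rewrite addnS qfactS ler_piMr //; first by case/andP: (qfact_unit (n + k) x0 x1).
by rewrite gerBl exprn_ge0.
Qed.

Lemma qfact_tail x n k : 0 <= x -> x <= 1 / 2%:R ->
  qfact x n - 2%:R * x ^+ n.+1 <= qfact x (n + k).
Proof.
move=> x0 x2; have x1 : x <= 1 by lra.
(* Strengthened for the induction: with y = x^(n + k + 1), the new factor loses at most y, and 2y -
   2xy >= y because x <= 1/2. *)
suff : qfact x n - 2%:R * x ^+ n.+1 + 2%:R * x ^+ (n + k).+1 <= qfact x (n + k).
  by apply: le_trans; rewrite lerDl mulr_ge0 // exprn_ge0.
elim: k => [|k IH]; first by rewrite addn0 subrK.
rewrite addnS qfactS mulrBr mulr1 [x ^+ (n + k).+2]exprS.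
set y := x ^+ (n + k).+1 in IH *; have y0 : 0 <= y by rewrite exprn_ge0.
have /andP[_ Q1] := qfact_unit (n + k) x0 x1.
have Qy : qfact x (n + k) * y <= y by rewrite ler_piMl.
have xy : x * y <= 1 / 2%:R * y by rewrite ler_wpM2r.
by lra.
Qed.

Definition euler_prod x : R := lim (qfact x n @[n --> \oo]).

Lemma cvg_euler_prod x : 0 <= x -> x <= 1 -> qfact x n @[n --> \oo] --> euler_prod x.
Proof.
move=> x0 x1; apply: nonincreasing_is_cvgn.
  by move=> n m nm; rewrite -(subnKC nm) qfact_noninc.
by exists 0 => _ [n _ <-]; case/andP: (qfact_unit n x0 x1).
Qed.

Lemma euler_prod_approx x n : 0 <= x -> x <= 1 / 2%:R ->
  qfact x n - 2%:R * x ^+ n.+1 <= euler_prod x <= qfact x n.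
Proof.
move=> x0 x2; have x1 : x <= 1 by lra.
have c := cvg_euler_prod x0 x1; apply/andP; split.
  apply: limr_ge; first exact: c.
  by exists n => // m /= nm; rewrite -(subnKC nm) qfact_tail.
apply: limr_le; first exact: c.
by exists n => // m /= nm; rewrite -(subnKC nm) qfact_noninc.
Qed.

Lemma euler_prod_ge0 x : 0 <= x -> x <= 1 -> 0 <= euler_prod x.
Proof.
move=> x0 x1; apply: limr_ge; first exact: cvg_euler_prod.
by apply: nearW => n; case/andP: (qfact_unit n x0 x1).
Qed.

End EulerProduct.

(** * The eta product on the imaginary axis *)

Section EtaExpansion.
Local Open Scope classical_set_scope.
Local Open Scope ring_scope.
Context (R : realType).
Local Notation C := (cplx R).

Definition toC : R -> C := real_complex R.

HB.instance Definition _ := GRing.RMorphism.copy toC (real_complex R).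

Lemma le_toC (x y : R) : (toC x <= toC y) = (x <= y).
Proof. exact: lecR. Qed.

Lemma lt_toC (x y : R) : (toC x < toC y) = (x < y).
Proof. exact: ltcR. Qed.

Lemma norm_toC (x : R) : `|toC x| = toC `|x|.
Proof. by rewrite [LHS]normc_def /= expr0n addr0 sqrtr_sqr. Qed.

Lemma gt0_toC (z : C) : 0 < z -> exists2 x : R, 0 < x & z = toC x.
Proof.
move=> z0; have /complex_realP[x xE] := gtr0_real z0.
by exists x; rewrite ?xE // -lt_toC rmorph0 -[toC x]xE.
Qed.

Lemma cvg_toC (u : nat -> R) (l : R) :
  u n @[n --> \oo] --> l -> toC (u n) @[n --> \oo] --> toC l.
Proof.
move=> ul; apply/cvgrPdist_lt => e /gt0_toC[d d0 ->].
move/cvgrPdist_lt: ul => /(_ d d0); apply: filterS => n /=.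
by rewrite -rmorphB norm_toC lt_toC.
Qed.

Variable q : R.
Hypotheses (q0 : 0 < q) (q1 : q < 1).

(** The point z of the imaginary axis with exp (2 pi i z) = q. *)
Definition eta_point : C := 'i * toC (- ln q / (2%:R * pi)).

Lemma expi2pi_eta_point (s : R) : expi2pi (toC s * eta_point) = toC (expR (s * ln q)).
Proof.
have -> : expi2pi (toC s * eta_point) = cexp (toC (s * ln q)).
  congr cexp; rewrite /eta_point -[Complex pi 0]/(toC pi).
  have -> : 2%:R = toC 2%:R :> C by rewrite rmorph_nat.
  have alg (a b c d I : C) : a * b * I * (c * (I * d)) = I ^+ 2 * (a * b * c * d) by ring.
  rewrite alg sqrCi mulN1r -!rmorphM -rmorphN /=; congr toC.
  have : pi != 0 :> R by rewrite gt_eqF // pi_gt0.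
  by move: pi (ln q) => v l v0; field.
by rewrite /cexp /= cos0 sin0 mulr1 mulr0.
Qed.

Lemma expi2pi_nat (n : nat) : expi2pi (n%:R * eta_point) = toC (q ^+ n).
Proof. by rewrite -(rmorph_nat toC) expi2pi_eta_point mulrC expRM_natr lnK. Qed.

Lemma Im_eta_point : 0 < 'Im eta_point.
Proof.
have w0 : 0 < - ln q / (2%:R * pi).
  by rewrite divr_gt0 ?mulr_gt0 ?pi_gt0 // oppr_gt0; apply: ln_lt0; rewrite q0.
have w0' : 0 < toC (- ln q / (2%:R * pi)) by rewrite -(rmorph0 toC) lt_toC.
by rewrite /eta_point mulrC ImMl ?gtr0_real // Im_i mulr1.
Qed.

Lemma eta_eta_point (m : nat) : (0 < m)%N ->
  dedekind_eta (m%:R * eta_point) = toC (expR (m%:R / 24%:R * ln q) * euler_prod (q ^+ m)).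
Proof.
move=> m0; rewrite /dedekind_eta rmorphM /=; congr (_ * _).
  rewrite -expi2pi_eta_point; congr expi2pi.
  by rewrite rmorphM /= fmorphV !rmorph_nat mulrAC.
apply: (@cvg_lim C); first exact: norm_hausdorff.
rewrite -cvg_shiftS.
have -> : (fun n => \prod_(1 <= k < n.+1) (1 - expi2pi (k%:R * (m%:R * eta_point)))) =
    (fun n => toC (qfact (q ^+ m) n)).
  apply/funext => n; rewrite big_add1 big_mkord rmorph_prod; apply: eq_bigr => k _ /=.
  by rewrite mulrA -natrM expi2pi_nat rmorphB rmorph1 mulnC exprM.
apply: cvg_toC; apply: cvg_euler_prod; first by rewrite exprn_ge0 // ltW.
by rewrite exprn_ile1 ?ltW.
Qed.

Lemma f_32_2_a_a_eta_point : f_32_2_a_a eta_point =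
  toC (q * (euler_prod (q ^+ 4) ^+ 2 * euler_prod (q ^+ 8) ^+ 2)).
Proof.
rewrite /f_32_2_a_a !eta_eta_point // -!rmorphXn -rmorphM /=; congr toC.
rewrite !exprMn mulrACA; congr (_ * _).
(* The exponents 2 * 4/24 and 2 * 8/24 add up to 1. *)
by rewrite -!expRM_natr -expRD -{3}[q](lnK q0); congr expR; field.
Qed.

End EtaExpansion.

Lemma horner_qfact (F : fieldType) e n (x : F) : (qfact ('X^e) n).[x] = qfact (x ^+ e) n.
Proof. by rewrite horner_prod; apply: eq_bigr => i _; rewrite !hornerE. Qed.

Lemma qfact_morph (A B : idomainType) (f : {rmorphism A -> B}) x n : f (qfact x n) = qfact (f x) n.
Proof. by rewrite rmorph_prod; apply: eq_bigr => i _; rewrite rmorphB rmorph1 rmorphXn. Qed.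

(** * Recovering the coefficients from the expansion *)

Section QExpansion.
Local Open Scope classical_set_scope.
Local Open Scope ring_scope.
Context (R : realType).
Local Notation C := (cplx R).
Local Notation toC := (@toC R).

Lemma euler_prod_square_approx (A B P Q d : R) :
  0 <= A -> 0 <= B -> P <= 1 -> Q <= 1 -> P - d <= A <= P -> Q - d <= B <= Q ->
  0 <= P ^+ 2 * Q ^+ 2 - A ^+ 2 * B ^+ 2 <= 4%:R * d.
Proof.
move=> A0 B0 P1 Q1 /andP[PA AP] /andP[QB BQ].
have P0 := le_trans A0 AP; have Q0 := le_trans B0 BQ.
have s1 : 0 <= (P ^+ 2 - A ^+ 2) <= 2%:R * d by apply/andP; split; nra.
have s2 : 0 <= (Q ^+ 2 - B ^+ 2) <= 2%:R * d by apply/andP; split; nra.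
have A2 : 0 <= A ^+ 2 <= 1 by apply/andP; split; nra.
have Q2 : 0 <= Q ^+ 2 <= 1 by apply/andP; split; nra.
have -> : P ^+ 2 * Q ^+ 2 - A ^+ 2 * B ^+ 2 =
  (P ^+ 2 - A ^+ 2) * Q ^+ 2 + A ^+ 2 * (Q ^+ 2 - B ^+ 2) by ring.
move: (P ^+ 2 - A ^+ 2) (Q ^+ 2 - B ^+ 2) (A ^+ 2) (Q ^+ 2) s1 s2 A2 Q2 => u v w t.
by move=> /andP[? ?] /andP[? ?] /andP[? ?] /andP[? ?]; apply/andP; split; nra.
Qed.

(** 8 = 4 * 2: each Euler product is approximated within 2 q^(M + 1), and [euler_prod_square_approx]
    costs a factor 4. *)
Lemma f_32_2_a_a_approx (q : R) M : 0 < q -> q <= 1 / 4%:R ->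
  `|f_32_2_a_a (eta_point q) - (eta_poly C M).[toC q]| <= toC (8%:R * q ^+ M.+1).
Proof.
move=> q0 q4; have q1 : q < 1 by lra.
have small e : (0 < e)%N -> q ^+ e <= q by move=> e0; rewrite ler_iXnr // ltW.
have ge e : 0 <= q ^+ e by rewrite exprn_ge0 // ltW.
have half e : (0 < e)%N -> q ^+ e <= 1 / 2%:R by move=> /small h; apply: le_trans h _; lra.
have le1 e : q ^+ e <= 1 by rewrite exprn_ile1 // ltW.
have approx e : (0 < e)%N -> qfact (q ^+ e) M - 2%:R * q ^+ M.+1 <= euler_prod (q ^+ e) <= qfact (q ^+ e) M.
  move=> e0; have /andP[h1 ->] := euler_prod_approx M (ge e) (half e e0).
  rewrite andbT; apply: le_trans h1; rewrite lerB // ler_pM2l //.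
  by rewrite lerXn2r ?nnegrE ?small // ltW.
have qf1 e : qfact (q ^+ e) M <= 1 by case/andP: (qfact_unit M (ge e) (le1 e)).
have := euler_prod_square_approx (euler_prod_ge0 (ge 4) (le1 4)) (euler_prod_ge0 (ge 8) (le1 8))
  (qf1 4) (qf1 8) (approx 4 isT) (approx 8 isT).
set D := _ - _ => /andP[D0 D8].
rewrite f_32_2_a_a_eta_point // /eta_poly hornerM hornerX hornerM !horner_exp !horner_qfact.
rewrite -!rmorphXn -!(qfact_morph toC) -!rmorphXn -!rmorphM -rmorphB norm_toC le_toC.
rewrite -mulrBr -normrN -mulrN opprB -/D normrM gtr0_norm // ger0_norm //.
apply: le_trans (_ : 1 * D <= _); first by rewrite ler_wpM2r // ltW.
by rewrite mul1r; apply: le_trans D8 _; rewrite mulrA -natrM.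
Qed.

Lemma geometric_tail (x : R) m k : 0 <= x -> x <= 1 / 2%:R ->
  \sum_(m <= n < m + k) x ^+ n <= 2%:R * x ^+ m.
Proof.
move=> x0 x2; suff : \sum_(m <= n < m + k) x ^+ n + 2%:R * x ^+ (m + k) <= 2%:R * x ^+ m.
  by apply: le_trans; rewrite lerDl mulr_ge0 // exprn_ge0.
elim: k => [|k IH]; first by rewrite addn0 big_geq // add0r.
apply: le_trans IH; rewrite addnS big_nat_recr ?leq_addr //= exprS.
have y0 : 0 <= x ^+ (m + k) by rewrite exprn_ge0.
have xy : x * x ^+ (m + k) <= 1 / 2%:R * x ^+ (m + k) by rewrite ler_wpM2r.
by lra.
Qed.

Variable a : nat -> C.
Hypothesis ha : is_q_expansion a (@f_32_2_a_a R).

Let S q N : C := \sum_(1 <= n < N) a n * toC (q ^+ n).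

Let cvgS q : 0 < q -> q < 1 -> S q N @[N --> \oo] --> f_32_2_a_a (eta_point q).
Proof.
move=> q0 q1; have := ha (Im_eta_point q0 q1).
rewrite (_ : (fun N => \sum_(1 <= n < N) a n * expi2pi (n%:R * eta_point q)) = S q) //.
by apply/funext => N; apply: eq_bigr => n _; rewrite expi2pi_nat.
Qed.

Let S_near q (e : R) m : 0 < q -> q < 1 -> 0 < e ->
  exists2 N, (m <= N)%N & forall n, (N <= n)%N -> `|f_32_2_a_a (eta_point q) - S q n| < toC e.
Proof.
move=> q0 q1 e0; have /cvgrPdist_lt /(_ (toC e)) := cvgS q0 q1.
rewrite -(rmorph0 toC) lt_toC => /(_ e0)[N _ hN].
by exists (maxn m N); [exact: leq_maxl | move=> n; rewrite geq_max => /andP[_ /hN]].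
Qed.

(** Convergence at q = 1/2 bounds the terms a_n / 2^n: by 2 from some N on, and by a finite sum
    before. *)
Lemma q_expansion_coef_bound : exists2 K : R, 0 <= K & forall n, `|a n| <= toC (K * 2%:R ^+ n).
Proof.
have h0 : 0 < (1 / 2%:R : R) by lra.
have h1 : (1 / 2%:R : R) < 1 by lra.
have [N N1 hN] := S_near 1 h0 h1 ltr01.
have big n : (N <= n)%N -> `|a n| <= toC (2%:R * 2%:R ^+ n).
  move=> Nn; have hS : S (1 / 2%:R) n.+1 - S (1 / 2%:R) n = a n * toC ((1 / 2%:R) ^+ n).
    by rewrite /S big_nat_recr /= ?(leq_trans N1) // addrAC subrr add0r.
  have : `|a n * toC ((1 / 2%:R) ^+ n)| <= toC 2%:R.
    rewrite -hS -[X in `|X - _|](subrK (f_32_2_a_a (eta_point (1 / 2%:R)))) -addrA.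
    apply: le_trans (ler_normD _ _) _; rewrite [2%:R](natrD _ 1 1) rmorphD /= lerD //.
      by rewrite -normrN opprB ltW // hN // leqW.
    by rewrite ltW // hN.
  rewrite normrM norm_toC (ger0_norm (exprn_ge0 n (ltW h0))) div1r exprVn fmorphV.
  by rewrite ler_pdivrMr ?rmorphM // -(rmorph0 toC) lt_toC exprn_gt0.
have real n : exists x : R, `|a n| = toC x.
  by have /complex_realP[x xE] := normr_real (a n); exists x.
pose r n : R := complex.Re `|a n|.
have rE n : `|a n| = toC (r n) by have [x xE] := real n; rewrite /r xE.
have r0 n : 0 <= r n by rewrite -le_toC -rE rmorph0.
have s0 : 0 <= \sum_(i < N) r i by apply: sumr_ge0.
exists (2%:R + \sum_(i < N) r i) => [|n]; first by rewrite addr_ge0.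
have p1 : 1 <= 2%:R ^+ n :> R by rewrite exprn_ege1 // ler1n.
case: (leqP N n) => [/big|nN].
  by move/le_trans; apply; rewrite le_toC ler_wpM2r ?lerDl // exprn_ge0.
rewrite rE le_toC; apply: le_trans (_ : \sum_(i < N) r i * 1 <= _); last first.
  rewrite -mulr_suml; by apply: ler_pM; rewrite ?lerDr.
by rewrite (bigD1 (Ordinal nN)) //= mulr1 lerDl sumr_ge0 // => i _; rewrite mulr1.
Qed.

(** q <= 1/4 makes 2q <= 1/2, so [q_expansion_coef_bound] gives a geometric tail. The summand 1 in K
    pays for stopping at a partial sum within q^(M + 1) of the value. *)
Lemma q_expansion_tail M : exists2 K : R, 0 <= K & forall q : R, 0 < q -> q <= 1 / 4%:R ->
  `|f_32_2_a_a (eta_point q) - S q M.+1| <= toC (K * q ^+ M.+1).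
Proof.
have [K K0 hK] := q_expansion_coef_bound.
exists (1 + K * 2%:R * 2%:R ^+ M.+1) => [|q q0 q4]; first by rewrite addr_ge0 ?mulr_ge0 ?exprn_ge0.
have q1 : q < 1 by lra.
have [N MN hN] := S_near M.+1 q0 q1 (exprn_gt0 M.+1 q0).
rewrite -(subrKA (S q N)); apply: le_trans (ler_normD _ _) _.
rewrite mulrDl mul1r rmorphD /= lerD // ?(ltW (hN N (leqnn N))) //.
have -> : S q N - S q M.+1 = \sum_(M.+1 <= n < N) a n * toC (q ^+ n).
  by rewrite /S (@big_cat_nat _ _ _ M.+1) //= addrAC subrr add0r.
apply: le_trans (ler_norm_sum _ _ _) _.
apply: le_trans (_ : toC (K * \sum_(M.+1 <= n < N) (2%:R * q) ^+ n) <= _).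
  rewrite mulr_sumr rmorph_sum; apply: ler_sum => n _ /=.
  rewrite normrM norm_toC (ger0_norm (exprn_ge0 n (ltW q0))) exprMn mulrA rmorphM /=.
  by rewrite ler_wpM2r // -(rmorph0 toC) le_toC exprn_ge0 // ltW.
rewrite le_toC -!mulrA ler_wpM2l // -exprMn -(subnKC MN).
by apply: geometric_tail; [rewrite mulr_ge0 // ltW | lra].
Qed.

(** The difference of the two polynomials of degree-M precision is O(q^(M + 1)) for small positive
    q, so its coefficients up to degree M vanish. *)
Theorem q_expansion_coef M p : (0 < p <= M)%N -> a p = (eta_poly C M)`_p.
Proof.
move=> /andP[p0 pM]; have [K K0 hK] := q_expansion_tail M.
pose P : {poly C} := \poly_(n < M.+1) (if n == 0%N then 0 else a n) - eta_poly C M.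
have : P`_p = 0.
  apply: (@coef_small_poly _ P (toC (K + 8%:R)) M.+1) => // [|_ /gt0_toC[q q0 ->] q4].
    by rewrite -(rmorph0 toC) le_toC addr_ge0.
  have {}q4 : q <= 1 / 4%:R by rewrite -le_toC rmorphM rmorph1 fmorphV rmorph_nat.
  have -> : P.[toC q] = S q M.+1 - (eta_poly C M).[toC q].
    rewrite hornerD hornerN; congr (_ - _).
    rewrite horner_poly big_ord_recl mul0r add0r /S big_add1 big_mkord.
    by apply: eq_bigr => n _; rewrite /= rmorphXn.
  rewrite -(subrKA (f_32_2_a_a (eta_point q))) -rmorphXn -rmorphM mulrDl rmorphD /=.
  apply: le_trans (ler_normD _ _) _; rewrite lerD ?f_32_2_a_a_approx //.
  by rewrite -normrN opprB hK.
rewrite coefB coef_poly ltnS pM gtn_eqF // => /eqP.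
by rewrite subr_eq0 => /eqP.
Qed.

End QExpansion.

Unset Implicit Arguments.

(** The two sides lie in different fields, the p-adic numbers and the complex numbers; the integer
    [c] is what allows them to be compared. *)
Theorem corollary5p6 (R : realType) (a : nat -> cplx R)
    (ha : is_q_expansion a (@f_32_2_a_a R))
    (p : nat) (pp : prime p) (p_odd : odd p) :
  exists2 c : int, a p = c%:~R &
    hypergeomG pp [tuple 1 / 4%:R; 3%:R / 4%:R; 1 / 4%:R; 3%:R / 4%:R]
                  [tuple 1; 1 / 2%:R; 1; 1 / 2%:R] 1
    = (quad_char (-1 : 'F_p) + c)%:~R.
Proof.
(* [coef_eta_poly] is used with n = p, hence the bound [p.+1] here and the truncation at [p.*2]
   factors. *)
exists (theta_jacobi p.+1 p).
  rewrite (@q_expansion_coef _ a ha p.*2 p); first by rewrite coef_eta_poly // mulSn -addnA leq_addr.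
  by rewrite (prime_gt0 pp) -addnn leq_addr.
by rewrite hypergeomG_jacobi // (theta_jacobi_prime pp).
Qed.
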